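(* Let $-1/2\leq m\leq 1$, $m\neq 0$, $s>1/2$, and put $\mu:=\min\{2\sqrt{1+m},\ \tfrac32\sqrt{4+m}\}$, $\varepsilon_0:=0.08\sqrt\mu$, and $\mathfrak c:=1$ if $m\ge 0$, $\mathfrak c:=(1+m)^{-1/2}$ if $-1/2\le m<0$. Let $u_0\in H^{s+2}_*$, $v_0\in H^{s}_*$, and set $$\varepsilon:=\max\Big\{|u_0|_1\,,\ \frac{|v_0|_0}{\sqrt{1+m}}\Big\},\qquad \varepsilon_1:=\min\left\{\varepsilon_0,\ \sqrt[4]{\frac{|m|\mu}{3222\,\mathfrak c^2}}\right\},\qquad T_1:=\frac{|m|\mu}{6595\,\mathfrak c^3\Big(1+30\frac{\mathfrak c}{|m|\mu}\varepsilon^2+90\frac{\mathfrak c}{\mu}\varepsilon^2\Big)}\,.$$ Assume $\varepsilon\le\varepsilon_1$. Then the weak solution $u(t,x)$ of the beam equation $$u_{tt}+u_{xxxx}-\Big(m+\frac1{2\pi}\int_0^\pi u_x^2\,dx\Big)u_{xx}=0$$ with hinged-hinged boundary conditions and initial data $u(0,x)=u_0(x)$, $u_t(0,x)=v_0(x)$ satisfies $$\sup_{x\in[0,\pi]}|u(t,x)|\leq 2.1\,\varepsilon\,,\qquad \forall\,|t|\leq T_1\,\varepsilon^{-6}\,.$$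
   Context: $\mathbb N=\{1,2,3,\dots\}$, $x\in[0,\pi]$, $t\in\mathbb R$, and $\phi_j(x):=\sqrt{2/\pi}\,\sin(jx)$ for $j\in\mathbb N$. For $s\ge 0$, $H^s_*$ is the Hilbert space of functions $u(x)=\sum_{j\in\mathbb N}u_j\phi_j(x)$, $u_j\in\mathbb R$, with finite norm $|u|_s:=\big(\sum_{j\in\mathbb N}u_j^2j^{2s}\big)^{1/2}$. The hinged-hinged boundary conditions are $u(t,0)=u(t,\pi)=u_{xx}(t,0)=u_{xx}(t,\pi)=0$. Weak solution: given an open interval of times $\mathcal I\ni 0$, $s>1/2$, and initial data $u_0\in H^{s+2}_*$, $v_0\in H^s_*$, a $C^2$ function $t\mapsto u(t,\cdot)\in H^{s+2}_*$ is a weak solution of the equation with data $(u_0,v_0)$ if $u(0,x)=u_0(x)$, $u_t(0,x)=v_0(x)$ and, for every test function $\eta\in C^\infty_c((0,\pi))$ and every $t\in\mathcal I$, $$\int_0^{\pi}\Big[u_{tt}\eta+u_{xx}\eta_{xx}+\Big(m+\frac 1{2\pi}\int_0^{\pi}u_x^2\,dx\Big) u_x \eta_x\Big]dx=0\,.$$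
   Formalization: Weak solutions are taken continuous into H^{s+2}, C^1 into H^s and C^2 into H^{s-2} (u_tt paired with test functions by duality), since C^2 into H^{s+2} is impossible for general v_0 in H^s; existence on an interval containing all |t| ≤ T_1 ε^{-6} is also asserted. *)

(* Defs.v *)
(* Stdlib's classical reals, with Coquelicot's limits, series and integrals. *)
From Stdlib Require Import Reals.
From Coquelicot Require Import Coquelicot.
Open Scope R_scope.

(* Modes j = 1, 2, 3, ... are enumerated by k : nat with j = k + 1. *)
Definition freq (k : nat) : R := INR (S k).

Definition phi (k : nat) (x : R) : R := sqrt (2 / PI) * sin (freq k * x).

(* An element of H^r_* is given by its coefficients in the basis phi. The index
   r may be negative: the second time derivative of a solution lives in
   H^{s-2}_*, whose elements are not functions in general. *)
Definition in_H (r : R) (c : nat -> R) : Prop :=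
  ex_series (fun k => c k ^ 2 * Rpower (freq k) (2 * r)).

Definition H_norm (r : R) (c : nat -> R) : R :=
  sqrt (Series (fun k => c k ^ 2 * Rpower (freq k) (2 * r))).

(* The function with coefficients c; the series converges absolutely as soon as
   c is in H^r_* with r > 1/2. *)
Definition fun_of (c : nat -> R) (x : R) : R :=
  Series (fun k => c k * phi k x).

Definition in_interval (a b : Rbar) (t : R) : Prop := Rbar_lt a t /\ Rbar_lt t b.

Definition H_continuous (r : R) (a b : Rbar) (u : R -> nat -> R) : Prop :=
  forall t, in_interval a b t ->
    in_H r (u t) /\
    is_lim (fun tau => H_norm r (fun k => u tau k - u t k)) t 0.

Definition H_derivative (r : R) (a b : Rbar) (u du : R -> nat -> R) : Prop :=
  forall t, in_interval a b t ->
    is_lim (fun h => H_norm r (fun k => (u (t + h) k - u t k) / h - du t k)) 0 0.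

Definition test_function (eta : R -> R) : Prop :=
  (forall (n : nat) (x : R), ex_derive_n eta n x) /\
  exists a b : R, 0 < a /\ b < PI /\ forall x, eta x <> 0 -> a <= x <= b.

(* The integral of w * eta over [0, PI], extended by duality to w in H^r_* with
   r < 0 (the coefficients of a test function decay fast enough for this); for
   w in L^2 it is the integral itself, by Parseval. *)
Definition pairing (w : nat -> R) (eta : R -> R) : R :=
  Series (fun k => w k * RInt (fun x => phi k x * eta x) 0 PI).

Definition hinged (f : R -> R) : Prop :=
  f 0 = 0 /\ f PI = 0 /\ Derive_n f 2 0 = 0 /\ Derive_n f 2 PI = 0.

Definition tension (m : R) (f : R -> R) : R :=
  m + 1 / (2 * PI) * RInt (fun x => Derive f x ^ 2) 0 PI.

(* Weak solution on the open time interval (a, b). A map of class C^2 with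
   values in H^{s+2}_* could only start from velocities in H^{s+2}_*, so the
   regularity asked for is the one matching data in H^{s+2}_* x H^s_*, namely
   C^0(H^{s+2}_* ) with first derivative in C^0(H^s_* ) and second derivative in
   C^0(H^{s-2}_* ); every C^2 map into H^{s+2}_* has it. The clause [hinged] is
   automatic in H^{s+2}_* because s > 1/2. *)
Definition weak_solution (m s : R) (a b : Rbar) (u0 v0 : nat -> R)
    (u : R -> nat -> R) : Prop :=
  in_interval a b 0 /\
  exists ut utt : R -> nat -> R,
    H_continuous (s + 2) a b u /\
    H_derivative s a b u ut /\ H_continuous s a b ut /\
    H_derivative (s - 2) a b ut utt /\ H_continuous (s - 2) a b utt /\
    (forall k, u 0 k = u0 k) /\ (forall k, ut 0 k = v0 k) /\
    (forall t, in_interval a b t -> hinged (fun_of (u t))) /\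
    (forall eta t, test_function eta -> in_interval a b t ->
       pairing (utt t) eta +
       RInt (fun x =>
               Derive_n (fun_of (u t)) 2 x * Derive_n eta 2 x +
               tension m (fun_of (u t)) *
                 (Derive (fun_of (u t)) x * Derive eta x)) 0 PI = 0).

Definition sup_abs (f : R -> R) : Rbar :=
  Lub_Rbar (fun y => exists x, 0 <= x <= PI /\ y = Rabs (f x)).

Definition mu (m : R) : R := Rmin (2 * sqrt (1 + m)) (3 / 2 * sqrt (4 + m)).

Definition eps0 (m : R) : R := 8 / 100 * sqrt (mu m).

Definition cfrak (m : R) : R := if Rle_dec 0 m then 1 else / sqrt (1 + m).

Definition epsilon (m : R) (u0 v0 : nat -> R) : R :=
  Rmax (H_norm 1 u0) (H_norm 0 v0 / sqrt (1 + m)).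

Definition eps1 (m : R) : R :=
  Rmin (eps0 m) (sqrt (sqrt (Rabs m * mu m / (3222 * cfrak m ^ 2)))).

Definition T1 (m eps : R) : R :=
  Rabs m * mu m /
  (6595 * cfrak m ^ 3 *
   (1 + 30 * (cfrak m / (Rabs m * mu m)) * eps ^ 2
      + 90 * (cfrak m / mu m) * eps ^ 2)).

(* |t| <= T1 * eps^(-6), with eps^(-6) = +infinity for eps = 0. *)
Definition within_time (m eps t : R) : Prop := Rabs t * eps ^ 6 <= T1 m eps.

(* Main.v *)
Require Import Defs.
From Stdlib Require Import Reals List Lra Lia ZArith.
From Coquelicot Require Import Coquelicot.
Open Scope R_scope.

(** On the sine modes the equation becomes an infinite system of oscillators
    u_k'' + om_k^2 u_k + kappa j^2 u_k = 0, with j = k + 1, om_k = j (j^2 + m)^(1/2),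
    coupled only through the scalar kappa = (1 / 2 pi) sum j^2 u_j^2.

    Sup bound. Put x_k = j u_k, y_k = j u_k' / om_k and N = sum (x_k^2 + y_k^2); N
    controls the sup norm of u and is at most 2 epsilon^2 initially. Instead of N one
    follows the comparable total action F = sum (x_k^2 + y_k^2) / g_k, g_k = j^2 / om_k.
    With z_k = x_k + i y_k its derivative is a sum over pairs of imaginary parts of
    z_k^2 z_l^2 and z_k^2 |z_l|^2, all of which rotate with nonzero frequency, so a
    correction of order four removes them ([corr4]). The remaining derivative, of
    order six, is a sum over triples of products of z^2, conj(z)^2 and |z|^2, again
    always an imaginary part because the flow is reversible. The frequencies are
    2 (om_i +- om_j +- om_l), or shorter combinations; since om_k is j^2 + m / 2 up to a
    small defect, they stay above 3 |m| / 5 even for Pythagorean triples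
    ([small_divisor]), and where a frequency vanishes identically the imaginary part
    vanishes too ([osc_nonresonant]). A correction of order six removes these terms
    at the cost of the factor 1 / |m| ([corr6], [prim3_derive]). What is left has order
    eight ([modified_action_derive]), so F moves by at most epsilon^2 / 4 during times
    |m| mu / (6595 epsilon^6) ([action_slow]), and a continuity argument closes the
    estimate of N ([mass_bound]). All corrections are finite sums over the first n
    modes; the modes beyond n enter only through their part of kappa, which tends to
    zero uniformly because every single mode obeys a Gronwall estimate with the same
    rate ([mode_growth]).

    Weak solutions. The coefficients of a weak solution solve the mode equations
    ([mode_equation]): dividing the equation by j^2 gives the sine series of a
    continuous function that vanishes at 0 and pi and is annihilated by second
    derivatives of test functions, and such a function is zero
    ([weakly_affine_zero]).

    Existence. With kappa capped at a level M the Duhamel map is a contraction in a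
    weighted norm in which each mode is measured against its initial size
    ([picard_solution]). The capped system conserves an energy that bounds kappa
    independently of M ([stretch_le]), so for large M the cap is never reached; the
    Gronwall estimate for single modes gives the regularity in time
    ([weak_solution_exists]). *)

(** * Rules of differentiation *)

Lemma is_derive_cast (f : R -> R) (t d d' : R) :
  is_derive f t d -> d = d' -> is_derive f t d'.
Proof. intros H <-; exact H. Qed.

Lemma is_derive_Rplus (f g : R -> R) (t df dg : R) :
  is_derive f t df -> is_derive g t dg ->
  is_derive (fun s => f s + g s) t (df + dg).
Proof. intros Hf Hg; exact (is_derive_plus f g t df dg Hf Hg). Qed.

Lemma is_derive_Rminus (f g : R -> R) (t df dg : R) :
  is_derive f t df -> is_derive g t dg ->
  is_derive (fun s => f s - g s) t (df - dg).
Proof. intros Hf Hg; exact (is_derive_minus f g t df dg Hf Hg). Qed.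

Lemma is_derive_Rmult (f g : R -> R) (t df dg : R) :
  is_derive f t df -> is_derive g t dg ->
  is_derive (fun s => f s * g s) t (df * g t + f t * dg).
Proof.
intros Hf Hg; exact (is_derive_mult f g t df dg Hf Hg Rmult_comm).
Qed.

Lemma is_derive_Rscal (f : R -> R) (c t df : R) :
  is_derive f t df -> is_derive (fun s => c * f s) t (c * df).
Proof. intros Hf; exact (is_derive_scal f t c df Hf). Qed.

Lemma is_derive_Rconst (c t : R) : is_derive (fun _ => c) t 0.
Proof. exact (is_derive_const (V := R_NormedModule) c t). Qed.

Lemma is_derive_continuous (f : R -> R) (t d : R) :
  is_derive f t d -> continuous f t.
Proof.
intros H. apply (ex_derive_continuous (V := R_NormedModule)). now exists d.
Qed.

Lemma MVT_R (f df : R -> R) (a b : R) :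
  (forall x, Rmin a b <= x <= Rmax a b -> is_derive f x (df x)) ->
  exists x, Rmin a b <= x <= Rmax a b /\ f b - f a = df x * (b - a).
Proof.
intros H. apply MVT_gen.
- intros x Hx; apply H; lra.
- intros x Hx. apply continuity_pt_filterlim. eapply is_derive_continuous, H, Hx.
Qed.

Ltac derive_poly :=
  lazymatch goal with
  | |- is_derive (fun r => @?f r - @?g r) _ _ => apply (is_derive_Rminus f g); derive_poly
  | |- is_derive (fun r => @?f r + @?g r) _ _ => apply (is_derive_Rplus f g); derive_poly
  | |- is_derive (fun r => @?f r * @?g r) _ _ => apply (is_derive_Rmult f g); derive_poly
  | |- _ =>
      match goal with
      | H : is_derive ?a ?t _ |- is_derive (fun r => ?a r) ?t _ => exact H
      | H : forall k, is_derive (?a k) ?t _ |- is_derive (fun r => ?a ?k r) ?t _ =>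
          exact (H k)
      | |- _ => apply is_derive_Rconst
      end
  end.

(** * Finite sums over lists *)

Definition lsum {A : Type} (l : list A) (f : A -> R) : R :=
  fold_right (fun a s => f a + s) 0 l.

Section ListSums.
Context {A B : Type}.
Implicit Types (l : list A) (f g : A -> R).

Lemma lsum_ext l f g : (forall a, f a = g a) -> lsum l f = lsum l g.
Proof. intros H; induction l as [|a l IH]; simpl; [easy|]. now rewrite H, IH. Qed.

Lemma lsum_plus l f g : lsum l (fun a => f a + g a) = lsum l f + lsum l g.
Proof. induction l as [|a l IH]; simpl; [ring|]. rewrite IH; ring. Qed.

Lemma lsum_scal l c f : lsum l (fun a => c * f a) = c * lsum l f.
Proof. induction l as [|a l IH]; simpl; [ring|]. rewrite IH; ring. Qed.

Lemma lsum_scal_r l c f : lsum l (fun a => f a * c) = lsum l f * c.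
Proof. induction l as [|a l IH]; simpl; [ring|]. rewrite IH; ring. Qed.

Lemma lsum_ge0 l f : (forall a, 0 <= f a) -> 0 <= lsum l f.
Proof.
intros H; induction l as [|a l IH]; simpl; [lra|]. specialize (H a); lra.
Qed.

Lemma lsum_Rabs_le l f g :
  (forall a, Rabs (f a) <= g a) -> Rabs (lsum l f) <= lsum l g.
Proof.
intros H; induction l as [|a l IH]; simpl; [rewrite Rabs_R0; lra|].
eapply Rle_trans; [apply Rabs_triang|]. specialize (H a); lra.
Qed.

Lemma is_derive_lsum l (f : A -> R -> R) (df : A -> R) (t : R) :
  (forall a, is_derive (f a) t (df a)) ->
  is_derive (fun s => lsum l (fun a => f a s)) t (lsum l df).
Proof.
intros H; induction l as [|a l IH]; simpl.
- apply is_derive_Rconst.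
- apply is_derive_Rplus; [apply H | apply IH].
Qed.
End ListSums.

Lemma lsum_swap {A B : Type} (l : list A) (l' : list B) (h : A -> B -> R) :
  lsum l (fun a => lsum l' (h a)) = lsum l' (fun b => lsum l (fun a => h a b)).
Proof.
induction l as [|a l IH]; simpl.
- induction l' as [|b l' IH']; simpl; [easy|]. rewrite <- IH'; ring.
- now rewrite IH, <- lsum_plus.
Qed.

(** * Products of three oscillators *)

(** Real and imaginary part of q1 q2 q3, where q2 or q3 is conjugated when its sign
    is -1. *)
Definition re3 (s t a1 b1 a2 b2 a3 b3 : R) : R :=
  a1 * a2 * a3 - s * t * (a1 * b2 * b3) - s * (b1 * b2 * a3) - t * (b1 * a2 * b3).

Definition im3 (s t a1 b1 a2 b2 a3 b3 : R) : R :=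
  b1 * a2 * a3 + s * (a1 * b2 * a3) + t * (a1 * a2 * b3) - s * t * (b1 * b2 * b3).

(** A complex amplitude a + i b of frequency th, perturbed at order kap. Real
    conserved quantities are the case th = 0, b = 0; they enter products on the
    same footing as rotating amplitudes. *)
Record oscillator (t kap G : R) (a b : R -> R) (th nu : R) : Prop := {
  osc_da : exists e, is_derive a t (th * b t + kap * e) /\ Rabs e <= 2 * G * nu;
  osc_db : exists e, is_derive b t (- th * a t + kap * e) /\ Rabs e <= 2 * G * nu;
  osc_a : Rabs (a t) <= nu;
  osc_b : Rabs (b t) <= nu }.

Definition prim3 (th1 th2 th3 a1 b1 a2 b2 a3 b3 : R) : R :=
  / 4 * (re3 1 1 a1 b1 a2 b2 a3 b3 * / (th1 + th2 + th3) +
         re3 1 (-1) a1 b1 a2 b2 a3 b3 * / (th1 + th2 - th3) +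
         re3 (-1) 1 a1 b1 a2 b2 a3 b3 * / (th1 - th2 + th3) +
         re3 (-1) (-1) a1 b1 a2 b2 a3 b3 * / (th1 - th2 - th3)).

Lemma Rabs_mult3_le (x y z X Y Z : R) :
  Rabs x <= X -> Rabs y <= Y -> Rabs z <= Z -> Rabs (x * y * z) <= X * Y * Z.
Proof.
intros Hx Hy Hz; rewrite !Rabs_mult.
apply Rmult_le_compat; try apply Rabs_pos; auto.
- apply Rmult_le_pos; apply Rabs_pos.
- apply Rmult_le_compat; auto using Rabs_pos.
Qed.

Lemma Rabs_add_le (x y X Y : R) :
  Rabs x <= X -> Rabs y <= Y -> Rabs (x + y) <= X + Y.
Proof. intros; eapply Rle_trans; [apply Rabs_triang | lra]. Qed.

Lemma Rabs_sub_le (x y X Y : R) :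
  Rabs x <= X -> Rabs y <= Y -> Rabs (x - y) <= X + Y.
Proof.
intros; unfold Rminus; apply Rabs_add_le; auto. now rewrite Rabs_Ropp.
Qed.

Definition is_sign (s : R) : Prop := s = 1 \/ s = -1.

Lemma is_sign_Rabs s : is_sign s -> Rabs s = 1.
Proof. intros [-> | ->]; unfold Rabs; destruct Rcase_abs; lra. Qed.

Lemma is_sign_mult s t : is_sign s -> is_sign t -> is_sign (s * t).
Proof. unfold is_sign; intros [-> | ->] [-> | ->]; lra. Qed.

Lemma is_sign_scale (s x X : R) : is_sign s -> Rabs x <= X -> Rabs (s * x) <= X.
Proof. intros Hs Hx; rewrite Rabs_mult, (is_sign_Rabs s Hs); lra. Qed.

Lemma re3_le (s t a1 b1 a2 b2 a3 b3 n1 n2 n3 : R) :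
  is_sign s -> is_sign t ->
  Rabs a1 <= n1 -> Rabs b1 <= n1 -> Rabs a2 <= n2 -> Rabs b2 <= n2 ->
  Rabs a3 <= n3 -> Rabs b3 <= n3 ->
  Rabs (re3 s t a1 b1 a2 b2 a3 b3) <= 4 * (n1 * n2 * n3).
Proof.
intros Hs Ht Ha1 Hb1 Ha2 Hb2 Ha3 Hb3; unfold re3.
replace (4 * (n1 * n2 * n3)) with
  (n1 * n2 * n3 + n1 * n2 * n3 + n1 * n2 * n3 + n1 * n2 * n3) by ring.
apply Rabs_sub_le; [apply Rabs_sub_le; [apply Rabs_sub_le |] |];
  try (apply is_sign_scale; [now (try apply is_sign_mult) |]);
  now apply Rabs_mult3_le.
Qed.

Lemma re3_derive (s sg tau kap G th1 th2 th3 n1 n2 n3 : R)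
    (a1 b1 a2 b2 a3 b3 : R -> R) :
  is_sign sg -> is_sign tau ->
  oscillator s kap G a1 b1 th1 n1 -> oscillator s kap G a2 b2 th2 n2 ->
  oscillator s kap G a3 b3 th3 n3 ->
  exists e,
    is_derive (fun r => re3 sg tau (a1 r) (b1 r) (a2 r) (b2 r) (a3 r) (b3 r)) s
      ((th1 + sg * th2 + tau * th3) *
         im3 sg tau (a1 s) (b1 s) (a2 s) (b2 s) (a3 s) (b3 s) + kap * e) /\
    Rabs e <= 24 * G * (n1 * n2 * n3).
Proof.
intros Hsg Htau [[ea1 [Ha1 Ea1]] [eb1 [Hb1 Eb1]] A1 B1]
  [[ea2 [Ha2 Ea2]] [eb2 [Hb2 Eb2]] A2 B2] [[ea3 [Ha3 Ea3]] [eb3 [Hb3 Eb3]] A3 B3].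
exists (re3 sg tau ea1 eb1 (a2 s) (b2 s) (a3 s) (b3 s) +
        re3 sg tau (a1 s) (b1 s) ea2 eb2 (a3 s) (b3 s) +
        re3 sg tau (a1 s) (b1 s) (a2 s) (b2 s) ea3 eb3); split.
- eapply is_derive_cast.
  + unfold re3.
    derive_poly.
  + unfold re3, im3.
    destruct Hsg as [-> | ->]; destruct Htau as [-> | ->]; ring.
- replace (24 * G * (n1 * n2 * n3)) with
    (4 * (2 * G * n1 * n2 * n3) + 4 * (n1 * (2 * G * n2) * n3) +
     4 * (n1 * n2 * (2 * G * n3))) by ring.
  repeat apply Rabs_add_le; apply re3_le; auto.
Qed.

(** Each sign pattern rotates with its own frequency, so dividing its real part by
    that frequency gives a primitive of its imaginary part, and the four patterns
    average to b1 a2 a3. A pattern whose frequency vanishes is harmless when its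
    imaginary part vanishes too, because the inverse of zero is zero. *)
Lemma prim3_derive (s kap G del th1 th2 th3 n1 n2 n3 : R)
    (a1 b1 a2 b2 a3 b3 : R -> R) :
  0 < del -> 0 <= G ->
  oscillator s kap G a1 b1 th1 n1 -> oscillator s kap G a2 b2 th2 n2 ->
  oscillator s kap G a3 b3 th3 n3 ->
  (forall sg tau, is_sign sg -> is_sign tau ->
     del <= Rabs (th1 + sg * th2 + tau * th3) \/
     (th1 + sg * th2 + tau * th3 = 0 /\
      im3 sg tau (a1 s) (b1 s) (a2 s) (b2 s) (a3 s) (b3 s) = 0)) ->
  (exists e,
    is_derive (fun r => prim3 th1 th2 th3 (a1 r) (b1 r) (a2 r) (b2 r) (a3 r) (b3 r)) s
      (b1 s * a2 s * a3 s + kap * e) /\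
    Rabs e <= 24 * G / del * (n1 * n2 * n3)) /\
  Rabs (prim3 th1 th2 th3 (a1 s) (b1 s) (a2 s) (b2 s) (a3 s) (b3 s)) <=
    4 / del * (n1 * n2 * n3).
Proof.
intros Hdel HG O1 O2 O3 Hdiv.
assert (Hn1 : 0 <= n1) by (eapply Rle_trans; [apply Rabs_pos | apply (osc_a _ _ _ _ _ _ _ O1)]).
assert (Hn2 : 0 <= n2) by (eapply Rle_trans; [apply Rabs_pos | apply (osc_a _ _ _ _ _ _ _ O2)]).
assert (Hn3 : 0 <= n3) by (eapply Rle_trans; [apply Rabs_pos | apply (osc_a _ _ _ _ _ _ _ O3)]).
assert (S1 : is_sign 1) by now left.
assert (S2 : is_sign (-1)) by now right.
assert (Hinv : forall x, del <= Rabs x \/ x = 0 -> Rabs (/ x) <= / del).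
{ intros x [Hx | ->].
  - rewrite Rabs_inv. apply Rinv_le_contravar; auto.
  - rewrite Rinv_0, Rabs_R0. left; now apply Rinv_0_lt_compat. }
assert (Hone : forall sg tau, is_sign sg -> is_sign tau ->
  let th := th1 + sg * th2 + tau * th3 in
  (exists e,
    is_derive (fun r => re3 sg tau (a1 r) (b1 r) (a2 r) (b2 r) (a3 r) (b3 r) * / th) s
      (im3 sg tau (a1 s) (b1 s) (a2 s) (b2 s) (a3 s) (b3 s) + kap * e) /\
    Rabs e <= 24 * G / del * (n1 * n2 * n3)) /\
  Rabs (re3 sg tau (a1 s) (b1 s) (a2 s) (b2 s) (a3 s) (b3 s) * / th) <=
    4 / del * (n1 * n2 * n3)).
{ intros sg tau Hsg Htau th.
  destruct (re3_derive s sg tau kap G th1 th2 th3 n1 n2 n3 a1 b1 a2 b2 a3 b3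
              Hsg Htau O1 O2 O3) as [e [He Be]].
  specialize (Hdiv sg tau Hsg Htau). fold th in Hdiv, He.
  assert (Hi : Rabs (/ th) <= / del) by (apply Hinv; tauto).
  split.
  - exists (e * / th); split.
    + eapply is_derive_cast.
      * apply is_derive_Rmult; [exact He | apply is_derive_Rconst].
      * destruct Hdiv as [Hd | [Hd1 Hd2]].
        -- assert (th <> 0) by (intros E; rewrite E, Rabs_R0 in Hd; lra).
           field; auto.
        -- rewrite Hd1, Hd2, Rinv_0; ring.
    + rewrite Rabs_mult.
      replace (24 * G / del * (n1 * n2 * n3)) with
        ((24 * G * (n1 * n2 * n3)) * / del) by (field; lra).
      apply Rmult_le_compat; auto using Rabs_pos.
  - rewrite Rabs_mult.
    replace (4 / del * (n1 * n2 * n3)) with ((4 * (n1 * n2 * n3)) * / del) by (field; lra).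
    apply Rmult_le_compat; auto using Rabs_pos.
    destruct O1, O2, O3; apply re3_le; auto. }
assert (H1 := Hone 1 1 S1 S1). assert (H2 := Hone 1 (-1) S1 S2).
assert (H3 := Hone (-1) 1 S2 S1). assert (H4 := Hone (-1) (-1) S2 S2).
cbv zeta in H1, H2, H3, H4.
replace (th1 + 1 * th2 + 1 * th3) with (th1 + th2 + th3) in H1 by ring.
replace (th1 + 1 * th2 + -1 * th3) with (th1 + th2 - th3) in H2 by ring.
replace (th1 + -1 * th2 + 1 * th3) with (th1 - th2 + th3) in H3 by ring.
replace (th1 + -1 * th2 + -1 * th3) with (th1 - th2 - th3) in H4 by ring.
destruct H1 as [[e1 [D1 E1]] P1], H2 as [[e2 [D2 E2]] P2],
  H3 as [[e3 [D3 E3]] P3], H4 as [[e4 [D4 E4]] P4].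
split.
- exists (/ 4 * (e1 + e2 + e3 + e4)); split.
  + eapply is_derive_cast.
    * unfold prim3. apply is_derive_Rscal.
      do 3 (apply is_derive_Rplus; [| eassumption]); eassumption.
    * unfold im3; field.
  + rewrite Rabs_mult, (Rabs_pos_eq (/ 4)) by lra.
    assert (Rabs (e1 + e2 + e3 + e4) <= 4 * (24 * G / del * (n1 * n2 * n3))); [|lra].
    eapply Rle_trans; [repeat apply Rabs_add_le; eassumption | lra].
- unfold prim3. rewrite Rabs_mult, (Rabs_pos_eq (/ 4)) by lra.
  match goal with |- / 4 * Rabs ?X <= _ =>
    assert (Rabs X <= 4 * (4 / del * (n1 * n2 * n3))); [|lra] end.
  eapply Rle_trans; [repeat apply Rabs_add_le; eassumption | lra].
Qed.

(** * Normal form for finitely many modes *)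

(** Every mode k gives two oscillators: (k, true) is (x + i y)^2, of frequency 2 om,
    and (k, false) is x^2 + y^2, of frequency 0. Their real parts add up to 2 x^2, so
    the coupling is linear in them. *)
Definition doubled (L : list nat) : list (nat * bool) :=
  flat_map (fun k => (k, true) :: (k, false) :: nil) L.

Lemma lsum_doubled (L : list nat) (f : nat * bool -> R) :
  lsum (doubled L) f = lsum L (fun k => f (k, true) + f (k, false)).
Proof. induction L as [|k L IH]; simpl; [easy|]. rewrite IH; ring. Qed.

Lemma lsum_Rabs_scal {A : Type} (l : list A) (f nu : A -> R) (K : R) :
  (forall a, Rabs (f a) <= K * nu a) -> Rabs (lsum l f) <= K * lsum l nu.
Proof. intros H; rewrite <- lsum_scal; now apply lsum_Rabs_le. Qed.

(** The divisors of products of three oscillators; with two, respectively one, factor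
    of frequency 0 they reduce to a single mode and a difference of two modes. *)
Record nonresonant (om g : nat -> R) (G mu del : R) : Prop := {
  nonres_gain : forall k, 0 < g k <= G;
  nonres_low : forall k, mu <= 2 * om k;
  nonres_single : forall k, del <= 2 * om k;
  nonres_difference : forall k l, k <> l -> del <= Rabs (2 * om k - 2 * om l);
  nonres_triple : forall i j l, del <= Rabs (2 * om i + 2 * om j - 2 * om l) }.

Section TruncatedModes.

Variables (L : list nat) (x y : nat -> R -> R) (om g : nat -> R).
Variables (c G mu del : R).
Hypothesis (Hc : 0 < c) (HG : 0 < G) (Hmu : 0 < mu) (Hdel : 0 < del).
Hypothesis Hnr : nonresonant om g G mu del.
Let Hg := nonres_gain _ _ _ _ _ Hnr.
Let Hom := nonres_low _ _ _ _ _ Hnr.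
Let Hdel1 := nonres_single _ _ _ _ _ Hnr.
Let Hdel2 := nonres_difference _ _ _ _ _ Hnr.
Let Hdel3 := nonres_triple _ _ _ _ _ Hnr.

Local Notation index := (nat * bool)%type.

Definition osc_re (al : index) (r : R) : R :=
  if snd al then x (fst al) r * x (fst al) r - y (fst al) r * y (fst al) r
  else x (fst al) r * x (fst al) r + y (fst al) r * y (fst al) r.
Definition osc_im (al : index) (r : R) : R :=
  if snd al then 2 * (x (fst al) r * y (fst al) r) else 0.
Definition osc_freq (al : index) : R := if snd al then 2 * om (fst al) else 0.
Definition osc_size (al : index) (r : R) : R := x (fst al) r * x (fst al) r + y (fst al) r * y (fst al) r.

Definition osc_force_re (al : index) (r : R) : R :=
  if snd al then g (fst al) * osc_im (fst al, true) r
  else - g (fst al) * osc_im (fst al, true) r.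
Definition osc_force_im (al : index) (r : R) : R :=
  if snd al
  then - g (fst al) * (osc_re (fst al, true) r + osc_re (fst al, false) r)
  else 0.

Definition mass (r : R) : R := lsum L (fun k => osc_size (k, true) r).

(** Twice the sum of the actions of the uncoupled oscillators. Unlike [mass] it
    Poisson commutes with z_k^2 conj(z_l)^2, so no difference of frequencies appears
    at order four. *)
Definition action (r : R) : R := lsum L (fun k => osc_size (k, true) r * / g k).

(** Two oscillators of frequency 0 get weight 0; their product has no imaginary part
    to be removed. *)
Definition weight (al be : index) : R := / (osc_freq al + osc_freq be).

Definition corr4 (r : R) : R :=
  c / 4 * lsum (doubled L) (fun al => lsum (doubled L) (fun be =>
    (osc_re al r * osc_re be r - osc_im al r * osc_im be r) * weight al be)).

Definition osc_prim (al be ga : index) (r : R) : R :=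
  prim3 (osc_freq al) (osc_freq be) (osc_freq ga)
    (osc_re al r) (osc_im al r) (osc_re be r) (osc_im be r)
    (osc_re ga r) (osc_im ga r).

(** A primitive, up to higher order, of the real part of the force on al times be,
    multiplied by the real part of ga: the force is again linear in the two
    oscillators of its mode. *)
Definition corr6_term (al be ga : index) (r : R) : R :=
  if snd al then
    g (fst al) * (osc_prim (fst al, true) be ga r +
                  osc_prim be (fst al, true) ga r +
                  osc_prim be (fst al, false) ga r)
  else - g (fst al) * osc_prim (fst al, true) be ga r.

Definition corr6 (r : R) : R :=
  - (c ^ 2 / 4) * lsum (doubled L) (fun al => lsum (doubled L) (fun be =>
    lsum (doubled L) (fun ga => weight al be * corr6_term al be ga r))).

Variables (t kap : R).
Hypothesis (Hx : forall k, is_derive (x k) t (om k * y k t)).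
Hypothesis (Hy : forall k,
  is_derive (y k) t (- om k * x k t - kap * g k * x k t)).

Lemma osc_re_derive al :
  is_derive (osc_re al) t
    (osc_freq al * osc_im al t + kap * osc_force_re al t).
Proof.
destruct al as [k b]; unfold osc_re, osc_freq, osc_im, osc_force_re; simpl.
destruct b; simpl; (eapply is_derive_cast;
  [derive_poly | unfold osc_im; simpl; ring]).
Qed.

Lemma osc_im_derive al :
  is_derive (osc_im al) t
    (- osc_freq al * osc_re al t + kap * osc_force_im al t).
Proof.
destruct al as [k b]; unfold osc_freq, osc_im, osc_force_im; simpl.
destruct b; simpl; (eapply is_derive_cast;
  [derive_poly | unfold osc_re; simpl; ring]).
Qed.

Lemma osc_size_ge0 al : 0 <= osc_size al t.
Proof. unfold osc_size; nra. Qed.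

Lemma osc_re_le al : Rabs (osc_re al t) <= osc_size al t.
Proof.
unfold osc_re, osc_size; destruct (snd al); apply Rabs_le; nra.
Qed.

Lemma osc_im_le al : Rabs (osc_im al t) <= osc_size al t.
Proof.
unfold osc_im, osc_size.
assert (H1 := Rle_0_sqr (x (fst al) t + y (fst al) t)).
assert (H2 := Rle_0_sqr (x (fst al) t - y (fst al) t)). unfold Rsqr in *.
destruct (snd al); apply Rabs_le; lra.
Qed.

Lemma osc_force_re_le al : Rabs (osc_force_re al t) <= G * osc_size al t.
Proof.
assert (H := osc_im_le (fst al, true)). destruct al as [k b].
unfold osc_force_re; simpl in *. pose proof (Hg k) as [H1 H2].
change (osc_size (k, true) t) with (osc_size (k, b) t) in H.
assert (H3 : Rabs (g k * osc_im (k, true) t) <= G * osc_size (k, b) t).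
{ rewrite Rabs_mult, (Rabs_pos_eq (g k)) by lra.
  apply Rmult_le_compat; auto using Rabs_pos; lra. }
destruct b; [exact H3|].
replace (- g k * osc_im (k, true) t) with (- (g k * osc_im (k, true) t)) by ring.
now rewrite Rabs_Ropp.
Qed.

Lemma osc_force_im_le al : Rabs (osc_force_im al t) <= 2 * G * osc_size al t.
Proof.
assert (H := osc_size_ge0 al).
destruct al as [k b]; unfold osc_force_im; simpl. pose proof (Hg k) as [H1 H2].
destruct b.
- unfold osc_re; simpl.
  replace (- g k * _) with (- (g k * (2 * (x k t ^ 2)))) by (simpl; ring).
  rewrite Rabs_Ropp, Rabs_pos_eq by nra.
  unfold osc_size in *; simpl in *.
  replace (2 * G * (x k t * x k t + y k t * y k t)) with
    (G * (2 * (x k t ^ 2)) + G * (2 * (y k t ^ 2))) by ring.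
  assert (0 <= G * (2 * y k t ^ 2)) by nra.
  assert (g k * (2 * x k t ^ 2) <= G * (2 * x k t ^ 2)) by nra. simpl in *; lra.
- rewrite Rabs_R0; nra.
Qed.

Lemma osc_oscillator al :
  oscillator t kap G (osc_re al) (osc_im al) (osc_freq al) (osc_size al t).
Proof.
assert (H := osc_size_ge0 al).
split.
- exists (osc_force_re al t); split; [apply osc_re_derive|].
  assert (H1 := osc_force_re_le al). nra.
- exists (osc_force_im al t); split; [apply osc_im_derive | apply osc_force_im_le].
- apply osc_re_le.
- apply osc_im_le.
Qed.

(** The only exact resonances pair a mode with its own conjugate; there the
    imaginary part of the product is zero. *)
Lemma osc_nonresonant al be ga sg tau :
  is_sign sg -> is_sign tau ->
  del <= Rabs (osc_freq al + sg * osc_freq be + tau * osc_freq ga) \/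
  (osc_freq al + sg * osc_freq be + tau * osc_freq ga = 0 /\
   im3 sg tau (osc_re al t) (osc_im al t) (osc_re be t) (osc_im be t)
     (osc_re ga t) (osc_im ga t) = 0).
Proof.
assert (Hp : forall z, del <= z -> del <= Rabs z) by
  (intros z Hz; eapply Rle_trans; [exact Hz | apply Rle_abs]).
assert (Hn : forall z, del <= - z -> del <= Rabs z) by
  (intros z Hz; rewrite <- Rabs_Ropp; eapply Rle_trans; [exact Hz | apply Rle_abs]).
assert (Hopp : forall z w, z = - w -> Rabs z = Rabs w) by
  (intros z w ->; apply Rabs_Ropp).
intros Hs Ht.
destruct al as [i b1], be as [j b2], ga as [l b3].
assert (Hi := Hdel1 i). assert (Hj := Hdel1 j). assert (Hl := Hdel1 l).
unfold osc_freq, osc_im; simpl.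
destruct b1, b2, b3; simpl.
- left.
  destruct Hs as [-> | ->]; destruct Ht as [-> | ->].
  + apply Hp; lra.
  + replace (_ + _ + _) with (2 * om i + 2 * om j - 2 * om l) by ring. apply Hdel3.
  + replace (_ + _ + _) with (2 * om i + 2 * om l - 2 * om j) by ring. apply Hdel3.
  + rewrite (Hopp _ (2 * om j + 2 * om l - 2 * om i)) by ring. apply Hdel3.
- destruct Hs as [-> | ->]; [left; apply Hp; lra|].
  destruct (PeanoNat.Nat.eq_dec i j) as [-> | Hij].
  + right; split; [ring | unfold im3, osc_re; simpl; ring].
  + left. replace (_ + _ + _) with (2 * om i - 2 * om j) by ring. now apply Hdel2.
- destruct Ht as [-> | ->]; [left; apply Hp; lra|].
  destruct (PeanoNat.Nat.eq_dec i l) as [-> | Hij].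
  + right; split; [ring | unfold im3, osc_re; simpl; ring].
  + left. replace (_ + _ + _) with (2 * om i - 2 * om l) by ring. now apply Hdel2.
- left; apply Hp; lra.
- destruct (PeanoNat.Nat.eq_dec j l) as [-> | Hjl].
  + destruct Hs as [-> | ->]; destruct Ht as [-> | ->];
      try (left; apply Hp; lra); try (left; apply Hn; lra);
      (right; split; [ring | unfold im3, osc_re; simpl; ring]).
  + left. destruct Hs as [-> | ->]; destruct Ht as [-> | ->];
      try (apply Hp; lra); try (apply Hn; lra).
    * replace (_ + _ + _) with (2 * om j - 2 * om l) by ring. now apply Hdel2.
    * rewrite (Hopp _ (2 * om j - 2 * om l)) by ring. now apply Hdel2.
- left; destruct Hs as [-> | ->]; [apply Hp; lra | apply Hn; lra].
- left; destruct Ht as [-> | ->]; [apply Hp; lra | apply Hn; lra].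
- right; split; [ring | unfold im3, osc_re; simpl; ring].
Qed.

Lemma osc_prim_derive al be ga :
  (exists e,
    is_derive (osc_prim al be ga) t
      (osc_im al t * osc_re be t * osc_re ga t + kap * e) /\
    Rabs e <= 24 * G / del * (osc_size al t * osc_size be t * osc_size ga t)) /\
  Rabs (osc_prim al be ga t) <=
    4 / del * (osc_size al t * osc_size be t * osc_size ga t).
Proof.
apply (prim3_derive t kap G del); auto using osc_oscillator, osc_nonresonant; lra.
Qed.

Lemma weight_le al be : Rabs (weight al be) <= / mu.
Proof.
assert (Hp : forall z, mu <= z -> Rabs (/ z) <= / mu).
{ intros z Hz; rewrite Rabs_inv, Rabs_pos_eq by lra.
  apply Rinv_le_contravar; lra. }
unfold weight, osc_freq.
assert (H1 := Hom (fst al)). assert (H2 := Hom (fst be)).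
destruct (snd al), (snd be); try (apply Hp; lra).
rewrite Rplus_0_r, Rinv_0, Rabs_R0; left; now apply Rinv_0_lt_compat.
Qed.

Lemma weight_sym al be : weight al be = weight be al.
Proof. unfold weight; now rewrite Rplus_comm. Qed.

Lemma weight_cancel al be :
  (osc_freq al + osc_freq be) *
    (osc_im al t * osc_re be t + osc_re al t * osc_im be t) * weight al be =
  osc_im al t * osc_re be t + osc_re al t * osc_im be t.
Proof.
unfold weight, osc_freq, osc_im.
assert (H1 := Hom (fst al)). assert (H2 := Hom (fst be)).
destruct (snd al), (snd be); try (field; lra). ring.
Qed.

Lemma corr6_term_derive al be ga :
  (exists e,
    is_derive (corr6_term al be ga) t
      ((osc_force_re al t * osc_re be t - osc_force_im al t * osc_im be t) *
         osc_re ga t + kap * e) /\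
    Rabs e <= 72 * G ^ 2 / del * (osc_size al t * osc_size be t * osc_size ga t)) /\
  Rabs (corr6_term al be ga t) <=
    12 * G / del * (osc_size al t * osc_size be t * osc_size ga t).
Proof.
destruct al as [k b]. pose proof (Hg k) as [Hg1 Hg2].
destruct (osc_prim_derive (k, true) be ga) as [[e1 [D1 E1]] P1].
destruct (osc_prim_derive be (k, true) ga) as [[e2 [D2 E2]] P2].
destruct (osc_prim_derive be (k, false) ga) as [[e3 [D3 E3]] P3].
change (osc_size (k, true) t) with (osc_size (k, b) t) in *.
change (osc_size (k, false) t) with (osc_size (k, b) t) in *.
rewrite (Rmult_comm (osc_size be t) (osc_size (k, b) t)) in E2, E3, P2, P3.
set (n := osc_size (k, b) t * osc_size be t * osc_size ga t) in *.
assert (Hn : 0 <= n) by (repeat apply Rmult_le_pos; apply osc_size_ge0).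
clearbody n.
assert (Hd : 0 < / del) by now apply Rinv_0_lt_compat.
assert (Hgs : forall z Z, Rabs z <= Z -> Rabs (g k * z) <= G * Z).
{ intros z Z HZ; rewrite Rabs_mult, (Rabs_pos_eq (g k)) by lra.
  apply Rmult_le_compat; auto using Rabs_pos; lra. }
assert (HGn : 0 <= G * G * n * / del) by (repeat apply Rmult_le_pos; lra).
assert (HGn' : 0 <= G * n * / del) by (repeat apply Rmult_le_pos; lra).
unfold corr6_term, osc_force_re, osc_force_im; simpl snd; simpl fst.
destruct b; (split; [eexists; split; [eapply is_derive_cast;
  [first [exact (is_derive_Rscal _ _ _ _
       (is_derive_Rplus _ _ _ _ _ (is_derive_Rplus _ _ _ _ _ D1 D2) D3)) |
          exact (is_derive_Rscal _ _ _ _ D1)] |] |] |]).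
- instantiate (1 := g k * (e1 + e2 + e3)). ring.
- eapply Rle_trans; [apply Hgs; repeat apply Rabs_add_le; eassumption|].
  right; field; lra.
- eapply Rle_trans; [apply Hgs; repeat apply Rabs_add_le; eassumption|].
  right; field; lra.
- instantiate (1 := - (g k * e1)). ring.
- rewrite Rabs_Ropp. eapply Rle_trans; [apply Hgs; eassumption|].
  replace (G * (24 * G / del * n)) with (24 * (G * G * n * / del)) by (field; lra).
  replace (72 * G ^ 2 / del * n) with (72 * (G * G * n * / del)) by (field; lra).
  lra.
- replace (- g k * _) with (- (g k * osc_prim (k, true) be ga t)) by ring.
  rewrite Rabs_Ropp. eapply Rle_trans; [apply Hgs; eassumption|].
  replace (G * (4 / del * n)) with (4 * (G * n * / del)) by (field; lra).
  replace (12 * G / del * n) with (12 * (G * n * / del)) by (field; lra).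
  lra.
Qed.

Lemma lsum_size : lsum (doubled L) (fun al => osc_size al t) = 2 * mass t.
Proof.
rewrite lsum_doubled. unfold mass; rewrite <- lsum_scal.
apply lsum_ext; intros k; unfold osc_size; simpl; ring.
Qed.

Lemma mass_ge0 : 0 <= mass t.
Proof. apply lsum_ge0; intros k; apply osc_size_ge0. Qed.

Lemma lsum_re : lsum (doubled L) (fun al => osc_re al t) =
  2 * lsum L (fun k => x k t ^ 2).
Proof.
rewrite lsum_doubled, <- lsum_scal.
apply lsum_ext; intros k; unfold osc_re; simpl; ring.
Qed.

Lemma lsum2_le (f : index -> index -> R) (K : R) :
  0 <= K ->
  (forall al be, Rabs (f al be) <= K * (osc_size al t * osc_size be t)) ->
  Rabs (lsum (doubled L) (fun al => lsum (doubled L) (f al))) <=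
    4 * K * mass t ^ 2.
Proof.
intros HK H.
replace (4 * K * mass t ^ 2) with (K * (2 * mass t) * (2 * mass t)) by ring.
rewrite <- lsum_size at 2. apply lsum_Rabs_scal; intros al.
replace (K * (2 * mass t) * osc_size al t) with
  (K * osc_size al t * (2 * mass t)) by ring.
rewrite <- lsum_size. apply lsum_Rabs_scal; intros be.
rewrite Rmult_assoc; apply H.
Qed.

Lemma lsum3_le (f : index -> index -> index -> R) (K : R) :
  0 <= K ->
  (forall al be ga,
     Rabs (f al be ga) <= K * (osc_size al t * osc_size be t * osc_size ga t)) ->
  Rabs (lsum (doubled L) (fun al => lsum (doubled L) (fun be =>
     lsum (doubled L) (f al be)))) <= 8 * K * mass t ^ 3.
Proof.
intros HK H.
replace (8 * K * mass t ^ 3) with (4 * (K * (2 * mass t)) * mass t ^ 2) by ring.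
assert (H0 := mass_ge0).
apply lsum2_le; [nra|]. intros al be.
replace (K * (2 * mass t) * (osc_size al t * osc_size be t)) with
  (K * (osc_size al t * osc_size be t) * (2 * mass t)) by ring.
rewrite <- lsum_size. apply lsum_Rabs_scal; intros ga.
rewrite Rmult_assoc. apply H.
Qed.

Lemma corr4_le : Rabs (corr4 t) <= 2 * c / mu * mass t ^ 2.
Proof.
unfold corr4. rewrite Rabs_mult, (Rabs_pos_eq (c / 4)) by lra.
replace (2 * c / mu * mass t ^ 2) with
  (c / 4 * (4 * (2 / mu) * mass t ^ 2)) by (field; lra).
apply Rmult_le_compat_l; [lra|].
assert (0 < / mu) by now apply Rinv_0_lt_compat.
apply lsum2_le; [unfold Rdiv; lra|]. intros al be.
rewrite Rabs_mult.
replace (2 / mu * (osc_size al t * osc_size be t)) with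
  ((osc_size al t * osc_size be t + osc_size al t * osc_size be t) * / mu)
  by (field; lra).
apply Rmult_le_compat; auto using Rabs_pos, weight_le.
apply Rabs_sub_le; rewrite Rabs_mult;
  apply Rmult_le_compat; auto using Rabs_pos, osc_re_le, osc_im_le.
Qed.

Lemma corr6_le :
  Rabs (corr6 t) <= 24 * c ^ 2 * G / (mu * del) * mass t ^ 3.
Proof.
unfold corr6. rewrite Rabs_mult, Rabs_Ropp, (Rabs_pos_eq (c ^ 2 / 4)) by nra.
replace (24 * c ^ 2 * G / (mu * del) * mass t ^ 3) with
  (c ^ 2 / 4 * (8 * (12 * G / (mu * del)) * mass t ^ 3)) by (field; lra).
apply Rmult_le_compat_l; [nra|].
apply lsum3_le.
{ apply Rlt_le, Rdiv_lt_0_compat; [lra | now apply Rmult_lt_0_compat]. }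
intros al be ga.
destruct (corr6_term_derive al be ga) as [_ P].
rewrite Rabs_mult.
replace (12 * G / (mu * del) * _) with
  (/ mu * (12 * G / del * (osc_size al t * osc_size be t * osc_size ga t)))
  by (field; lra).
apply Rmult_le_compat; auto using Rabs_pos, weight_le.
Qed.

Definition pair_force (al be : index) : R :=
  osc_force_re al t * osc_re be t - osc_force_im al t * osc_im be t.

Lemma pair_force_le al be :
  Rabs (pair_force al be) <= 3 * G * (osc_size al t * osc_size be t).
Proof.
unfold pair_force.
replace (3 * G * (osc_size al t * osc_size be t)) with
  (G * osc_size al t * osc_size be t + 2 * G * osc_size al t * osc_size be t) by ring.
apply Rabs_sub_le; rewrite Rabs_mult; apply Rmult_le_compat;
  auto using Rabs_pos, osc_force_re_le, osc_force_im_le, osc_re_le, osc_im_le.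
Qed.

(** The part of order six of the derivative of [action] plus [corr4], divided by
    kap. *)
Definition cubic : R :=
  c / 2 * lsum (doubled L) (fun al => lsum (doubled L) (fun be =>
    pair_force al be * weight al be)).

Lemma cubic_le : Rabs cubic <= 6 * c * G / mu * mass t ^ 2.
Proof.
unfold cubic. rewrite Rabs_mult, (Rabs_pos_eq (c / 2)) by lra.
replace (6 * c * G / mu * mass t ^ 2) with
  (c / 2 * (4 * (3 * G / mu) * mass t ^ 2)) by (field; lra).
apply Rmult_le_compat_l; [lra|].
assert (0 < / mu) by now apply Rinv_0_lt_compat.
apply lsum2_le; [apply Rmult_le_pos; lra|]. intros al be.
rewrite Rabs_mult.
replace (3 * G / mu * (osc_size al t * osc_size be t)) with
  ((3 * G * (osc_size al t * osc_size be t)) * / mu) by (field; lra).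
apply Rmult_le_compat; auto using Rabs_pos, weight_le, pair_force_le.
Qed.

Lemma action_derive :
  is_derive action t (- kap * lsum (doubled L) (fun al => osc_im al t)).
Proof.
eapply is_derive_cast.
- unfold action. apply is_derive_lsum; intros k.
  apply is_derive_Rmult; [|apply is_derive_Rconst].
  exact (osc_re_derive (k, false)).
- rewrite lsum_doubled, <- lsum_scal. apply lsum_ext; intros k.
  destruct (Hg k). unfold osc_freq, osc_force_re, osc_im; simpl. field; lra.
Qed.

Lemma corr4_derive :
  is_derive corr4 t
    (c / 2 * (lsum (doubled L) (fun al => osc_im al t) *
              lsum (doubled L) (fun al => osc_re al t)) + kap * cubic).
Proof.
eapply is_derive_cast.
- unfold corr4. apply is_derive_Rscal.
  apply is_derive_lsum; intros al. apply is_derive_lsum; intros be.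
  apply is_derive_Rmult; [|apply is_derive_Rconst].
  apply (is_derive_Rminus (fun r => osc_re al r * osc_re be r)
           (fun r => osc_im al r * osc_im be r)).
  + exact (is_derive_Rmult _ _ _ _ _ (osc_re_derive al) (osc_re_derive be)).
  + exact (is_derive_Rmult _ _ _ _ _ (osc_im_derive al) (osc_im_derive be)).
- rewrite (lsum_ext _ _ (fun al =>
    (osc_im al t * lsum (doubled L) (fun be => osc_re be t) +
     osc_re al t * lsum (doubled L) (fun be => osc_im be t)) +
    (kap * lsum (doubled L) (fun be => pair_force al be * weight al be) +
     kap * lsum (doubled L) (fun be => pair_force be al * weight be al)))).
  + rewrite !lsum_plus, !lsum_scal_r, !lsum_scal.
    rewrite (lsum_swap (doubled L) (doubled L)
      (fun al be => pair_force be al * weight be al)).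
    unfold cubic; field.
  + intros al. rewrite <- !lsum_scal, <- !lsum_plus. apply lsum_ext; intros be.
    rewrite (weight_sym be al), <- (weight_cancel al be). unfold pair_force. ring.
Qed.

Lemma corr6_derive :
  exists e,
    is_derive corr6 t
      (- (c / 2 * (cubic * lsum (doubled L) (fun al => osc_re al t))) + e) /\
    Rabs e <= Rabs kap * (144 * c ^ 2 * G ^ 2 / (mu * del) * mass t ^ 3).
Proof.
set (err := fun al be ga =>
  Derive (corr6_term al be ga) t - pair_force al be * osc_re ga t).
assert (Herr : forall al be ga,
  is_derive (corr6_term al be ga) t (pair_force al be * osc_re ga t + err al be ga) /\
  Rabs (err al be ga) <= Rabs kap * (72 * G ^ 2 / del) *
    (osc_size al t * osc_size be t * osc_size ga t)).
{ intros al be ga.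
  destruct (corr6_term_derive al be ga) as [[e [De Be]] _]. fold (pair_force al be) in De.
  unfold err; rewrite (is_derive_unique _ _ _ De). split.
  - eapply is_derive_cast; [exact De | ring].
  - replace (_ - _) with (kap * e) by ring. rewrite Rabs_mult, Rmult_assoc.
    apply Rmult_le_compat_l; [apply Rabs_pos | exact Be]. }
exists (- (c ^ 2 / 4) * lsum (doubled L) (fun al => lsum (doubled L) (fun be =>
    lsum (doubled L) (fun ga => weight al be * err al be ga)))).
split.
- eapply is_derive_cast.
  + unfold corr6. apply is_derive_Rscal.
    apply is_derive_lsum; intros al. apply is_derive_lsum; intros be.
    apply is_derive_lsum; intros ga. apply is_derive_Rscal. apply Herr.
  + rewrite (lsum_ext _ _ (fun al =>
      lsum (doubled L) (fun be => pair_force al be * weight al be) *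
        lsum (doubled L) (fun ga => osc_re ga t) +
      lsum (doubled L) (fun be => lsum (doubled L) (fun ga =>
        weight al be * err al be ga)))).
    * rewrite lsum_plus, lsum_scal_r. unfold cubic; field.
    * intros al. rewrite <- lsum_scal_r, <- lsum_plus. apply lsum_ext; intros be.
      rewrite <- lsum_scal, <- lsum_plus. apply lsum_ext; intros ga. ring.
- rewrite Rabs_mult, Rabs_Ropp, (Rabs_pos_eq (c ^ 2 / 4)) by nra.
  replace (Rabs kap * (144 * c ^ 2 * G ^ 2 / (mu * del) * mass t ^ 3)) with
    (c ^ 2 / 4 * (8 * (Rabs kap * (72 * G ^ 2 / (mu * del))) * mass t ^ 3))
    by (field; lra).
  apply Rmult_le_compat_l; [nra|].
  apply lsum3_le.
  { apply Rmult_le_pos; [apply Rabs_pos|].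
    apply Rlt_le, Rdiv_lt_0_compat; [nra | now apply Rmult_lt_0_compat]. }
  intros al be ga.
  rewrite Rabs_mult.
  replace (Rabs kap * (72 * G ^ 2 / (mu * del)) * _) with
    (/ mu * (Rabs kap * (72 * G ^ 2 / del) *
       (osc_size al t * osc_size be t * osc_size ga t))) by (field; lra).
  apply Rmult_le_compat; auto using Rabs_pos, weight_le. apply Herr.
Qed.

(** The derivative of [action] is cancelled by the rotation of [corr4], and what the
    coupling does to [corr4] is cancelled by the rotation of [corr6]. Both
    cancellations use the coupling of the listed modes only; rho is the rest. *)
Lemma modified_action_derive (rho : R) :
  kap = c * lsum L (fun k => x k t ^ 2) + rho ->
  exists d,
    is_derive (fun r => action r + corr4 r + corr6 r) t d /\
    Rabs d <= Rabs rho * (2 * mass t + 6 * c * G / mu * mass t ^ 2) +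
      Rabs kap * (144 * c ^ 2 * G ^ 2 / (mu * del) * mass t ^ 3).
Proof.
intros Hkap.
destruct corr6_derive as [e [D6 E6]].
eexists; split.
- apply is_derive_Rplus; [apply is_derive_Rplus|];
    [apply action_derive | apply corr4_derive | exact D6].
- rewrite lsum_re in *.
  set (B := lsum (doubled L) (fun al => osc_im al t)).
  set (S := lsum L (fun k => x k t ^ 2)) in *.
  replace (_ + _ + _) with (- (rho * B) + rho * cubic + e) by (rewrite Hkap; field).
  apply Rabs_add_le; [|exact E6].
  rewrite Rmult_plus_distr_l. apply Rabs_add_le.
  + rewrite Rabs_Ropp, Rabs_mult. apply Rmult_le_compat_l; [apply Rabs_pos|].
    unfold B. rewrite <- lsum_size. apply lsum_Rabs_le, osc_im_le.
  + rewrite Rabs_mult. apply Rmult_le_compat_l; [apply Rabs_pos | apply cubic_le].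
Qed.
End TruncatedModes.

(** * Frequencies and small divisors *)

Definition om (m : R) (k : nat) : R := freq k * sqrt (freq k ^ 2 + m).
Definition gain (m : R) (k : nat) : R := freq k / sqrt (freq k ^ 2 + m).

Lemma freq_ge1 k : 1 <= freq k.
Proof. unfold freq. rewrite S_INR. assert (H := pos_INR k). lra. Qed.

Section Frequencies.
Variable m : R.
Hypothesis (Hm_lo : - (1 / 2) <= m) (Hm_hi : m <= 1).

Lemma root_arg_pos k : 1 / 2 <= freq k ^ 2 + m.
Proof. assert (H := freq_ge1 k). nra. Qed.

Lemma root_sqr k : sqrt (freq k ^ 2 + m) ^ 2 = freq k ^ 2 + m.
Proof.
assert (H := root_arg_pos k). rewrite <- Rsqr_pow2. apply Rsqr_sqrt. lra.
Qed.

Lemma root_ge k : freq k - 3 / 10 <= sqrt (freq k ^ 2 + m).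
Proof.
assert (H := freq_ge1 k).
rewrite <- (sqrt_pow2 (freq k - 3 / 10)) by lra.
apply sqrt_le_1; nra.
Qed.

Lemma root_pos k : 0 < sqrt (freq k ^ 2 + m).
Proof. assert (H := freq_ge1 k). assert (H1 := root_ge k). lra. Qed.

Lemma om_gain k : om m k * gain m k = freq k ^ 2.
Proof. unfold om, gain. assert (H := root_pos k). field. lra. Qed.

Lemma om_sqr k : om m k ^ 2 = freq k ^ 2 * (freq k ^ 2 + m).
Proof. unfold om. rewrite Rpow_mult_distr, root_sqr. ring. Qed.

Lemma om_ge k : sqrt (1 + m) <= om m k.
Proof.
unfold om. assert (H := freq_ge1 k).
assert (H2 : sqrt (1 + m) <= sqrt (freq k ^ 2 + m)) by (apply sqrt_le_1; nra).
assert (H3 := sqrt_pos (1 + m)). nra.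
Qed.

Lemma om_pos k : 0 < om m k.
Proof. unfold om. assert (H := freq_ge1 k). assert (H1 := root_pos k). nra. Qed.

Lemma gain_pos k : 0 < gain m k.
Proof.
apply Rdiv_lt_0_compat; [assert (H := freq_ge1 k); lra | apply root_pos].
Qed.

Lemma gain_le k : gain m k <= 3 / 2.
Proof.
assert (H := freq_ge1 k). assert (H1 := root_ge k).
unfold gain. apply Rle_div_l; lra.
Qed.

Lemma mu_eq : mu m = 2 * sqrt (1 + m).
Proof.
unfold mu. apply Rmin_left.
apply Rsqr_incr_0_var; [| assert (H := sqrt_pos (4 + m)); lra].
rewrite !Rsqr_mult, !Rsqr_sqrt by lra. unfold Rsqr; lra.
Qed.

Lemma mu_pos : 0 < mu m.
Proof.
rewrite mu_eq. assert (0 < sqrt (1 + m)) by (apply sqrt_lt_R0; lra). lra.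
Qed.

(** Since j (j^2+m)^(1/2) = (j^2 + (j^2+m) - ((j^2+m)^(1/2) - j)^2) / 2, the
    frequencies are integers shifted by m / 2 up to the defect below. *)
Definition defect (k : nat) : R := (sqrt (freq k ^ 2 + m) - freq k) ^ 2 / 2.

Lemma om_defect k : om m k = freq k ^ 2 + m / 2 - defect k.
Proof.
unfold om, defect. assert (H := root_sqr k).
set (s := sqrt _) in *.
replace ((s - freq k) ^ 2) with (s ^ 2 - 2 * (freq k * s) + freq k ^ 2) by ring. lra.
Qed.

Lemma defect_ge0 k : 0 <= defect k.
Proof. unfold defect. apply Rmult_le_pos; [apply pow2_ge_0 | lra]. Qed.

Lemma defect_le k (J : R) :
  0 < J -> J <= 2 * freq k - 3 / 10 -> defect k <= m ^ 2 / (2 * J ^ 2).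
Proof.
intros HJ HJk. unfold defect. assert (H := root_sqr k). assert (H1 := root_ge k).
assert (HJ2 : 0 < 2 * J ^ 2) by nra.
set (s := sqrt _) in *.
assert (E : m ^ 2 = (s - freq k) ^ 2 * (s + freq k) ^ 2).
{ rewrite <- Rpow_mult_distr. f_equal. lra. }
rewrite E. apply (proj1 (Rle_div_r _ _ _ HJ2)).
replace ((s - freq k) ^ 2 / 2 * (2 * J ^ 2)) with ((s - freq k) ^ 2 * J ^ 2) by field.
apply Rmult_le_compat_l; [nra|]. apply pow_incr; lra.
Qed.

Lemma defect_le_first k : defect k <= 174 / 1000 * m ^ 2.
Proof.
assert (H := freq_ge1 k).
eapply Rle_trans; [apply (defect_le k (17 / 10)); lra|]. nra.
Qed.

Lemma defect_le_next k : (1 <= k)%nat -> defect k <= 37 / 1000 * m ^ 2.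
Proof.
intros Hk. assert (H : 2 <= freq k).
{ unfold freq. change 2 with (INR 2). apply le_INR. lia. }
eapply Rle_trans; [apply (defect_le k (37 / 10)); lra|]. nra.
Qed.

Lemma freq_sqr_IZR k : freq k ^ 2 = IZR (Z.of_nat (S k) * Z.of_nat (S k)).
Proof. unfold freq. rewrite mult_IZR, <- INR_IZR_INZ. ring. Qed.

(** The square after J^2 is J^2 + 2 J + 1. *)
Lemma no_unit_leg j l :
  (1 + Z.of_nat (S j) * Z.of_nat (S j) <> Z.of_nat (S l) * Z.of_nat (S l))%Z.
Proof.
set (J := Z.of_nat (S j)) in *; set (K := Z.of_nat (S l)) in *.
destruct (Z.le_gt_cases K J); nia.
Qed.

Lemma sqr_shift_le : m ^ 2 <= Rabs m.
Proof. unfold Rabs; destruct Rcase_abs; nra. Qed.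

(** When i^2 + j^2 = l^2 the integer parts cancel and the shift m / 2 is what
    keeps the divisor away from zero; no such triple has an entry 1. *)
Lemma small_divisor i j l :
  3 / 5 * Rabs m <= Rabs (2 * om m i + 2 * om m j - 2 * om m l).
Proof.
assert (Hi := defect_ge0 i). assert (Hj := defect_ge0 j). assert (Hl := defect_ge0 l).
assert (Hi' := defect_le_first i). assert (Hj' := defect_le_first j).
assert (Hl' := defect_le_first l).
rewrite !om_defect, !freq_sqr_IZR.
set (p := (Z.of_nat (S i) * Z.of_nat (S i) + Z.of_nat (S j) * Z.of_nat (S j)
           - Z.of_nat (S l) * Z.of_nat (S l))%Z).
replace (_ + _ - _) with
  (2 * (IZR p + m / 2 - (defect i + defect j - defect l)))
  by (unfold p; rewrite minus_IZR, plus_IZR; field).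
assert (Hm2 := sqr_shift_le).
(* p is the integer part of half the divisor; what remains, m / 2 and the defects,
   is less than 0.7 in size. *)
assert (Hp : (p = 0 \/ 1 <= p \/ p <= -1)%Z) by lia.
destruct Hp as [Hp | [Hp | Hp]].
- assert (Hi1 : (1 <= i)%nat).
  { destruct i as [|i]; [exfalso | lia]. apply (no_unit_leg j l). unfold p in Hp; lia. }
  assert (Hj1 : (1 <= j)%nat).
  { destruct j as [|j]; [exfalso | lia]. apply (no_unit_leg i l). unfold p in Hp; lia. }
  apply defect_le_next in Hi1, Hj1. rewrite Hp.
  unfold Rabs in *; destruct (Rcase_abs m), Rcase_abs; lra.
- apply IZR_le in Hp.
  unfold Rabs in *; destruct (Rcase_abs m), Rcase_abs; lra.
- apply IZR_le in Hp.
  unfold Rabs in *; destruct (Rcase_abs m), Rcase_abs; lra.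
Qed.

Lemma divisor_single k : 3 / 5 * Rabs m <= 2 * om m k.
Proof.
assert (H := defect_le_first k). assert (H1 := freq_ge1 k). rewrite om_defect.
assert (Hm2 := sqr_shift_le). assert (1 <= freq k ^ 2) by nra.
unfold Rabs in *; destruct Rcase_abs; lra.
Qed.

Lemma divisor_difference k l :
  k <> l -> 3 / 5 * Rabs m <= Rabs (2 * om m k - 2 * om m l).
Proof.
intros Hkl.
assert (Hk := defect_ge0 k). assert (Hl := defect_ge0 l).
assert (Hk' := defect_le_first k). assert (Hl' := defect_le_first l).
assert (Hm2 := sqr_shift_le).
rewrite !om_defect, !freq_sqr_IZR.
set (p := (Z.of_nat (S k) * Z.of_nat (S k) - Z.of_nat (S l) * Z.of_nat (S l))%Z).
replace (_ - _) with (2 * (IZR p - (defect k - defect l)))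
  by (unfold p; rewrite minus_IZR; field).
assert (Hp : (1 <= p \/ p <= -1)%Z) by (unfold p; nia).
destruct Hp as [Hp | Hp]; apply IZR_le in Hp;
  unfold Rabs in *; destruct (Rcase_abs m), Rcase_abs; lra.
Qed.
End Frequencies.

(** * Series of functions under a summable bound *)

Lemma ex_series_dominated (f a : nat -> R) :
  (forall k, Rabs (f k) <= a k) -> ex_series a -> ex_series f.
Proof. intros H Ha. now apply (ex_series_le (V := R_CompleteNormedModule) f a). Qed.

Lemma ex_series_ext_R (f g : nat -> R) :
  (forall k, f k = g k) -> ex_series f -> ex_series g.
Proof. exact (ex_series_ext (V := R_NormedModule) f g). Qed.

Lemma ex_series_Rscal (c : R) (f : nat -> R) :
  ex_series f -> ex_series (fun k => c * f k).
Proof. exact (ex_series_scal (V := R_NormedModule) c f). Qed.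

Lemma ex_series_Rplus (f g : nat -> R) :
  ex_series f -> ex_series g -> ex_series (fun k => f k + g k).
Proof. exact (ex_series_plus (V := R_NormedModule) f g). Qed.

Lemma sum_n_S_R (f : nat -> R) n : sum_n f (S n) = sum_n f n + f (S n).
Proof. now rewrite sum_Sn. Qed.

Lemma sum_n_O_R (f : nat -> R) : sum_n f 0 = f 0%nat.
Proof. now rewrite sum_O. Qed.

Lemma Series_zero (f : nat -> R) : (forall k, f k = 0) -> Series f = 0.
Proof.
intros H. rewrite (Series_ext f (fun k => 0 * f k)).
- rewrite Series_scal_l; ring.
- intros k; rewrite H; ring.
Qed.

Lemma sum_n_le_Series (f : nat -> R) n :
  (forall k, 0 <= f k) -> ex_series f -> sum_n f n <= Series f.
Proof.
intros H Hf. apply Series_correct in Hf.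
apply (is_lim_seq_incr_compare (sum_n f)); [exact Hf|].
intros p. rewrite sum_n_S_R. specialize (H (S p)); lra.
Qed.

Lemma Series_ge0 (f : nat -> R) :
  (forall k, 0 <= f k) -> ex_series f -> 0 <= Series f.
Proof.
intros H Hf. eapply Rle_trans; [|apply (sum_n_le_Series f 0 H Hf)].
rewrite sum_n_O_R; apply H.
Qed.

Lemma term_le_Series (f : nat -> R) k :
  (forall k, 0 <= f k) -> ex_series f -> f k <= Series f.
Proof.
intros H Hf. eapply Rle_trans; [|apply (sum_n_le_Series f k H Hf)].
destruct k as [|k]; [rewrite sum_n_O_R; lra|]. rewrite sum_n_S_R.
assert (H0 : forall n, 0 <= sum_n f n).
{ intros n; induction n as [|n IH]; [rewrite sum_n_O_R; apply H|].
  rewrite sum_n_S_R. specialize (H (S n)); lra. }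
specialize (H0 k); lra.
Qed.

Lemma Series_tail (f : nat -> R) n :
  ex_series f -> Series f = sum_n f n + Series (fun k => f (S n + k)%nat).
Proof.
intros Hf. rewrite (Series_incr_n f (S n)) by (auto; lia). simpl pred.
now rewrite sum_n_Reals.
Qed.

Lemma Series_tail_small (a : nat -> R) (e : R) :
  ex_series a -> 0 < e ->
  exists n, Rabs (Series (fun k => a (S n + k)%nat)) < e.
Proof.
intros Ha He. assert (H : is_lim_seq (sum_n a) (Series a)) by exact (Series_correct _ Ha).
apply is_lim_seq_spec in H. destruct (H (mkposreal e He)) as [n Hn].
exists n. specialize (Hn n (le_n n)). simpl in Hn.
rewrite (Series_tail a n Ha) in Hn.
rewrite <- Rabs_Ropp. now replace (- _) with (sum_n a n - (sum_n a n + Series (fun k => a (S n + k)%nat))) by ring.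
Qed.

Lemma Series_dominated_le (f a : nat -> R) :
  (forall k, Rabs (f k) <= a k) -> ex_series a -> Rabs (Series f) <= Series a.
Proof.
intros H Ha. eapply Rle_trans.
- apply Series_Rabs. apply (ex_series_dominated _ a); auto.
  intros k; now rewrite Rabs_Rabsolu.
- apply Series_le; auto. intros k; split; [apply Rabs_pos | apply H].
Qed.

Section DominatedConvergence.
Context {U : Type} (F : (U -> Prop) -> Prop) {FF : ProperFilter F}.

Lemma filterlim_R_spec (f : U -> R) (l : R) :
  filterlim f F (locally l) <->
  forall e, 0 < e -> F (fun u => Rabs (f u - l) < e).
Proof.
split.
- intros H e He. apply (H (fun y => Rabs (y - l) < e)).
  now exists (mkposreal e He).
- intros H P [d Hd]. unfold filtermap. eapply filter_imp; [|apply (H d (cond_pos d))].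
  intros u Hu; apply Hd; exact Hu.
Qed.

Lemma filterlim_sum_n (f : U -> nat -> R) (l : nat -> R) n :
  (forall k, filterlim (fun u => f u k) F (locally (l k))) ->
  filterlim (fun u => sum_n (f u) n) F (locally (sum_n l n)).
Proof.
intros H; induction n as [|n IH].
- apply (filterlim_ext (fun u => f u 0%nat)); [intros u; now rewrite sum_n_O_R|].
  rewrite sum_n_O_R; apply H.
- apply (filterlim_ext (fun u => plus (sum_n (f u) n) (f u (S n))));
    [intros u; now rewrite sum_n_S_R|].
  rewrite sum_n_S_R.
  eapply filterlim_comp_2; [exact IH | apply (H (S n)) |].
  exact (filterlim_plus (V := R_NormedModule) (sum_n l n) (l (S n))).
Qed.

(** The tails are small uniformly along the filter, and finitely many terms
    converge. *)
Lemma Series_dominated_limit (f : U -> nat -> R) (l a : nat -> R) :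
  ex_series a ->
  F (fun u => forall k, Rabs (f u k) <= a k) ->
  (forall k, filterlim (fun u => f u k) F (locally (l k))) ->
  filterlim (fun u => Series (f u)) F (locally (Series l)).
Proof.
intros Ha Hdom Hlim.
assert (Hl : forall k, Rabs (l k) <= a k).
{ intros k. apply Rnot_lt_le; intros Hlt.
  assert (He : 0 < Rabs (l k) - a k) by lra.
  assert (H := proj1 (filterlim_R_spec _ _) (Hlim k) _ He).
  destruct (filter_ex _ (filter_and _ _ Hdom H)) as [u [H1 H2]].
  specialize (H1 k).
  assert (H3 := Rabs_triang_inv (l k) (f u k)).
  rewrite Rabs_minus_sym in H3. lra. }
apply filterlim_R_spec; intros e He.
destruct (Series_tail_small a (e / 3) Ha) as [n Hn]; [lra|].
assert (Htail : forall g, (forall k, Rabs (g k) <= a k) ->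
  Rabs (Series g - sum_n g n) < e / 3).
{ intros g Hg. rewrite (Series_tail g n) by (now apply (ex_series_dominated _ a)).
  replace (_ + _ - _) with (Series (fun k => g (S n + k)%nat)) by ring.
  eapply Rle_lt_trans; [|exact Hn].
  eapply Rle_trans; [|apply Rle_abs].
  apply Series_dominated_le; [intros k; apply Hg|].
  now apply (ex_series_incr_n a (S n)). }
assert (He3 : 0 < e / 3) by lra.
assert (Hs := proj1 (filterlim_R_spec _ _) (filterlim_sum_n f l n Hlim) _ He3).
eapply filter_imp; [|exact (filter_and _ _ Hdom Hs)].
intros u [H1 H2].
assert (H3 := Htail _ H1). assert (H4 := Htail _ Hl).
replace (Series (f u) - Series l) with
  ((Series (f u) - sum_n (f u) n) + (sum_n (f u) n - sum_n l n) -
   (Series l - sum_n l n)) by ring.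
apply Rabs_def2 in H2, H3, H4. apply Rabs_def1; lra.
Qed.
End DominatedConvergence.

(** Termwise differentiation: the difference quotients of the terms are bounded
    by the same summable sequence as the derivatives. *)
Lemma Series_derive (f df : nat -> R -> R) (a : nat -> R) (t d : R) :
  0 < d -> ex_series a ->
  (forall k s, Rabs (s - t) < d -> is_derive (f k) s (df k s)) ->
  (forall k s, Rabs (s - t) < d -> Rabs (df k s) <= a k) ->
  (forall s, Rabs (s - t) < d -> ex_series (fun k => f k s)) ->
  is_derive (fun s => Series (fun k => f k s)) t (Series (fun k => df k t)).
Proof.
intros Hd Ha Hf Hdf Hex.
assert (Hball : Rabs (t - t) < d) by (rewrite Rminus_eq_0, Rabs_R0; lra).
apply is_derive_Reals. intros e He.
assert (Hlim : filterlim (fun h => Series (fun k => (f k (t + h) - f k t) / h))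
  (Rbar_locally' 0) (locally (Series (fun k => df k t)))).
{ apply (Series_dominated_limit (Rbar_locally' 0) (fun h k => (f k (t + h) - f k t) / h)
    (fun k => df k t) a Ha).
  - apply (filter_imp (fun h => h <> 0 /\ Rabs h < d)).
    2: { exists (mkposreal d Hd). intros h Hh Hh0. split; [exact Hh0|]. change (Rabs (h - 0) < d) in Hh. now rewrite Rminus_0_r in Hh. }
    intros h [Hh0 Hh] k.

    assert (Hseg : forall s, Rmin t (t + h) <= s <= Rmax t (t + h) -> Rabs (s - t) < d).
    { intros s Hs. unfold Rmin, Rmax in Hs. apply Rabs_def2 in Hh.
      destruct (Rle_dec t (t + h)); apply Rabs_def1; lra. }
    destruct (MVT_R (f k) (df k) t (t + h)) as [s [Hs1 Hs2]].
    + intros s Hs; now apply Hf, Hseg.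
    + rewrite Hs2. replace (_ / h) with (df k s) by (field; auto).
      apply Hdf, Hseg; lra.
  - intros k. apply (filterlim_R_spec (Rbar_locally' 0)). intros e' He'.
    destruct (proj1 (is_derive_Reals _ _ _) (Hf k t Hball) e' He') as [del Hdel].
    exists del. intros h Hh Hh0. apply Hdel; auto.
    change (Rabs (h - 0) < del) in Hh. now rewrite Rminus_0_r in Hh. }
destruct (proj1 (filterlim_R_spec (Rbar_locally' 0) _ _) Hlim e He) as [del Hdel].
exists (mkposreal (Rmin d del) (Rmin_pos _ _ Hd (cond_pos del))).
intros h Hh0 Hh. simpl in Hh.
assert (Hhd := Rlt_le_trans _ _ _ Hh (Rmin_l _ _)).
assert (Hhdel := Rlt_le_trans _ _ _ Hh (Rmin_r _ _)).
assert (H := Hdel h). rewrite <- Series_minus.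
- unfold Rdiv at 1. rewrite <- Series_scal_r. apply H; auto.
  change (Rabs (h - 0) < del). now rewrite Rminus_0_r.
- apply Hex. now replace (t + h - t) with h by ring.
- now apply Hex.
Qed.

Lemma Series_continuous (f : nat -> R -> R) (a : nat -> R) (t d : R) :
  0 < d -> ex_series a ->
  (forall k, continuous (f k) t) ->
  (forall k s, Rabs (s - t) < d -> Rabs (f k s) <= a k) ->
  continuous (fun s => Series (fun k => f k s)) t.
Proof.
intros Hd Ha Hf Hdom.
apply (Series_dominated_limit (locally t) (fun s k => f k s) (fun k => f k t) a Ha).
- exists (mkposreal d Hd). intros s Hs k. apply Hdom. exact Hs.
- exact Hf.
Qed.

(** By the fundamental theorem of calculus: the series of the primitives can be
    differentiated term by term. *)
Lemma is_RInt_Series (f : nat -> R -> R) (a : nat -> R) (x y : R) :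
  ex_series a ->
  (forall k z, continuous (f k) z) ->
  (forall k z, Rabs (f k z) <= a k) ->
  is_RInt (fun z => Series (fun k => f k z)) x y (Series (fun k => RInt (f k) x y)).
Proof.
intros Ha Hc Hb.
set (G := fun w => Series (fun k => RInt (f k) x w)).
assert (Hex : forall k w, ex_RInt (f k) x w).
{ intros k w. apply (ex_RInt_continuous (V := R_CompleteNormedModule)).
  intros z _; apply Hc. }
assert (Hbd : forall w k, Rabs (RInt (f k) x w) <= Rabs (w - x) * a k).
{ intros w k. destruct (Rle_dec x w) as [H | H].
  - rewrite (Rabs_pos_eq (w - x)) by lra.
    apply abs_RInt_le_const; auto.
  - apply Rnot_le_lt in H. rewrite <- (opp_RInt_swap (f k) w x) by apply ex_RInt_swap, Hex.
    change (opp (RInt (f k) w x)) with (- RInt (f k) w x). rewrite Rabs_Ropp.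
    replace (Rabs (w - x)) with (x - w) by (rewrite Rabs_minus_sym, Rabs_pos_eq; lra).
    apply abs_RInt_le_const; [lra | apply ex_RInt_swap, Hex | auto]. }
assert (HG : forall w, is_derive G w (Series (fun k => f k w))).
{ intros w. unfold G. apply (Series_derive _ f a w 1); auto; [lra| |].
  - intros k s _. apply (is_derive_RInt (f k) (fun r => RInt (f k) x r) x s).
    + apply filter_forall; intros z. now apply (RInt_correct (V := R_CompleteNormedModule)).
    + apply Hc.
  - intros s _. eapply ex_series_dominated; [apply Hbd|].
    now apply (ex_series_scal (Rabs (s - x)) a). }
replace (Series (fun k => RInt (f k) x y)) with (minus (G y) (G x)).
- apply (is_RInt_derive (V := R_CompleteNormedModule) G).
  + intros w _; apply HG.
  + intros w _. apply (Series_continuous f a w 1); auto; lra.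
- unfold G. rewrite (Series_zero (fun k => RInt (f k) x x)).
  + unfold minus, plus, opp; simpl; ring.
  + intros k. now rewrite RInt_point.
Qed.

Lemma RInt_Series (f : nat -> R -> R) (a : nat -> R) (x y : R) :
  ex_series a ->
  (forall k z, continuous (f k) z) ->
  (forall k z, Rabs (f k z) <= a k) ->
  RInt (fun z => Series (fun k => f k z)) x y = Series (fun k => RInt (f k) x y).
Proof.
intros Ha Hc Hb. apply is_RInt_unique. now apply is_RInt_Series with a.
Qed.

(** * A priori bound along a solution *)

Definition seg (t s : R) : Prop := Rmin 0 t <= s <= Rmax 0 t.

Lemma seg_0 t : seg t 0.
Proof. split; [apply Rmin_l | apply Rmax_l]. Qed.

Lemma seg_end t : seg t t.
Proof. split; [apply Rmin_r | apply Rmax_r]. Qed.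

Lemma seg_trans t s r : seg t s -> seg s r -> seg t r.
Proof.
unfold seg, Rmin, Rmax.
destruct (Rle_dec 0 t), (Rle_dec 0 s); lra.
Qed.

Lemma seg_Rabs t s : seg t s -> Rabs s <= Rabs t.
Proof.
unfold seg, Rmin, Rmax, Rabs.
destruct (Rle_dec 0 t), (Rcase_abs s), (Rcase_abs t); lra.
Qed.

Lemma MVT_seg (f df : R -> R) (t : R) :
  (forall s, seg t s -> is_derive f s (df s)) ->
  exists s, seg t s /\ f t - f 0 = df s * t.
Proof.
intros H. destruct (MVT_R f df 0 t H) as [s [Hs E]].
exists s; split; [exact Hs|]. now rewrite Rminus_0_r in E.
Qed.

(** The product of f with exp (- C |s|) decreases away from time 0. *)
Lemma gronwall (f df : R -> R) (C t : R) :
  (forall s, seg t s -> is_derive f s (df s)) ->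
  (forall s, seg t s -> Rabs (df s) <= C * f s) ->
  f t <= f 0 * exp (C * Rabs t).
Proof.
intros Hf Hdf.
assert (H : exists sg, sg * t = Rabs t /\ (sg = 1 /\ 0 <= t \/ sg = -1 /\ t <= 0)).
{ unfold Rabs; destruct (Rcase_abs t); [exists (-1) | exists 1]; split; lra. }
destruct H as [sg [Hsg Hcase]].
destruct (MVT_seg (fun s => f s * exp (- C * sg * s))
  (fun s => (df s - C * sg * f s) * exp (- C * sg * s)) t) as [s [Hs E]].
- intros s Hs. eapply is_derive_cast.
  + apply is_derive_Rmult; [now apply Hf|].
    instantiate (1 := - C * sg * exp (- C * sg * s)).
    auto_derive; [easy | ring].
  + cbv beta; ring.
- rewrite Rmult_0_r, exp_0, Rmult_1_r in E.
  assert (Hle : f t * exp (- C * sg * t) <= f 0).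
  { specialize (Hdf s Hs). assert (Hx := exp_pos (- C * sg * s)).
    assert (H1 : - (C * f s) <= df s <= C * f s) by (apply Rabs_le_between; exact Hdf).
    destruct Hcase as [[-> Ht] | [-> Ht]].
    - assert ((df s - C * 1 * f s) * exp (- C * 1 * s) <= 0) by nra. nra.
    - assert (0 <= (df s - C * -1 * f s) * exp (- C * -1 * s)) by nra. nra. }
  rewrite <- Hsg.
  replace (f t) with (f t * exp (- C * sg * t) * exp (C * (sg * t))).
  + apply Rmult_le_compat_r; [left; apply exp_pos | exact Hle].
  + rewrite Rmult_assoc, <- exp_plus.
    replace (- C * sg * t + C * (sg * t)) with 0 by ring. rewrite exp_0; ring.
Qed.

(** Continuity argument: at the supremum of the times up to which f stays below B the
    bound is strict, so it extends beyond them. *)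
Lemma bootstrap (f : R -> R) (t0 B : R) :
  (forall s, seg t0 s -> continuous f s) ->
  f 0 < B ->
  (forall t, seg t0 t -> (forall s, seg t s -> f s <= B) -> f t < B) ->
  f t0 < B.
Proof.
intros Hc H0 Hstep.
set (g := fun r => f (r * t0)).
assert (Hseg : forall r, 0 <= r <= 1 -> seg t0 (r * t0)).
{ intros r Hr. unfold seg, Rmin, Rmax. destruct (Rle_dec 0 t0); nra. }
assert (Hsub : forall r s, 0 <= r <= 1 -> seg (r * t0) s ->
  exists r', 0 <= r' <= r /\ s = r' * t0).
{ intros r s Hr Hs. destruct (Req_dec t0 0) as [-> | Hne].
  - exists 0. unfold seg in Hs. rewrite Rmult_0_r, Rmin_left, Rmax_left in Hs; lra.
  - exists (s / t0). split; [|field; auto].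
    unfold seg, Rmin, Rmax in Hs.
    destruct (Rlt_le_dec 0 t0) as [Hp | Hp].
    + destruct (Rle_dec 0 (r * t0)) as [H|H]; [|nra].
      split; [apply Rle_div_r | apply Rle_div_l]; nra.
    +
      replace (s / t0) with ((- s) / (- t0)) by (field; lra).
      destruct (Rle_dec 0 (r * t0)) as [H|H];
      (split; [apply Rle_div_r | apply Rle_div_l]; nra). }
assert (Hstep' : forall r, 0 <= r <= 1 -> (forall r', 0 <= r' <= r -> g r' <= B) -> g r < B).
{ intros r Hr H. apply Hstep; [now apply Hseg|].
  intros s Hs. destruct (Hsub r s Hr Hs) as [r' [Hr' ->]]. now apply H. }
assert (Hgc : forall r e, 0 <= r <= 1 -> 0 < e ->
  exists d, 0 < d /\ forall r', Rabs (r' - r) < d -> Rabs (g r' - g r) < e).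
{ intros r e Hr He.
  assert (Hcr : continuous g r).
  { apply (continuous_comp (fun r => r * t0) f).
    - apply (continuous_mult (K := R_AbsRing) (fun r => r) (fun _ => t0));
        [apply continuous_id | apply continuous_const].
    - now apply Hc, Hseg. }
  destruct (proj1 (filterlim_R_spec (locally r) g (g r)) Hcr e He) as [d Hd].
  exists d; split; [apply cond_pos | exact Hd]. }
replace (f t0) with (g 1) by (unfold g; now rewrite Rmult_1_l).
set (E := fun r => 0 <= r <= 1 /\ forall r', 0 <= r' <= r -> g r' <= B).
assert (HE0 : E 0).
{ split; [lra|]. intros r' Hr'. replace r' with 0 by lra.
  unfold g; rewrite Rmult_0_l; lra. }
destruct (completeness E) as [S [HS1 HS2]].
{ exists 1. intros r [Hr _]; lra. }
{ now exists 0. }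
assert (HS0 : 0 <= S) by (now apply HS1).
assert (HSle : S <= 1) by (apply HS2; intros r [Hr _]; lra).
assert (Hbelow : forall r, 0 <= r < S -> g r <= B).
{ intros r Hr. apply Rnot_lt_le; intros Hlt.
  assert (S <= r); [|lra]. apply HS2. intros r' [Hr' H].
  apply Rnot_lt_le; intros Hlt'. specialize (H r). lra. }
assert (HSB : g S < B).
{ apply Hstep'; [lra|]. intros r' Hr'. destruct (Req_dec r' S) as [-> | Hne]; [|apply Hbelow; lra].
  apply Rnot_lt_le; intros Hlt.
  destruct (Req_dec S 0) as [HS | HS].
  { rewrite HS in Hlt. unfold g in Hlt. rewrite Rmult_0_l in Hlt. lra. }
  destruct (Hgc S (g S - B)) as [d [Hd Hd']]; [lra | lra|].
  set (r := Rmax 0 (S - d / 2)).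
  assert (0 <= r < S) by (unfold r, Rmax; destruct Rle_dec; lra).
  assert (Hr : g r <= B) by (now apply Hbelow).
  assert (HrS : Rabs (r - S) < d) by
    (apply Rabs_def1; unfold r, Rmax in *; destruct Rle_dec; lra).
  apply Hd', Rabs_def2 in HrS. lra. }
destruct (Req_dec S 1) as [HS | HS]; [now rewrite <- HS|]. exfalso.
destruct (Hgc S (B - g S)) as [d [Hd Hd']]; [lra | lra|].
set (r := Rmin 1 (S + d / 2)).
assert (Hr : S < r <= 1 /\ r < S + d) by (unfold r, Rmin; destruct Rle_dec; lra).
assert (HrE : E r).
{ split; [lra|]. intros r' Hr'. destruct (Rlt_le_dec r' S) as [Hlt | Hle].
  - apply Hbelow; lra.
  - assert (HrS : Rabs (r' - S) < d) by (apply Rabs_def1; lra).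
    apply Hd', Rabs_def2 in HrS. lra. }
apply HS1 in HrE. lra.
Qed.

Lemma lsum_seq (f : nat -> R) (n : nat) : lsum (seq 0 (S n)) f = sum_n f n.
Proof.
assert (H : forall l1 l2, lsum (l1 ++ l2) f = lsum l1 f + lsum l2 f).
{ intros l1 l2; induction l1 as [|a l1 IH]; simpl; [ring|]. rewrite IH; ring. }
induction n as [|n IH].
- rewrite sum_n_O_R; simpl; ring.
- rewrite seq_S, H, IH, sum_n_S_R; simpl; ring.
Qed.

Definition coupling : R := / (2 * PI).

Lemma coupling_bounds : 0 < coupling <= 1 / 6.
Proof.
assert (H := PI2_3_2). unfold coupling. split.
- apply Rinv_0_lt_compat; lra.
- replace (1 / 6) with (/ 6) by field. apply Rinv_le_contravar; lra.
Qed.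

Lemma nonresonant_modes (m : R) :
  - (1 / 2) <= m -> m <= 1 -> nonresonant (om m) (gain m) (3 / 2) (mu m) (3 / 5 * Rabs m).
Proof.
intros Hm_lo Hm_hi. split.
- intros k; split; [apply gain_pos | apply gain_le]; lra.
- intros k; rewrite mu_eq by lra.
  assert (H : sqrt (1 + m) <= om m k) by (apply om_ge; lra). lra.
- intros k; apply divisor_single; lra.
- intros k l; apply divisor_difference; lra.
- intros i j l; apply small_divisor; lra.
Qed.

Section ModeFlow.
Variables (m : R) (X Y : nat -> R -> R) (kap : R -> R) (t0 : R).
Hypothesis (Hm_lo : - (1 / 2) <= m) (Hm_hi : m <= 1).
Hypothesis (HX : forall s, seg t0 s -> forall k,
  is_derive (X k) s (om m k * Y k s)).
Hypothesis (HY : forall s, seg t0 s -> forall k,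
  is_derive (Y k) s (- om m k * X k s - kap s * gain m k * X k s)).
Hypothesis (Hsum : forall s, seg t0 s ->
  ex_series (fun k => X k s * X k s + Y k s * Y k s)).
Hypothesis (Hkap : forall s, seg t0 s ->
  kap s = coupling * Series (fun k => X k s ^ 2)).

Definition total_mass (s : R) : R :=
  Series (fun k => X k s * X k s + Y k s * Y k s).
Definition total_action (s : R) : R :=
  Series (fun k => (X k s * X k s + Y k s * Y k s) * / gain m k).

(** All modes feel the coupling through one and the same scalar, so each of them
    satisfies a Gronwall estimate of its own, with a common rate. *)
Lemma mode_growth (K t : R) (k : nat) :
  seg t0 t -> (forall s, seg t s -> Rabs (kap s) <= K) ->
  X k t * X k t + Y k t * Y k t <=
  (X k 0 * X k 0 + Y k 0 * Y k 0) * exp (3 / 2 * K * Rabs t).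
Proof.
intros Ht HK.
apply (gronwall (fun s => X k s * X k s + Y k s * Y k s)
  (fun s => - kap s * gain m k * (2 * (X k s * Y k s)))).
- intros s Hs. assert (Hs0 := seg_trans _ _ _ Ht Hs).
  assert (H1 := HX s Hs0). assert (H2 := HY s Hs0).
  eapply is_derive_cast; [derive_poly | ring].
- intros s Hs. specialize (HK s Hs).
  assert (H1 : 0 < gain m k) by (apply gain_pos; lra).
  assert (H2 : gain m k <= 3 / 2) by (apply gain_le; lra).
  rewrite Rabs_mult, Rabs_mult, Rabs_Ropp, (Rabs_pos_eq (gain m k)) by lra.
  assert (H3 := Rabs_pos (kap s)).
  assert (H4 : Rabs (2 * (X k s * Y k s)) <= X k s * X k s + Y k s * Y k s).
  { assert (H5 := Rle_0_sqr (X k s + Y k s)).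
    assert (H6 := Rle_0_sqr (X k s - Y k s)). unfold Rsqr in *.
    apply Rabs_le; lra. }
  apply Rmult_le_compat; auto using Rabs_pos; [nra|].
  rewrite (Rmult_comm (3 / 2)). apply Rmult_le_compat; lra.
Qed.

Lemma sq_sum_ge0 k s : 0 <= X k s * X k s + Y k s * Y k s.
Proof. nra. Qed.

Lemma ex_series_pos_part s : seg t0 s -> ex_series (fun k => X k s ^ 2).
Proof.
intros Hs. eapply ex_series_dominated; [|exact (Hsum s Hs)].
intros k; cbv beta. rewrite Rabs_pos_eq; nra.
Qed.

Lemma kap_bounds s : seg t0 s -> 0 <= kap s <= coupling * total_mass s.
Proof.
intros Hs. rewrite (Hkap s Hs). assert (Hc := coupling_bounds).
assert (H := ex_series_pos_part s Hs).
assert (0 <= Series (fun k => X k s ^ 2)) by (apply Series_ge0; auto; intros; nra).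
split; [nra|]. apply Rmult_le_compat_l; [lra|].
apply Series_le; [intros k; nra | auto].
Qed.

Lemma ex_series_action s : seg t0 s ->
  ex_series (fun k => (X k s * X k s + Y k s * Y k s) * / gain m k).
Proof.
intros Hs.
apply (ex_series_dominated _ (fun k => 2 * (X k s * X k s + Y k s * Y k s))).
- intros k. assert (H1 : 0 < gain m k) by (apply gain_pos; lra).
  assert (H2 : / gain m k <= 2).
  { replace 2 with (/ / 2) by field. apply Rinv_le_contravar; [lra|].
    unfold gain. assert (H3 : 0 < sqrt (freq k ^ 2 + m)) by (apply root_pos; lra). assert (H4 := freq_ge1 k).
    apply (proj1 (Rle_div_r _ _ _ H3)).
    assert (H5 : sqrt (freq k ^ 2 + m) ^ 2 = freq k ^ 2 + m) by (apply root_sqr; lra).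
    assert (sqrt (freq k ^ 2 + m) <= 2 * freq k); [|lra].
    apply Rsqr_incr_0_var; [|lra]. rewrite !Rsqr_pow2, H5. nra. }
  assert (0 < / gain m k) by now apply Rinv_0_lt_compat.
  rewrite Rabs_pos_eq; nra.
- apply (ex_series_Rscal 2). now apply Hsum.
Qed.

Section SlowMass.
Variables (e t : R).
Hypothesis (Ht : seg t0 t) (He : 0 < e) (Hm0 : m <> 0).
Hypothesis (Hsmall2 : e ^ 2 <= 64 / 10000 * mu m).
Hypothesis (Hsmall4 : e ^ 4 <= Rabs m * mu m / 3222).
Hypothesis (Htime : Rabs t * e ^ 6 <= Rabs m * mu m / 6595).
(* The bound to be improved by [mass_step]. *)
Hypothesis (Hmass : forall s, seg t s -> total_mass s <= 4 * e ^ 2).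

Let del := 3 / 5 * Rabs m.
Let del_pos : 0 < del.
Proof. unfold del. assert (H := Rabs_pos_lt m Hm0). lra. Qed.

Let modified (n : nat) (r : R) : R :=
  action (seq 0 (S n)) X Y (gain m) r +
  corr4 (seq 0 (S n)) X Y (om m) coupling r +
  corr6 (seq 0 (S n)) X Y (om m) (gain m) coupling r.

Let tail0 (n : nat) : R :=
  Series (fun k => X (S n + k)%nat 0 * X (S n + k)%nat 0 + Y (S n + k)%nat 0 * Y (S n + k)%nat 0).

Lemma mass_le n s : seg t s -> 0 <= mass (seq 0 (S n)) X Y s <= 4 * e ^ 2.
Proof.
intros Hs. assert (Hs0 := seg_trans _ _ _ Ht Hs). split; [apply mass_ge0|].
eapply Rle_trans; [|exact (Hmass s Hs)].
unfold mass; rewrite lsum_seq. unfold osc_size; simpl fst.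
apply sum_n_le_Series; [intros k; apply sq_sum_ge0 | now apply Hsum].
Qed.

Lemma kap_le s : seg t s -> 0 <= kap s <= 4 * coupling * e ^ 2.
Proof.
intros Hs. assert (H := kap_bounds s (seg_trans _ _ _ Ht Hs)).
specialize (Hmass s Hs). assert (Hc := coupling_bounds). nra.
Qed.

(** Uniform in time on the segment: by [mode_growth] the tail of the coupling is
    controlled by the tail of the initial mass. *)
Lemma rest_le n s : seg t s ->
  0 <= kap s - coupling * lsum (seq 0 (S n)) (fun k => X k s ^ 2) <=
  coupling * exp (6 * coupling * e ^ 2 * Rabs t) * tail0 n.
Proof.
intros Hs. assert (Hs0 := seg_trans _ _ _ Ht Hs). assert (Hc := coupling_bounds).
rewrite (Hkap s Hs0), lsum_seq.
assert (Hex := ex_series_pos_part s Hs0).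
rewrite (Series_tail _ n Hex).
set (T := Series (fun k => X (S n + k)%nat s ^ 2)).
replace (coupling * (_ + T) - _) with (coupling * T) by ring.
assert (HT : 0 <= T).
{ apply Series_ge0; [intros k; nra|]. now apply (ex_series_incr_n _ (S n)) in Hex. }
split; [nra|]. rewrite Rmult_assoc. apply Rmult_le_compat_l; [lra|].
unfold T, tail0. rewrite <- Series_scal_l. apply Series_le.
- intros k; split; [nra|].
  set (j := (S n + k)%nat).
  assert (HK : forall r, seg s r -> Rabs (kap r) <= 4 * coupling * e ^ 2).
  { intros r Hr. assert (H := kap_le r (seg_trans _ _ _ Hs Hr)).
    rewrite Rabs_pos_eq; lra. }
  assert (H := mode_growth _ s j Hs0 HK).
  assert (He1 : exp (3 / 2 * (4 * coupling * e ^ 2) * Rabs s) <=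
                exp (6 * coupling * e ^ 2 * Rabs t)).
  { assert (Hst := seg_Rabs _ _ Hs).
    destruct (Rle_lt_or_eq_dec _ _ Hst) as [Hlt | ->].
    - left; apply exp_increasing.
      replace (3 / 2 * (4 * coupling * e ^ 2)) with (6 * coupling * e ^ 2) by field.
      apply Rmult_lt_compat_l; [|exact Hlt]. apply Rmult_lt_0_compat; nra.
    - right; f_equal; field. }
  nra.
- apply (ex_series_Rscal (exp (6 * coupling * e ^ 2 * Rabs t))).
  apply (ex_series_incr_n (fun k => X k 0 * X k 0 + Y k 0 * Y k 0) (S n)).
  apply Hsum, seg_0.
Qed.

Lemma corrections_le n s : seg t s ->
  Rabs (corr4 (seq 0 (S n)) X Y (om m) coupling s) <= 35 / 1000 * e ^ 2 /\
  Rabs (corr6 (seq 0 (S n)) X Y (om m) (gain m) coupling s) <= 34 / 1000 * e ^ 2.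
Proof.
intros Hs. assert (Hs0 := seg_trans _ _ _ Ht Hs). assert (Hc := coupling_bounds).
assert (HM := mass_le n s Hs).
assert (Hma := Rabs_pos_lt m Hm0).
set (M := mass (seq 0 (S n)) X Y s) in *.
assert (He2 : 0 < e ^ 2) by nra.
split.
- eapply Rle_trans.
  + apply (corr4_le (seq 0 (S n)) X Y (om m) (gain m) coupling (3 / 2) (mu m) del);
      try exact (nonresonant_modes m Hm_lo Hm_hi); lra.
  + fold M.
    assert (HM2 : M ^ 2 <= 16 * (e ^ 2 * (64 / 10000 * mu m))).
    { nra. }
    assert (Hd : 0 < 2 * coupling / mu m) by (apply Rdiv_lt_0_compat; lra).
    eapply Rle_trans; [apply Rmult_le_compat_l; [lra | exact HM2]|].
    replace (2 * coupling / mu m * (16 * (e ^ 2 * (64 / 10000 * mu m)))) with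
      (2048 / 10000 * coupling * e ^ 2) by (field; lra).
    nra.
- eapply Rle_trans.
  + apply (corr6_le (seq 0 (S n)) X Y (om m) (gain m) coupling (3 / 2) (mu m) del)
      with (kap := kap s).
    all: try exact (nonresonant_modes m Hm_lo Hm_hi); auto; try lra.
  + fold M.
    assert (HM3 : M ^ 3 <= 64 * (e ^ 2 * (Rabs m * mu m / 3222))).
    { assert (M ^ 3 <= (4 * e ^ 2) ^ 3) by (apply pow_incr; lra).
      assert (e ^ 2 * e ^ 4 <= e ^ 2 * (Rabs m * mu m / 3222)) by
        (apply Rmult_le_compat_l; lra).
      replace ((4 * e ^ 2) ^ 3) with (64 * (e ^ 2 * e ^ 4)) in H by ring. lra. }
    assert (Hd : 0 < 24 * coupling ^ 2 * (3 / 2) / (mu m * del)).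
    { apply Rdiv_lt_0_compat; nra. }
    eapply Rle_trans; [apply Rmult_le_compat_l; [lra | exact HM3]|].
    unfold del.
    replace (24 * coupling ^ 2 * (3 / 2) / (mu m * (3 / 5 * Rabs m)) *
      (64 * (e ^ 2 * (Rabs m * mu m / 3222)))) with
      (3840 / 3222 * coupling ^ 2 * e ^ 2) by (field; lra).
    assert (coupling ^ 2 <= 1 / 36) by nra. nra.
Qed.

(** The error of order eight, integrated over the admissible time, plus the effect
    of the modes beyond the truncation. *)
Lemma modified_change :
  exists C, forall n,
  Rabs (modified n t - modified n 0) <= 98 / 1000 * e ^ 2 + C * tail0 n.
Proof.
assert (Hc := coupling_bounds).
assert (Hmu : 0 < mu m) by (apply mu_pos; lra).
assert (Hma := Rabs_pos_lt m Hm0).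
assert (He2 : 0 < e ^ 2) by nra.
set (ex := exp (6 * coupling * e ^ 2 * Rabs t)).
set (A := 2 * (4 * e ^ 2) + 6 * coupling * (3 / 2) / mu m * (4 * e ^ 2) ^ 2).
exists (coupling * ex * A * Rabs t). intros n.
assert (HD : forall s, seg t s -> exists d, is_derive (modified n) s d /\
  Rabs d <= coupling * ex * tail0 n * A +
    4 * coupling * e ^ 2 *
    (144 * coupling ^ 2 * (3 / 2) ^ 2 / (mu m * del) * (4 * e ^ 2) ^ 3)).
{ intros s Hs. assert (Hs0 := seg_trans _ _ _ Ht Hs).
  assert (HM := mass_le n s Hs).
  assert (Hrest := rest_le n s Hs). fold ex in Hrest.
  set (rho := kap s - coupling * lsum (seq 0 (S n)) (fun k => X k s ^ 2)) in *.
  destruct (modified_action_derive (seq 0 (S n)) X Y (om m) (gain m) coupling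
    (3 / 2) (mu m) del) with (t := s) (kap := kap s) (rho := rho) as [d [Dd Bd]];
    try exact (nonresonant_modes m Hm_lo Hm_hi); auto; try lra.
  - unfold rho; ring.
  - exists d; split; [exact Dd|].
    eapply Rle_trans; [exact Bd|].
    set (M := mass (seq 0 (S n)) X Y s) in *.
    assert (HM2 : M ^ 2 <= (4 * e ^ 2) ^ 2) by (apply pow_incr; lra).
    assert (HM3 : M ^ 3 <= (4 * e ^ 2) ^ 3) by (apply pow_incr; lra).
    assert (HM2' : 0 <= M ^ 2) by (apply pow_le; lra).
    assert (HM3' : 0 <= M ^ 3) by (apply pow_le; lra).
    assert (Hd1 : 0 < 6 * coupling * (3 / 2) / mu m) by (apply Rdiv_lt_0_compat; lra).
    assert (Hd2 : 0 < 144 * coupling ^ 2 * (3 / 2) ^ 2 / (mu m * del)).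
    { assert (Hc2 : 0 < coupling ^ 2) by (apply pow_lt; lra).
      apply Rdiv_lt_0_compat; [lra | apply Rmult_lt_0_compat; auto]. }
    apply Rplus_le_compat; apply Rmult_le_compat.
    + apply Rabs_pos.
    + apply Rplus_le_le_0_compat; [lra|]. apply Rmult_le_pos; lra.
    + rewrite Rabs_pos_eq; lra.
    + unfold A. apply Rplus_le_compat; [lra|]. apply Rmult_le_compat_l; lra.
    + apply Rabs_pos.
    + apply Rmult_le_pos; lra.
    + assert (H := kap_le s Hs). rewrite Rabs_pos_eq; lra.
    + apply Rmult_le_compat_l; lra. }
destruct (MVT_seg (modified n) (Derive (modified n)) t) as [s [Hs E]].
{ intros s Hs. destruct (HD s Hs) as [d [Dd _]]. rewrite (is_derive_unique _ _ _ Dd). exact Dd. }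
rewrite E, Rabs_mult. destruct (HD s Hs) as [d [Dd Bd]].
rewrite (is_derive_unique _ _ _ Dd).
eapply Rle_trans; [apply Rmult_le_compat_r; [apply Rabs_pos | exact Bd]|].
rewrite Rmult_plus_distr_r, Rplus_comm.
apply Rplus_le_compat; [|right; ring].
unfold del.
replace (4 * coupling * e ^ 2 *
  (144 * coupling ^ 2 * (3 / 2) ^ 2 / (mu m * (3 / 5 * Rabs m)) * (4 * e ^ 2) ^ 3) * Rabs t)
  with (138240 * coupling ^ 3 / (mu m * Rabs m) * e ^ 2 * (Rabs t * e ^ 6)) by (field; lra).
assert (Hd : 0 < 138240 * coupling ^ 3 / (mu m * Rabs m)).
{ apply Rdiv_lt_0_compat; [|nra]. assert (0 < coupling ^ 3) by (apply pow_lt; lra). lra. }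
eapply Rle_trans; [apply Rmult_le_compat_l; [apply Rmult_le_pos; lra | exact Htime]|].
replace (138240 * coupling ^ 3 / (mu m * Rabs m) * e ^ 2 * (Rabs m * mu m / 6595)) with
  (138240 / 6595 * coupling ^ 3 * e ^ 2) by (field; lra).
assert (coupling ^ 3 <= (1 / 6) ^ 3) by (apply pow_incr; lra).
apply Rmult_le_compat_r; lra.
Qed.

(** The truncation error vanishes with the tail of the initial mass, so the
    bound for the truncated sums passes to the limit. *)
Lemma action_slow : Rabs (total_action t - total_action 0) <= 1 / 4 * e ^ 2.
Proof.
destruct modified_change as [C HC].
set (A := fun n s => sum_n (fun k => (X k s * X k s + Y k s * Y k s) * / gain m k) n).
assert (Hseg0 := seg_trans _ _ _ Ht (seg_0 t)).
assert (Hbd : forall n, Rabs (A n t - A n 0) <= 236 / 1000 * e ^ 2 + C * tail0 n).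
{ intros n. specialize (HC n).
  destruct (corrections_le n t (seg_end t)) as [H1 H2].
  destruct (corrections_le n 0 (seg_0 t)) as [H3 H4].
  unfold modified, action in HC. rewrite !lsum_seq in HC.
  change (sum_n (fun k => osc_size X Y (k, true) t * / gain m k) n) with (A n t) in HC.
  change (sum_n (fun k => osc_size X Y (k, true) 0 * / gain m k) n) with (A n 0) in HC.
  set (c4 := corr4 _ _ _ _ _ t) in *. set (c6 := corr6 _ _ _ _ _ _ t) in *.
  set (c4' := corr4 _ _ _ _ _ 0) in *. set (c6' := corr6 _ _ _ _ _ _ 0) in *.
  apply Rabs_le_between in H1, H2, H3, H4, HC. apply Rabs_le_between. lra. }
assert (Hlim : forall s, seg t0 s -> is_lim_seq (fun n => A n s) (total_action s)).
{ intros s Hs. exact (Series_correct _ (ex_series_action s Hs)). }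
assert (Htail : is_lim_seq tail0 0).
{ assert (Hex := Hsum 0 Hseg0).
  apply (is_lim_seq_ext (fun n => total_mass 0 -
    sum_n (fun k => X k 0 * X k 0 + Y k 0 * Y k 0) n)).
  - intros n. unfold total_mass. rewrite (Series_tail _ n Hex).
    unfold tail0. ring.
  - replace (Finite 0) with (Finite (total_mass 0 - total_mass 0)) by (f_equal; ring).
    apply is_lim_seq_minus'; [apply is_lim_seq_const | exact (Series_correct _ Hex)]. }
assert (H : Rbar_le (Rabs (total_action t - total_action 0))
  (236 / 1000 * e ^ 2 + C * 0)).
{ eapply is_lim_seq_le; [exact Hbd| |].
  - apply (is_lim_seq_abs _ (total_action t - total_action 0)).
    apply is_lim_seq_minus'; now apply Hlim.
  - apply (is_lim_seq_plus' _ _ (236 / 1000 * e ^ 2) (C * 0)); [apply is_lim_seq_const|].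
    apply (is_lim_seq_scal_l _ C 0 Htail). }
simpl in H. nra.
Qed.
End SlowMass.
End ModeFlow.

Section MassBound.
Variables (m : R) (X Y : nat -> R -> R) (kap : R -> R) (t0 : R).
Variables (u0 v0 : nat -> R) (e : R).
Hypothesis (Hm_lo : - (1 / 2) <= m) (Hm_hi : m <= 1) (Hm0 : m <> 0).
Hypothesis (HX : forall s, seg t0 s -> forall k,
  is_derive (X k) s (om m k * Y k s)).
Hypothesis (HY : forall s, seg t0 s -> forall k,
  is_derive (Y k) s (- om m k * X k s - kap s * gain m k * X k s)).
Hypothesis (Hsum : forall s, seg t0 s ->
  ex_series (fun k => X k s * X k s + Y k s * Y k s)).
Hypothesis (Hkap : forall s, seg t0 s ->
  kap s = coupling * Series (fun k => X k s ^ 2)).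
Hypothesis (Hcont : forall s, seg t0 s -> continuous (total_mass X Y) s).
Hypothesis (HX0 : forall k, X k 0 = freq k * u0 k).
Hypothesis (HY0 : forall k, Y k 0 = freq k * v0 k / om m k).
Hypothesis (Hu : ex_series (fun k => (freq k * u0 k) ^ 2)).
Hypothesis (Hv : ex_series (fun k => v0 k ^ 2)).
Hypothesis (Hue : Series (fun k => (freq k * u0 k) ^ 2) <= e ^ 2).
Hypothesis (Hve : Series (fun k => v0 k ^ 2) <= (1 + m) * e ^ 2).
Hypothesis (He : 0 <= e).
Hypothesis (Hsmall2 : e ^ 2 <= 64 / 10000 * mu m).
Hypothesis (Hsmall4 : e ^ 4 <= Rabs m * mu m / 3222).
Hypothesis (Htime : Rabs t0 * e ^ 6 <= Rabs m * mu m / 6595).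

Let root1_sqr : sqrt (1 + m) ^ 2 = 1 + m.
Proof. rewrite <- Rsqr_pow2. apply Rsqr_sqrt. lra. Qed.

Let root1_pos : 0 < sqrt (1 + m).
Proof. apply sqrt_lt_R0. lra. Qed.

Lemma initial_velocity_term k : Y k 0 * Y k 0 = v0 k ^ 2 / (freq k ^ 2 + m).
Proof.
assert (Hs : 0 < sqrt (freq k ^ 2 + m)) by (apply root_pos; lra).
assert (Hs2 : sqrt (freq k ^ 2 + m) ^ 2 = freq k ^ 2 + m) by (apply root_sqr; lra).
assert (Hf := freq_ge1 k).
rewrite HY0. unfold om. set (s := sqrt (freq k ^ 2 + m)) in *. rewrite <- Hs2. field; lra.
Qed.

Lemma gain_inv_eq k : / gain m k = sqrt (freq k ^ 2 + m) / freq k.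
Proof.
assert (Hs : 0 < sqrt (freq k ^ 2 + m)) by (apply root_pos; lra).
assert (Hf := freq_ge1 k). unfold gain. field; lra.
Qed.

Lemma root_le_pos k : 0 <= m -> sqrt (freq k ^ 2 + m) <= sqrt (1 + m) * freq k.
Proof.
intros Hm. assert (Hf := freq_ge1 k). assert (Hf2 : 1 <= freq k ^ 2) by nra.
assert (Hs2 : sqrt (freq k ^ 2 + m) ^ 2 = freq k ^ 2 + m) by (apply root_sqr; lra).
apply Rsqr_incr_0_var; [|nra]. rewrite !Rsqr_pow2, Rpow_mult_distr, Hs2, root1_sqr. nra.
Qed.

Lemma root_ge_neg k : m <= 0 -> sqrt (1 + m) * freq k <= sqrt (freq k ^ 2 + m) <= freq k.
Proof.
intros Hm. assert (Hf := freq_ge1 k). assert (Hf2 : 1 <= freq k ^ 2) by nra. assert (Hs : 0 < sqrt (freq k ^ 2 + m)) by (apply root_pos; lra).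
assert (Hs2 : sqrt (freq k ^ 2 + m) ^ 2 = freq k ^ 2 + m) by (apply root_sqr; lra).
split; (apply Rsqr_incr_0_var; [|lra]);
  rewrite ?Rsqr_pow2, ?Rpow_mult_distr, Hs2, ?root1_sqr; nra.
Qed.

Lemma initial_mass : total_mass X Y 0 <= 2 * e ^ 2.
Proof.
unfold total_mass.
apply Rle_trans with (Series (fun k => (freq k * u0 k) ^ 2 + / (1 + m) * v0 k ^ 2)).
- apply Series_le; [|apply ex_series_Rplus; auto; now apply ex_series_Rscal].
  intros k; split; [nra|]. rewrite initial_velocity_term, HX0.
  assert (Hf := freq_ge1 k).
  apply Rplus_le_compat; [right; ring|].
  unfold Rdiv; rewrite Rmult_comm. apply Rmult_le_compat_r; [apply pow2_ge_0|].
  apply Rinv_le_contravar; nra.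
- rewrite Series_plus by (auto; now apply ex_series_Rscal). rewrite Series_scal_l.
  assert (/ (1 + m) * Series (fun k => v0 k ^ 2) <= e ^ 2); [|lra].
  apply (Rmult_le_reg_l (1 + m)); [lra|].
  rewrite <- Rmult_assoc, Rinv_r, Rmult_1_l; lra.
Qed.

Lemma initial_action :
  total_action m X Y 0 <= (Rmax 1 (sqrt (1 + m)) + sqrt (1 + m)) * e ^ 2.
Proof.
set (w := sqrt (1 + m)) in *. set (p := Rmax 1 w).
assert (Hp : 1 <= p) by apply Rmax_l.
unfold total_action.
apply Rle_trans with (Series (fun k => p * (freq k * u0 k) ^ 2 + / w * v0 k ^ 2)).
- apply Series_le; [|apply ex_series_Rplus; now apply ex_series_Rscal].
  intros k. assert (Hg : 0 < gain m k) by (apply gain_pos; lra).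
  assert (Hgi := Rinv_0_lt_compat _ Hg).
  split; [nra|]. rewrite Rmult_plus_distr_r.
  assert (Hf := freq_ge1 k).
  assert (Hs : 0 < sqrt (freq k ^ 2 + m)) by (apply root_pos; lra).
  assert (Hs2 : sqrt (freq k ^ 2 + m) ^ 2 = freq k ^ 2 + m) by (apply root_sqr; lra).
  apply Rplus_le_compat.
  + rewrite HX0, gain_inv_eq.
    replace (freq k * u0 k * (freq k * u0 k)) with ((freq k * u0 k) ^ 2) by ring.
    rewrite Rmult_comm. apply Rmult_le_compat_r; [apply pow2_ge_0|].
    apply (proj2 (Rle_div_l _ _ _ (Rlt_le_trans _ _ _ Rlt_0_1 Hf))).
    unfold p, Rmax. destruct (Rle_dec 1 w) as [H | H].
    * apply root_le_pos. unfold w in *. nra.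
    * apply Rnot_le_lt in H. destruct (root_ge_neg k); [unfold w in *; nra | lra].
  + rewrite initial_velocity_term, gain_inv_eq.
    replace (v0 k ^ 2 / (freq k ^ 2 + m) * (sqrt (freq k ^ 2 + m) / freq k))
      with (v0 k ^ 2 * / (om m k))
      by (unfold om; set (s := sqrt (freq k ^ 2 + m)) in *; rewrite <- Hs2; field; lra).
    rewrite Rmult_comm. apply Rmult_le_compat_r; [apply pow2_ge_0|].
    apply Rinv_le_contravar; [exact root1_pos|]. apply om_ge; lra.
- rewrite Series_plus by now apply ex_series_Rscal. rewrite !Series_scal_l.
  assert (/ w * Series (fun k => v0 k ^ 2) <= w * e ^ 2).
  { apply (Rmult_le_reg_l w); [exact root1_pos|].
    rewrite <- Rmult_assoc, Rinv_r, Rmult_1_l by lra.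
    replace (w * (w * e ^ 2)) with (w ^ 2 * e ^ 2) by ring. now rewrite root1_sqr. }
  rewrite Rmult_plus_distr_r. apply Rplus_le_compat; [|exact H].
  apply Rmult_le_compat_l; lra.
Qed.

Lemma mass_le_action s : seg t0 s ->
  total_mass X Y s <= Rmax 1 (/ sqrt (1 + m)) * total_action m X Y s.
Proof.
intros Hs. set (w := sqrt (1 + m)) in *. set (p := Rmax 1 (/ w)).
unfold total_mass, total_action. rewrite <- Series_scal_l.
apply Series_le; [|apply ex_series_Rscal; now apply (ex_series_action m X Y t0)].
intros k. assert (Hg : 0 < gain m k) by (apply gain_pos; lra).
split; [nra|].
assert (Hgp : gain m k <= p).
{
  assert (Hr : 0 < sqrt (freq k ^ 2 + m)) by (apply root_pos; lra).
  unfold gain. apply (proj2 (Rle_div_l _ _ _ Hr)).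
  destruct (Rle_dec 0 m) as [Hm | Hm].
  - assert (H1 : 1 <= p) by apply Rmax_l.
    apply Rle_trans with (1 * sqrt (freq k ^ 2 + m)); [|apply Rmult_le_compat_r; lra].
    rewrite Rmult_1_l.
    apply Rsqr_incr_0_var; [|lra]. rewrite !Rsqr_pow2, root_sqr; lra.
  - destruct (root_ge_neg k) as [H1 _]; [lra|]. fold w in H1.
    assert (H2 : / w <= p) by apply Rmax_r.
    apply Rle_trans with (/ w * sqrt (freq k ^ 2 + m)); [|apply Rmult_le_compat_r; lra].
    apply (Rmult_le_reg_l w); [exact root1_pos|].
    rewrite <- Rmult_assoc, Rinv_r, Rmult_1_l; [exact H1|].
    lra. }
assert (Hn : 0 <= X k s * X k s + Y k s * Y k s) by nra.
replace (p * _) with ((X k s * X k s + Y k s * Y k s) * (p * / gain m k)) by ring.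
rewrite <- (Rmult_1_r (X k s * X k s + Y k s * Y k s)) at 1.
apply Rmult_le_compat_l; [exact Hn|].
apply (proj1 (Rle_div_r _ _ _ Hg)). lra.
Qed.

(** A change of the action by e^2 / 4 leaves room below 4 e^2: the worst cases are
    m = 1, where the initial action may reach 2 sqrt 2 e^2, and m = - 1 / 2, where the
    mass may exceed the action by the factor sqrt 2. *)
Lemma mass_step t : 0 < e -> seg t0 t ->
  (forall s, seg t s -> total_mass X Y s <= 4 * e ^ 2) ->
  total_mass X Y t <= 31 / 10 * e ^ 2.
Proof.
intros He0 Ht Hmass.
assert (Hslow : Rabs (total_action m X Y t - total_action m X Y 0) <= 1 / 4 * e ^ 2).
{ apply (action_slow m X Y kap t0); auto.
  eapply Rle_trans; [|exact Htime]. apply Rmult_le_compat_r; [nra|]. now apply seg_Rabs. }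
assert (H1 := mass_le_action t Ht). assert (H2 := initial_action).
apply Rabs_le_between in Hslow.
set (w := sqrt (1 + m)) in *.
assert (Hw : 7 / 10 <= w <= 15 / 10).
{ unfold w in *; split; apply Rsqr_incr_0_var; try lra;
    rewrite Rsqr_sqrt by lra; unfold Rsqr; lra. }
assert (Hw2 : w <= 14143 / 10000).
{ unfold w in *; apply Rsqr_incr_0_var; try lra;
    rewrite Rsqr_sqrt by lra; unfold Rsqr; lra. }
assert (Hwi : 70710 / 100000 <= w).
{ unfold w in *; apply Rsqr_incr_0_var; try lra;
    rewrite Rsqr_sqrt by lra; unfold Rsqr; lra. }
destruct (Rle_dec 1 w) as [Hw1 | Hw1].
- rewrite (Rmax_right 1 w) in H2 by lra.
  assert (Hi : / w <= 1) by (rewrite <- Rinv_1; apply Rinv_le_contravar; lra).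
  rewrite Rmax_left in H1 by lra. nra.
- apply Rnot_le_lt in Hw1. rewrite (Rmax_left 1 w) in H2 by lra.
  assert (Hi : 1 <= / w) by (rewrite <- Rinv_1 at 1; apply Rinv_le_contravar; lra).
  rewrite Rmax_right in H1 by lra.
  eapply Rle_trans; [exact H1|].
  apply (Rmult_le_reg_l w); [lra|].
  rewrite <- Rmult_assoc, Rinv_r, Rmult_1_l by lra. nra.
Qed.

(** For e = 0 the smallness conditions degenerate, and uniqueness of the zero
    solution follows from the growth estimate of the single modes. *)
Lemma mass_bound : total_mass X Y t0 <= 31 / 10 * e ^ 2.
Proof.
destruct (Rle_lt_or_eq_dec _ _ He) as [He0 | He0].
- assert (He2 : 0 < e ^ 2) by nra. assert (Hinit := initial_mass).
  assert (Hall : forall t, seg t0 t -> total_mass X Y t < 4 * e ^ 2).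
  { intros t Ht. apply bootstrap.
    - intros s Hs; apply Hcont. now apply (seg_trans _ t).
    - lra.
    - intros s Hs Hb. apply mass_step in Hb; auto; [lra|]. now apply (seg_trans _ t). }
  apply mass_step; auto using seg_end.
  intros s Hs. left; now apply Hall.
- assert (Hinit := initial_mass). rewrite <- He0 in *.
  assert (Hk0 : forall k, X k 0 * X k 0 + Y k 0 * Y k 0 = 0).
  { intros k. assert (H := term_le_Series (fun k => X k 0 * X k 0 + Y k 0 * Y k 0) k).
    cbv beta in H. assert (0 <= X k 0 * X k 0 + Y k 0 * Y k 0) by nra.
    unfold total_mass in Hinit.
    assert (X k 0 * X k 0 + Y k 0 * Y k 0 <= 2 * 0 ^ 2); [|lra].
    eapply Rle_trans; [apply H|exact Hinit]; [intros; nra | apply Hsum, seg_0]. }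
  assert (Hzero : forall t K, seg t0 t -> (forall s, seg t s -> Rabs (kap s) <= K) ->
    total_mass X Y t = 0).
  { intros t K Ht HK. apply Series_zero; intros k.
    assert (H := mode_growth m X Y kap t0 Hm_lo HX HY K t k Ht HK).
    rewrite Hk0 in H. nra. }
  assert (Hall : forall t, seg t0 t -> total_mass X Y t < 1).
  { intros t Ht. apply bootstrap.
    - intros s Hs; apply Hcont. now apply (seg_trans _ t).
    - lra.
    - intros s Hs Hb. rewrite (Hzero s coupling); [lra | now apply (seg_trans _ t) |].
      intros r Hr. assert (Hr0 := seg_trans _ _ _ Ht (seg_trans _ _ _ Hs Hr)).
      assert (Hkb := kap_bounds X Y kap t0 Hsum Hkap r Hr0).
      specialize (Hb r Hr). assert (Hc := coupling_bounds).
      rewrite Rabs_pos_eq; nra. }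
  rewrite (Hzero t0 coupling); [lra | apply seg_end |].
  intros r Hr. assert (Hkb := kap_bounds X Y kap t0 Hsum Hkap r Hr).
  specialize (Hall r Hr). assert (Hc := coupling_bounds). rewrite Rabs_pos_eq; nra.
Qed.
End MassBound.

(** * Smooth bumps *)

Definition smooth (f : R -> R) : Prop := forall n x, ex_derive_n f n x.

Lemma Derive_n_shift (f g : R -> R) (n : nat) :
  (forall x, is_derive f x (g x)) -> forall x, Derive_n f (S n) x = Derive_n g n x.
Proof.
intros H. induction n as [|n IH]; intros x.
- simpl. now apply is_derive_unique.
- change (Derive (Derive_n f (S n)) x = Derive (Derive_n g n) x).
  apply Derive_ext, IH.
Qed.

(** Induction on the order of differentiation, for all members of the class at
    once. *)
Lemma smooth_by_class (P : (R -> R) -> Prop) :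
  (forall f, P f -> exists g, P g /\ forall x, is_derive f x (g x)) ->
  forall f, P f -> smooth f.
Proof.
intros HP f Hf n. revert f Hf.
induction n as [|n IH]; intros f Hf x; [exact I|].
destruct (HP f Hf) as [g [Hg Hd]].
destruct n as [|n].
- exists (g x). apply Hd.
- change (ex_derive (Derive_n f (S n)) x).
  apply (ex_derive_ext (Derive_n g n)).
  + intros y; symmetry; now apply Derive_n_shift.
  + exact (IH g Hg x).
Qed.

Lemma smooth_primitive (f g : R -> R) :
  (forall x, is_derive f x (g x)) -> smooth g -> smooth f.
Proof.
intros Hd Hg n x. destruct n as [|[|n]]; [exact I | exists (g x); apply Hd |].
change (ex_derive (Derive_n f (S n)) x).
apply (ex_derive_ext (Derive_n g n)).
- intros y; symmetry; now apply Derive_n_shift.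
- exact (Hg (S n) x).
Qed.

(** From 1 + y / n <= exp (y / n), raised to the power n. *)
Lemma pow_exp_le (n : nat) (y : R) :
  0 <= y -> y ^ n * exp (- y) <= INR n ^ n.
Proof.
intros Hy. destruct n as [|n].
- simpl. rewrite Rmult_1_l. rewrite <- exp_0.
  destruct Hy as [Hy | <-]; [left; apply exp_increasing; lra | rewrite Ropp_0; lra].
- assert (Hn : 0 < INR (S n)) by (apply lt_0_INR; lia).
  assert (H : (y / INR (S n)) ^ S n <= exp y).
  { replace (exp y) with (exp (y / INR (S n)) ^ S n).
    - apply pow_incr. split; [apply Rmult_le_pos; auto; left; now apply Rinv_0_lt_compat|].
      assert (H := exp_ineq1_le (y / INR (S n))). lra.
    - rewrite <- Rpower_pow by apply exp_pos. unfold Rpower. rewrite ln_exp.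
      f_equal. field; lra. }
  unfold Rdiv in H. rewrite Rpow_mult_distr, pow_inv in H.
  assert (Hp : 0 < INR (S n) ^ S n) by now apply pow_lt.
  rewrite exp_Ropp. apply (proj2 (Rle_div_l _ _ _ (exp_pos y))).
  apply (Rmult_le_compat_l (INR (S n) ^ S n)) in H; [|lra].
  replace (INR (S n) ^ S n * (y ^ S n * / INR (S n) ^ S n)) with (y ^ S n) in H
    by (field; lra).
  exact H.
Qed.

(** The functions x^(-n) exp (- 1 / x), extended by 0; differentiation maps them to
    combinations of each other. *)
Definition flat (n : nat) (x : R) : R :=
  if Rlt_dec 0 x then (/ x) ^ n * exp (- / x) else 0.

Lemma flat_pos n x : 0 < x -> flat n x = (/ x) ^ n * exp (- / x).
Proof. intros H; unfold flat; destruct Rlt_dec; lra. Qed.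

Lemma flat_neg n x : x <= 0 -> flat n x = 0.
Proof. intros H; unfold flat; destruct Rlt_dec; lra. Qed.

(** At 0 the difference quotient is the next function of the family, which is at
    most a constant times h by [pow_exp_le]. *)
Lemma flat_derive n x :
  is_derive (flat n) x (flat (S (S n)) x - INR n * flat (S n) x).
Proof.
destruct (Rtotal_order x 0) as [Hx | [-> | Hx]].
- rewrite !flat_neg by lra.
  apply (is_derive_ext_loc (fun _ => 0)).
  + exists (mkposreal (- x) ltac:(lra)). intros y Hy. apply Rabs_def2 in Hy.
    change (y - x < - x /\ - - x < y - x) in Hy. rewrite flat_neg; lra.
  + eapply is_derive_cast; [apply is_derive_Rconst | ring].
- rewrite !flat_neg by lra. apply is_derive_Reals. intros e He.
  set (C := INR (S (S n)) ^ S (S n)).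
  assert (HC : 0 < C) by (apply pow_lt, lt_0_INR; lia).
  exists (mkposreal (e / C) ltac:(now apply Rdiv_lt_0_compat)). simpl.
  intros h Hh0 Hh. rewrite Rplus_0_l, (flat_neg n 0) by lra.
  replace (0 - INR n * 0) with 0 by ring. rewrite !Rminus_0_r.
  destruct (Rlt_dec 0 h) as [Hp | Hp].
  + rewrite flat_pos by lra.
    assert (Hi : 0 < / h) by now apply Rinv_0_lt_compat.
    assert (H := pow_exp_le (S (S n)) (/ h) ltac:(lra)). fold C in H.
    replace ((/ h) ^ n * exp (- / h) / h) with
      ((/ h) ^ S (S n) * exp (- / h) * h) by (simpl; field; lra).
    rewrite Rabs_pos_eq in Hh by lra.
    assert (Hpos : 0 <= (/ h) ^ S (S n) * exp (- / h)).
    { apply Rmult_le_pos; [apply pow_le; lra | left; apply exp_pos]. }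
    rewrite Rabs_pos_eq by (apply Rmult_le_pos; lra).
    apply Rle_lt_trans with (C * h); [apply Rmult_le_compat_r; lra|].
    apply (Rmult_lt_compat_l C) in Hh; [|exact HC].
    replace (C * (e / C)) with e in Hh by (field; lra). exact Hh.
  + rewrite flat_neg by lra. unfold Rdiv. rewrite Rmult_0_l, Rabs_R0. exact He.
- rewrite !flat_pos by lra.
  apply (is_derive_ext_loc (fun y => (/ y) ^ n * exp (- / y))).
  + exists (mkposreal x Hx). intros y Hy. apply Rabs_def2 in Hy.
    change (y - x < x /\ - x < y - x) in Hy. rewrite flat_pos; lra.
  + eapply is_derive_cast.
    * apply is_derive_Rmult.
      -- instantiate (1 := - INR n * (/ x) ^ S n).
         auto_derive; [lra|]. destruct n as [|n]; [simpl; ring|].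
         simpl pred. simpl pow. field; lra.
      -- instantiate (1 := (/ x) ^ 2 * exp (- / x)).
         auto_derive; [lra|]. field; lra.
    * simpl. ring.
Qed.

Inductive flat_product (d : R) : (R -> R) -> Prop :=
| flat_product_base i j :
    flat_product d (fun x => flat i (x + d) * flat j (d - x))
| flat_product_plus f g :
    flat_product d f -> flat_product d g -> flat_product d (fun x => f x + g x)
| flat_product_scal c f :
    flat_product d f -> flat_product d (fun x => c * f x).

Lemma flat_product_smooth d f : flat_product d f -> smooth f.
Proof.
revert f; apply smooth_by_class.
intros f Hf; induction Hf as [i j | f g _ [f' [Hf' Df]] _ [g' [Hg' Dg]] | c f _ [f' [Hf' Df]]].
- exists (fun x =>
    (flat (S (S i)) (x + d) * flat j (d - x) +
     (- INR i) * (flat (S i) (x + d) * flat j (d - x))) +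
    (-1) * (flat i (x + d) * flat (S (S j)) (d - x) +
     (- INR j) * (flat i (x + d) * flat (S j) (d - x)))).
  split.
  + repeat first [apply flat_product_base | apply flat_product_plus | apply flat_product_scal].
  + intros x. eapply is_derive_cast.
    * apply (is_derive_Rmult (fun y => flat i (y + d)) (fun y => flat j (d - y))).
      -- apply (is_derive_comp (flat i) (fun y => y + d)); [apply flat_derive|].
         instantiate (1 := 1). auto_derive; [easy | ring].
      -- apply (is_derive_comp (flat j) (fun y => d - y)); [apply flat_derive|].
         instantiate (1 := -1). auto_derive; [easy | ring].
    * unfold scal; simpl; unfold mult; simpl. ring.
- exists (fun x => f' x + g' x). split; [now constructor|].
  intros x; now apply is_derive_Rplus.
- exists (fun x => c * f' x). split; [now constructor|].
  intros x; now apply is_derive_Rscal.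
Qed.

Definition bump (d x : R) : R := flat 0 (x + d) * flat 0 (d - x).

Lemma bump_smooth d : smooth (bump d).
Proof. apply (flat_product_smooth d). unfold bump; constructor. Qed.

Lemma bump_continuous d x : continuous (bump d) x.
Proof.
apply (ex_derive_continuous (V := R_NormedModule)). exact (bump_smooth d 1%nat x).
Qed.

Lemma bump_out d x : d <= Rabs x -> bump d x = 0.
Proof.
intros H. unfold bump, Rabs in *. destruct Rcase_abs.
- rewrite (flat_neg 0 (x + d)) by lra; ring.
- rewrite (flat_neg 0 (d - x)) by lra; ring.
Qed.

Lemma bump_pos d x : Rabs x < d -> 0 < bump d x.
Proof.
intros H. apply Rabs_def2 in H. unfold bump. rewrite !flat_pos by lra. simpl.
rewrite !Rmult_1_l. apply Rmult_lt_0_compat; apply exp_pos.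
Qed.

(** Successive primitives of the bump; beyond the support they are constant and
    affine. *)
Definition bump1 (d x : R) : R := RInt (bump d) (- d) x.
Definition bump2 (d x : R) : R := RInt (bump1 d) (- d) x.

Lemma ex_RInt_cont (f : R -> R) (a b : R) :
  (forall x, continuous f x) -> ex_RInt f a b.
Proof. intros H. apply (ex_RInt_continuous (V := R_CompleteNormedModule)). auto. Qed.

Lemma primitive_derive (f : R -> R) (a x : R) :
  (forall x, continuous f x) -> is_derive (fun y => RInt f a y) x (f x).
Proof.
intros H. apply (is_derive_RInt f (fun y => RInt f a y) a x); [|apply H].
apply filter_forall; intros z. apply (RInt_correct (V := R_CompleteNormedModule)).
now apply ex_RInt_cont.
Qed.

Lemma bump1_derive d x : is_derive (bump1 d) x (bump d x).
Proof. apply primitive_derive. apply bump_continuous. Qed.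

Lemma bump1_continuous d x : continuous (bump1 d) x.
Proof.
eapply is_derive_continuous, bump1_derive.
Qed.

Lemma bump2_derive d x : is_derive (bump2 d) x (bump1 d x).
Proof. apply primitive_derive. apply bump1_continuous. Qed.

Lemma bump2_smooth d : smooth (bump2 d).
Proof.
apply (smooth_primitive _ (bump1 d)); [apply bump2_derive|].
apply (smooth_primitive _ (bump d)); [apply bump1_derive | apply bump_smooth].
Qed.

Lemma RInt_ext_R (f g : R -> R) (a b : R) :
  (forall x, Rmin a b < x < Rmax a b -> f x = g x) -> RInt f a b = RInt g a b.
Proof. apply (RInt_ext (V := R_CompleteNormedModule)). Qed.

Lemma RInt_zero (f : R -> R) a b :
  (forall x, Rmin a b < x < Rmax a b -> f x = 0) -> RInt f a b = 0.
Proof.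
intros H. rewrite (RInt_ext _ (fun _ => 0)) by auto.
rewrite RInt_const. unfold scal; simpl; unfold mult; simpl. ring.
Qed.

Lemma RInt_Rplus (f g : R -> R) a b :
  (forall x, continuous f x) -> (forall x, continuous g x) ->
  RInt (fun x => f x + g x) a b = RInt f a b + RInt g a b.
Proof.
intros Hf Hg. exact (RInt_plus (V := R_CompleteNormedModule) f g a b
  (ex_RInt_cont f a b Hf) (ex_RInt_cont g a b Hg)).
Qed.

Lemma RInt_Rscal (f : R -> R) c a b :
  (forall x, continuous f x) -> RInt (fun x => c * f x) a b = c * RInt f a b.
Proof.
intros Hf. exact (RInt_scal (V := R_CompleteNormedModule) f a b c (ex_RInt_cont f a b Hf)).
Qed.

Lemma bump1_left d x : 0 < d -> x <= - d -> bump1 d x = 0.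
Proof.
intros Hd Hx. apply RInt_zero. rewrite Rmin_right, Rmax_left by lra.
intros y Hy. apply bump_out. rewrite Rabs_left; lra.
Qed.

Lemma bump2_left d x : 0 < d -> x <= - d -> bump2 d x = 0.
Proof.
intros Hd Hx. apply RInt_zero. rewrite Rmin_right, Rmax_left by lra.
intros y Hy. apply bump1_left; lra.
Qed.

Lemma RInt_Chasles_cont (f : R -> R) (a b c : R) :
  (forall x, continuous f x) -> RInt f a c = RInt f a b + RInt f b c.
Proof.
intros H. symmetry. apply (RInt_Chasles (V := R_CompleteNormedModule)); now apply ex_RInt_cont.
Qed.

Lemma bump1_right d x : 0 < d -> d <= x -> bump1 d x = bump1 d d.
Proof.
intros Hd Hx. unfold bump1 at 1.
rewrite (RInt_Chasles_cont _ _ d) by apply bump_continuous.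
rewrite (RInt_zero _ d x); [unfold bump1; ring|].
rewrite Rmin_left, Rmax_right by lra.
intros y Hy. apply bump_out. rewrite Rabs_pos_eq; lra.
Qed.

Lemma bump2_right d x : 0 < d -> d <= x ->
  bump2 d x = bump2 d d + bump1 d d * (x - d).
Proof.
intros Hd Hx. unfold bump2 at 1.
rewrite (RInt_Chasles_cont _ _ d) by apply bump1_continuous.
f_equal. rewrite (RInt_ext _ (fun _ => bump1 d d)).
- rewrite RInt_const. unfold scal; simpl; unfold mult; simpl. ring.
- rewrite Rmin_left, Rmax_right by lra. intros y Hy. apply bump1_right; lra.
Qed.

Lemma smooth_shift f a : smooth f -> smooth (fun x => f (x - a)).
Proof.
intros H n x.
apply (ex_derive_n_ext (fun y => f (y + - a))); [intros; f_equal; ring|].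
apply ex_derive_n_comp_trans, H.
Qed.

Lemma smooth_plus f g : smooth f -> smooth g -> smooth (fun x => f x + g x).
Proof.
intros Hf Hg n x. apply ex_derive_n_plus; apply filter_forall; intros; auto.
Qed.

Lemma smooth_scal c f : smooth f -> smooth (fun x => c * f x).
Proof. intros Hf n x. apply ex_derive_n_scal_l, Hf. Qed.

Lemma smooth_is_derive f x : smooth f -> is_derive f x (Derive f x).
Proof. intros H. apply Derive_correct. exact (H 1%nat x). Qed.

Lemma smooth_Derive f : smooth f -> smooth (Derive f).
Proof.
intros H n x. destruct n as [|n]; [exact I|].
change (ex_derive (Derive_n (Derive f) n) x).
apply (ex_derive_ext (Derive_n f (S n))).
- intros y. apply Derive_n_shift. intros z; now apply smooth_is_derive.
- exact (H (S (S n)) x).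
Qed.

(** Second difference of a double primitive of a bump: the affine tails cancel,
    so it has compact support, and its second derivative is the second
    difference of the bump itself. *)
Definition second_difference (f : R -> R) (b h x : R) : R :=
  f (x - (b - h)) - 2 * f (x - b) + f (x - (b + h)).

Lemma second_difference_test d b h :
  0 < d -> 0 < h -> 0 < b - h - d -> b + h + d < PI ->
  test_function (second_difference (bump2 d) b h).
Proof.
intros Hd Hh Ha Hb. split.
- assert (H : smooth (fun x => (bump2 d (x - (b - h)) + (-2) * bump2 d (x - b)) +
                bump2 d (x - (b + h)))).
  { assert (H := fun a => smooth_shift (bump2 d) a (bump2_smooth d)).
    exact (smooth_plus _ _ (smooth_plus _ _ (H _) (smooth_scal (-2) _ (H _))) (H _)). }
  intros n x. eapply ex_derive_n_ext; [|exact (H n x)].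
  intros t; unfold second_difference; ring.
- exists (b - h - d), (b + h + d). split; [exact Ha | split; [exact Hb|]].
  intros x Hx. apply Classical_Prop.NNPP; intros Hout. apply Hx.
  unfold second_difference.
  destruct (Rlt_le_dec x (b - h - d)) as [Hl | Hl].
  + rewrite !bump2_left by lra; ring.
  +
    rewrite (bump2_right d (x - (b - h))), (bump2_right d (x - b)),
      (bump2_right d (x - (b + h))) by lra. ring.
Qed.

Lemma second_difference_Derive2 d b h x :
  Derive_n (second_difference (bump2 d) b h) 2 x =
  second_difference (bump d) b h x.
Proof.
assert (Hs : forall f g, (forall x, is_derive f x (g x)) ->
  forall x, is_derive (second_difference f b h) x (second_difference g b h x)).
{ intros f g Hf y.
  assert (Hc : forall a, is_derive (fun z => f (z - a)) y (g (y - a))).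
  { intros a. eapply is_derive_cast.
    - apply (is_derive_comp f (fun z => z - a)); [apply Hf|].
      instantiate (1 := 1). auto_derive; [easy | ring].
    - unfold scal; simpl; unfold mult; simpl; ring. }
  unfold second_difference. apply is_derive_Rplus; [apply is_derive_Rminus|]; auto.
  now apply is_derive_Rscal. }
rewrite (Derive_n_shift _ (second_difference (bump1 d) b h)) by
  (apply Hs, bump2_derive).
simpl. apply is_derive_unique. apply Hs, bump1_derive.
Qed.

Lemma continuous_Rmult (f g : R -> R) x :
  continuous f x -> continuous g x -> continuous (fun y => f y * g y) x.
Proof. exact (continuous_mult (K := R_AbsRing) f g x). Qed.

Lemma continuous_Rplus (f g : R -> R) x :
  continuous f x -> continuous g x -> continuous (fun y => f y + g y) x.
Proof. exact (continuous_plus (V := R_NormedModule) f g x). Qed.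

Lemma continuous_Rminus (f g : R -> R) x :
  continuous f x -> continuous g x -> continuous (fun y => f y - g y) x.
Proof. exact (continuous_minus (V := R_NormedModule) f g x). Qed.

Lemma continuous_shift (f : R -> R) a x :
  (forall x, continuous f x) -> continuous (fun y => f (y + a)) x.
Proof.
intros H. apply (continuous_comp (fun y => y + a) f); [|apply H].
apply continuous_Rplus; [apply continuous_id | apply continuous_const].
Qed.

Lemma RInt_bump_shift (w : R -> R) d a :
  (forall x, continuous w x) -> 0 < d -> 0 < a - d -> a + d < PI ->
  RInt (fun x => w x * bump d (x - a)) 0 PI =
  RInt (fun y => w (y + a) * bump d y) (- d) d.
Proof.
intros Hw Hd Ha Hb.
set (f := fun x => w x * bump d (x - a)).
assert (Hf : forall x, continuous f x).
{ intros x. apply continuous_Rmult; [apply Hw|].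
  apply (continuous_shift (bump d) (- a)), bump_continuous. }
rewrite (RInt_Chasles_cont f 0 (a - d) PI Hf).
rewrite (RInt_Chasles_cont f (a - d) (a + d) PI Hf).
assert (Hz : forall x y, x <= y -> (y <= a - d \/ a + d <= x) -> RInt f x y = 0).
{ intros x y Hxy Hxy'. apply RInt_zero. rewrite Rmin_left, Rmax_right by lra.
  intros z Hz. unfold f. rewrite bump_out; [ring|].
  unfold Rabs; destruct Rcase_abs; lra. }
rewrite (Hz 0 (a - d)), (Hz (a + d) PI) by lra.
rewrite Rplus_0_l, Rplus_0_r.
replace (a - d) with (1 * (- d) + a) by ring.
replace (a + d) with (1 * d + a) by ring.
rewrite <- (RInt_comp_lin (V := R_CompleteNormedModule) f 1 a (- d) d)
  by (now apply ex_RInt_cont).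
apply RInt_ext_R. intros y _. unfold f, scal; simpl; unfold mult; simpl.
rewrite Rmult_1_l. replace (1 * y + a - a) with y by ring.
now replace (1 * y + a) with (y + a) by ring.
Qed.

(** Tested against second differences of ever narrower bumps, the equation
    concentrates at the three points b - h, b and b + h. *)
Lemma midpoint_affine (w : R -> R) (b h : R) :
  (forall x, continuous w x) ->
  (forall eta, test_function eta -> RInt (fun x => w x * Derive_n eta 2 x) 0 PI = 0) ->
  0 < h -> 0 < b - h -> b + h < PI ->
  w (b - h) + w (b + h) = 2 * w b.
Proof.
intros Hw Hweak Hh Ha Hb.
set (D := fun y => w (y + (b - h)) - 2 * w (y + b) + w (y + (b + h))).
assert (HD : forall y, continuous D y).
{ intros y. unfold D. apply continuous_Rplus; [apply continuous_Rminus|];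
    try (now apply continuous_shift).
  apply continuous_Rmult; [apply continuous_const | now apply continuous_shift]. }
assert (Hint : forall d, 0 < d -> 0 < b - h - d -> b + h + d < PI ->
  RInt (fun y => D y * bump d y) (- d) d = 0).
{ intros d Hd Hd1 Hd2.
  assert (Hc : forall a x, continuous (fun y => w (y + a) * bump d y) x).
  { intros a x. apply continuous_Rmult; [now apply continuous_shift | apply bump_continuous]. }
  assert (Hc' : forall a x, continuous (fun x => w x * bump d (x - a)) x).
  { intros a x. apply continuous_Rmult; [apply Hw|].
    apply (continuous_shift (bump d) (- a)), bump_continuous. }
  assert (H := Hweak _ (second_difference_test d b h Hd Hh Hd1 Hd2)).
  rewrite (RInt_ext_R _ (fun x => (w x * bump d (x - (b - h)) +
      (-2) * (w x * bump d (x - b))) + w x * bump d (x - (b + h)))) in H.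
  2: { intros x _. rewrite second_difference_Derive2. unfold second_difference; ring. }
  rewrite (RInt_ext_R _ (fun y => (w (y + (b - h)) * bump d y +
      (-2) * (w (y + b) * bump d y)) + w (y + (b + h)) * bump d y)).
  2: { intros y _. unfold D; ring. }
  assert (Hlin : forall f g k a b, (forall x, continuous f x) -> (forall x, continuous g x) ->
    (forall x, continuous k x) ->
    RInt (fun x => (f x + (-2) * g x) + k x) a b =
    RInt f a b + (-2) * RInt g a b + RInt k a b).
  { intros f g k p q Hf Hg Hk.
    assert (Hg2 : forall x, continuous (fun x => -2 * g x) x) by
      (intros x; apply continuous_Rmult; [apply continuous_const | apply Hg]).
    rewrite (RInt_Rplus (fun x => f x + -2 * g x) k), (RInt_Rplus f (fun x => -2 * g x)),
      RInt_Rscal; auto. intros x. apply continuous_Rplus; auto. }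
  rewrite Hlin in H by auto. rewrite Hlin by auto.
  rewrite <- !RInt_bump_shift by (auto; lra). exact H. }
apply Classical_Prop.NNPP; intros Hne.
assert (HD0 : D 0 <> 0).
{ unfold D. rewrite !Rplus_0_l. lra. }
destruct (proj1 (filterlim_R_spec (locally 0) D (D 0)) (HD 0) (Rabs (D 0) / 2)) as [d0 Hd0].
{ assert (H := Rabs_pos_lt _ HD0). lra. }
set (d := Rmin (d0 / 2) (Rmin ((b - h) / 2) ((PI - (b + h)) / 2))).
assert (Hd : 0 < d /\ d < d0 /\ d < b - h /\ d < PI - (b + h)).
{ assert (H := cond_pos d0). unfold d, Rmin. repeat destruct Rle_dec; lra. }
specialize (Hint d ltac:(lra) ltac:(lra) ltac:(lra)).
assert (Hpos : 0 < RInt (fun y => D 0 * (D y * bump d y)) (- d) d).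
{ apply RInt_gt_0; [lra| |].
  - intros y Hy. rewrite <- Rmult_assoc. apply Rmult_lt_0_compat.
    + assert (H := Hd0 y). assert (Hy' : Rabs (y - 0) < d0) by
        (rewrite Rminus_0_r; apply Rabs_def1; lra).
      specialize (H Hy'). unfold Rabs in H.
      destruct (Rcase_abs (D 0)), (Rcase_abs (D y - D 0)); nra.
    + apply bump_pos. apply Rabs_def1; lra.
  - intros y _. apply continuous_Rmult; [apply continuous_const|].
    apply continuous_Rmult; [apply HD | apply bump_continuous]. }
rewrite (RInt_Rscal (fun y => D y * bump d y)) in Hpos.
- rewrite Hint in Hpos. lra.
- intros y. apply continuous_Rmult; [apply HD | apply bump_continuous].
Qed.

(** By the midpoint rule a positive maximum would be attained along a whole interval
    reaching to one of the endpoints, where w is zero. *)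
Lemma midpoint_nonpos (w : R -> R) :
  (forall x, continuous w x) -> w 0 = 0 -> w PI = 0 ->
  (forall b h, 0 < h -> 0 < b - h -> b + h < PI -> w (b - h) + w (b + h) = 2 * w b) ->
  forall x, 0 <= x <= PI -> w x <= 0.
Proof.
intros Hw H0 HPI Hmid x Hx.
destruct (continuity_ab_maj w 0 PI) as [M [HM HMx]]; [lra| |].
{ intros y _. apply continuity_pt_filterlim, Hw. }
apply Rle_trans with (w M); [now apply HM|].
apply Rnot_lt_le; intros Hpos.
assert (HM' : 0 < M < PI).
{ destruct HMx as [[H1 | <-] [H2 | ->]]; lra. }
set (h0 := Rmin M (PI - M)).
assert (Hh0 : 0 < h0 /\ h0 <= M /\ h0 <= PI - M).
{ unfold h0; split; [|split]; [apply Rmin_pos; lra | apply Rmin_l | apply Rmin_r]. }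
assert (Heq : forall h, 0 < h < h0 -> w (M - h) = w M /\ w (M + h) = w M).
{ intros h Hh. assert (H := Hmid M h ltac:(lra) ltac:(lra) ltac:(lra)).
  assert (H1 := HM (M - h) ltac:(lra)). assert (H2 := HM (M + h) ltac:(lra)). lra. }
assert (Hbd : forall p, (forall e, 0 < e -> exists y, Rabs (y - p) < e /\ w y = w M) -> w p <> 0).
{ intros p Hp Hp0.
  destruct (proj1 (filterlim_R_spec (locally p) w (w p)) (Hw p) (w M) Hpos) as [d Hd].
  destruct (Hp d (cond_pos d)) as [y [Hy1 Hy2]].
  specialize (Hd y Hy1). rewrite Hp0, Hy2, Rminus_0_r, Rabs_pos_eq in Hd; lra. }
assert (Hsmall : forall e, 0 < e -> exists h, 0 < h < h0 /\ h0 - h < e).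
{ intros e He. exists (h0 - Rmin (e / 2) (h0 / 2)).
  unfold Rmin; destruct Rle_dec; lra. }
destruct (Rle_dec M (PI - M)) as [Hle | Hle].
- apply (Hbd 0); [|exact H0]. intros e He. destruct (Hsmall e He) as [h [Hh1 Hh2]].
  exists (M - h). split; [|exact (proj1 (Heq h Hh1))].
  unfold h0 in *. rewrite Rmin_left in * by lra. apply Rabs_def1; lra.
- apply (Hbd PI); [|exact HPI]. intros e He. destruct (Hsmall e He) as [h [Hh1 Hh2]].
  exists (M + h). split; [|exact (proj2 (Heq h Hh1))].
  unfold h0 in *. rewrite Rmin_right in * by lra. apply Rabs_def1; lra.
Qed.

(** Test functions with compact support in the open interval see nothing of the
    endpoints. That w vanishes there replaces an approximation of the sine functions
    by test functions in fractional Sobolev norms. *)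
Lemma weakly_affine_zero (w : R -> R) :
  (forall x, continuous w x) -> w 0 = 0 -> w PI = 0 ->
  (forall eta, test_function eta -> RInt (fun x => w x * Derive_n eta 2 x) 0 PI = 0) ->
  forall x, 0 <= x <= PI -> w x = 0.
Proof.
intros Hw H0 HPI Hweak x Hx.
assert (Hmid := fun b h => midpoint_affine w b h Hw Hweak).
apply Rle_antisym.
- now apply midpoint_nonpos.
- assert (- w x <= 0); [|lra].
  apply (midpoint_nonpos (fun y => - w y)); auto; try lra.
  + intros y. exact (continuous_opp (V := R_NormedModule) w y (Hw y)).
  + intros b h Hh Ha Hb. specialize (Hmid b h Hh Ha Hb). lra.
Qed.

(** * Sine series *)

(** The mean value theorem for the power -(2 s - 1) makes the sum telescope. *)
Lemma ex_series_freq (s : R) :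
  1 / 2 < s -> ex_series (fun k => Rpower (freq k) (- (2 * s))).
Proof.
intros Hs. set (b := 2 * s - 1). assert (Hb : 0 < b) by (unfold b; lra).
set (g := fun x => Rpower x (- b)).
assert (Hg : forall x, 0 < x -> is_derive g x (- b * Rpower x (- b - 1))).
{ intros x Hx. apply is_derive_Reals. now apply derivable_pt_lim_power. }
assert (Hstep : forall k, b * Rpower (freq (S k)) (- (2 * s)) <= g (freq k) - g (freq (S k))).
{ intros k. assert (Hk := freq_ge1 k).
  assert (E : freq (S k) = freq k + 1) by (unfold freq; now rewrite (S_INR (S k))).
  destruct (MVT_R g (fun x => - b * Rpower x (- b - 1)) (freq k) (freq (S k)))
    as [x [Hx1 Hx2]].
  - rewrite E, Rmin_left, Rmax_right by lra. intros x Hx; apply Hg; lra.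
  - rewrite E, Rmin_left, Rmax_right in Hx1 by lra. rewrite E in *.
    assert (H : Rpower (freq k + 1) (- (2 * s)) <= Rpower x (- b - 1)).
    { replace (- b - 1) with (- (2 * s)) by (unfold b; ring).
      rewrite !Rpower_Ropp. apply Rinv_le_contravar; [apply exp_pos|].
      apply Rle_Rpower_l; lra. }
    nra. }
apply (ex_series_incr_1 (V := R_NormedModule)).
apply (ex_series_dominated _ (fun k => / b * (g (freq k) - g (freq (S k))))).
- intros k. rewrite Rabs_pos_eq by (left; apply exp_pos).
  apply (Rmult_le_reg_l b); [exact Hb|]. rewrite <- Rmult_assoc, Rinv_r, Rmult_1_l by lra.
  apply Hstep.
- apply ex_series_Rscal. exists (g (freq 0)).
  change (is_lim_seq (sum_n (fun k => g (freq k) - g (freq (S k)))) (g (freq 0))).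
  apply (is_lim_seq_ext (fun n => g (freq 0) - g (freq (S n)))).
  + intros n; induction n as [|n IH]; [now rewrite sum_n_O_R|].
    rewrite sum_n_S_R, <- IH. ring.
  + replace (Finite (g (freq 0))) with (Finite (g (freq 0) - 0)) by (f_equal; ring).
    apply is_lim_seq_minus'; [apply is_lim_seq_const|].
    apply is_lim_seq_spec. intros e.
    set (x0 := Rpower e (- / b)).
    destruct (archimed_cor1 (/ (x0 + 1))) as [N [HN1 HN2]].
    { apply Rinv_0_lt_compat. assert (H := exp_pos (- / b * ln e)). unfold x0, Rpower; lra. }
    exists N. intros n Hn.
    assert (Hx0 : 0 < x0) by apply exp_pos.
    assert (HNf : x0 < freq (S n)).
    { apply Rlt_trans with (INR N).
      - apply (Rlt_trans _ (x0 + 1)); [lra|]. apply Rinv_lt_cancel; [|exact HN1].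
        apply lt_0_INR; lia.
      - unfold freq. apply lt_INR. lia. }
    rewrite Rminus_0_r. unfold g.
    rewrite Rabs_pos_eq by (left; apply exp_pos).
    replace (pos e) with (Rpower x0 (- b)).
    * rewrite !Rpower_Ropp. apply Rinv_lt_contravar.
      -- apply Rmult_lt_0_compat; apply exp_pos.
      -- apply Rlt_Rpower_l; lra.
    * unfold x0. rewrite Rpower_mult.
      replace (- / b * - b) with 1 by (field; lra). apply Rpower_1, cond_pos.
Qed.

Lemma Rpower_freq_pos k r : 0 < Rpower (freq k) r.
Proof. apply exp_pos. Qed.

Lemma Rpower_freq_nat k n : Rpower (freq k) (INR n) = freq k ^ n.
Proof. apply Rpower_pow. assert (H := freq_ge1 k). lra. Qed.

Lemma in_H_weaken r r' c : r' <= r -> in_H r c -> in_H r' c.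
Proof.
intros Hr. apply ex_series_dominated. intros k.
rewrite Rabs_pos_eq by (apply Rmult_le_pos; [apply pow2_ge_0 | left; apply Rpower_freq_pos]).
apply Rmult_le_compat_l; [apply pow2_ge_0|].
apply Rle_Rpower; [apply freq_ge1 | lra].
Qed.

(** Young's inequality for the product of |c_k| j^r and j^(p - r). *)
Lemma in_H_summable r p c :
  1 / 2 < r - p -> in_H r c -> ex_series (fun k => Rabs (c k) * Rpower (freq k) p).
Proof.
intros Hr Hc.
apply (ex_series_dominated _ (fun k => / 2 * (c k ^ 2 * Rpower (freq k) (2 * r) +
  Rpower (freq k) (- (2 * (r - p)))))).
- intros k. assert (Hp := Rpower_freq_pos k p).
  assert (H0 := Rabs_pos (c k)). rewrite Rabs_pos_eq by nra.
  set (y := Rabs (c k) * Rpower (freq k) r).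
  set (z := Rpower (freq k) (- (r - p))).
  replace (c k ^ 2 * Rpower (freq k) (2 * r)) with (y ^ 2).
  2: { unfold y. rewrite Rpow_mult_distr, <- Rsqr_pow2, <- Rsqr_abs, Rsqr_pow2.
       f_equal. rewrite <- Rsqr_pow2. unfold Rsqr. rewrite <- Rpower_plus. f_equal; ring. }
  replace (Rpower (freq k) (- (2 * (r - p)))) with (z ^ 2).
  2: { unfold z. rewrite <- Rsqr_pow2. unfold Rsqr. rewrite <- Rpower_plus. f_equal; ring. }
  replace (Rabs (c k) * Rpower (freq k) p) with (y * z).
  2: { unfold y, z. rewrite Rmult_assoc, <- Rpower_plus. do 2 f_equal; ring. }
  assert (H := Rle_0_sqr (y - z)). unfold Rsqr in H. nra.
- apply ex_series_Rscal, ex_series_Rplus; [exact Hc | now apply ex_series_freq].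
Qed.

Lemma in_H_summable_pow r n c :
  1 / 2 < r - INR n -> in_H r c -> ex_series (fun k => Rabs (c k) * freq k ^ n).
Proof.
intros Hr Hc. apply (ex_series_ext_R (fun k => Rabs (c k) * Rpower (freq k) (INR n))).
- intros k. now rewrite Rpower_freq_nat.
- now apply in_H_summable with r.
Qed.

Lemma freq_pow_ge1 k n : 1 <= freq k ^ n.
Proof. apply pow_R1_Rle, freq_ge1. Qed.

Definition nrm : R := sqrt (2 / PI).

Lemma nrm_bounds : 0 < nrm <= 1.
Proof.
assert (H := PI2_3_2). unfold nrm. split.
- apply sqrt_lt_R0. apply Rdiv_lt_0_compat; lra.
- rewrite <- sqrt_1. apply sqrt_le_1_alt. apply (proj2 (Rle_div_l 2 1 PI ltac:(lra))). lra.
Qed.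

Lemma nrm_sqr : nrm * nrm * (PI / 2) = 1.
Proof.
assert (H := PI_RGT_0). unfold nrm. rewrite sqrt_sqrt.
- field; lra.
- apply Rlt_le, Rdiv_lt_0_compat; lra.
Qed.

Definition psi (k : nat) (x : R) : R := nrm * cos (freq k * x).

Lemma phi_le k x : Rabs (phi k x) <= 1.
Proof.
assert (H := nrm_bounds). assert (H1 := SIN_bound (freq k * x)).
unfold phi. fold nrm. rewrite Rabs_mult, (Rabs_pos_eq nrm) by lra.
assert (Rabs (sin (freq k * x)) <= 1) by (apply Rabs_le; lra).
nra.
Qed.

Lemma psi_le k x : Rabs (psi k x) <= 1.
Proof.
assert (H := nrm_bounds). assert (H1 := COS_bound (freq k * x)).
unfold psi. rewrite Rabs_mult, (Rabs_pos_eq nrm) by lra.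
assert (Rabs (cos (freq k * x)) <= 1) by (apply Rabs_le; lra).
nra.
Qed.

Lemma phi_derive k x : is_derive (phi k) x (freq k * psi k x).
Proof. unfold phi, psi, nrm. auto_derive; [easy | ring]. Qed.

Lemma psi_derive k x : is_derive (psi k) x (- freq k * phi k x).
Proof. unfold phi, psi, nrm. auto_derive; [easy | ring]. Qed.

Lemma phi_continuous k x : continuous (phi k) x.
Proof. eapply is_derive_continuous, phi_derive. Qed.

Lemma psi_continuous k x : continuous (psi k) x.
Proof. eapply is_derive_continuous, psi_derive. Qed.

Lemma sin_nat_PI n : sin (INR n * PI) = 0.
Proof.
induction n as [|n IH]; [simpl; rewrite Rmult_0_l; apply sin_0|].
rewrite S_INR, Rmult_plus_distr_r, Rmult_1_l, neg_sin, IH. ring.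
Qed.

Lemma phi_0 k : phi k 0 = 0.
Proof. unfold phi. rewrite Rmult_0_r, sin_0. ring. Qed.

Lemma phi_PI k : phi k PI = 0.
Proof. unfold phi, freq. rewrite sin_nat_PI. ring. Qed.

Lemma term_le (c x y : R) : Rabs x <= 1 -> 0 <= y -> Rabs (c * y * x) <= Rabs c * y.
Proof.
intros Hx Hy. rewrite !Rabs_mult, (Rabs_pos_eq y) by lra.
assert (H := Rabs_pos c).
assert (0 <= Rabs c * y) by nra. nra.
Qed.

Definition sine_series (c : nat -> R) (x : R) : R := Series (fun k => c k * phi k x).
Definition cosine_series (c : nat -> R) (x : R) : R := Series (fun k => c k * psi k x).

Lemma Rabs_mult_le1 c b : Rabs b <= 1 -> Rabs (c * b) <= Rabs c.
Proof.
intros H. rewrite Rabs_mult. assert (H0 := Rabs_pos c). nra.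
Qed.

Lemma summable_lower c n :
  ex_series (fun k => Rabs (c k) * freq k ^ S n) -> ex_series (fun k => Rabs (c k) * freq k ^ n).
Proof.
apply ex_series_dominated. intros k. assert (H := freq_ge1 k).
assert (H1 := freq_pow_ge1 k n). assert (H2 := Rabs_pos (c k)).
rewrite Rabs_pos_eq by nra. apply Rmult_le_compat_l; [exact H2|]. simpl. nra.
Qed.

Lemma summable_coef c :
  ex_series (fun k => Rabs (c k) * freq k ^ 0) -> ex_series (fun k => Rabs (c k)).
Proof. apply ex_series_ext_R. intros k. simpl; ring. Qed.

Lemma sine_series_derive c x :
  ex_series (fun k => Rabs (c k) * freq k ^ 1) ->
  is_derive (sine_series c) x (cosine_series (fun k => c k * freq k) x).
Proof.
intros Hc. assert (H0 := summable_coef c (summable_lower c 0 Hc)).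
apply (Series_derive (fun k y => c k * phi k y) (fun k y => c k * freq k * psi k y)
  (fun k => Rabs (c k) * freq k ^ 1) x 1); [lra | exact Hc | | |].
- intros k s _. eapply is_derive_cast; [apply is_derive_Rscal, phi_derive | ring].
- intros k s _. rewrite pow_1. apply term_le; [apply psi_le|].
  assert (H := freq_ge1 k). lra.
- intros s _. eapply ex_series_dominated; [|exact H0].
  intros k. apply Rabs_mult_le1, phi_le.
Qed.

Lemma cosine_series_derive c x :
  ex_series (fun k => Rabs (c k) * freq k ^ 1) ->
  is_derive (cosine_series c) x (sine_series (fun k => - (c k * freq k)) x).
Proof.
intros Hc. assert (H0 := summable_coef c (summable_lower c 0 Hc)).
apply (Series_derive (fun k y => c k * psi k y) (fun k y => - (c k * freq k) * phi k y)
  (fun k => Rabs (c k) * freq k ^ 1) x 1); [lra | exact Hc | | |].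
- intros k s _. eapply is_derive_cast; [apply is_derive_Rscal, psi_derive | ring].
- intros k s _. rewrite pow_1, Ropp_mult_distr_l_reverse, Rabs_Ropp.
  apply term_le; [apply phi_le|]. assert (H := freq_ge1 k). lra.
- intros s _. eapply ex_series_dominated; [|exact H0].
  intros k. apply Rabs_mult_le1, psi_le.
Qed.

Lemma sine_series_continuous c x :
  ex_series (fun k => Rabs (c k)) -> continuous (sine_series c) x.
Proof.
intros Hc. apply (Series_continuous (fun k y => c k * phi k y) (fun k => Rabs (c k)) x 1);
  [lra | exact Hc | |].
- intros k. apply continuous_Rmult; [apply continuous_const | apply phi_continuous].
- intros k s _. apply Rabs_mult_le1, phi_le.
Qed.

Lemma cosine_series_continuous c x :
  ex_series (fun k => Rabs (c k)) -> continuous (cosine_series c) x.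
Proof.
intros Hc. apply (Series_continuous (fun k y => c k * psi k y) (fun k => Rabs (c k)) x 1);
  [lra | exact Hc | |].
- intros k. apply continuous_Rmult; [apply continuous_const | apply psi_continuous].
- intros k s _. apply Rabs_mult_le1, psi_le.
Qed.

Lemma sine_series_0 c : sine_series c 0 = 0.
Proof. apply Series_zero. intros k; rewrite phi_0; ring. Qed.

Lemma sine_series_PI c : sine_series c PI = 0.
Proof. apply Series_zero. intros k; rewrite phi_PI; ring. Qed.

Lemma fun_of_Derive c x :
  ex_series (fun k => Rabs (c k) * freq k ^ 1) ->
  Derive (fun_of c) x = cosine_series (fun k => c k * freq k) x.
Proof. intros Hc. apply is_derive_unique. now apply sine_series_derive. Qed.

Lemma fun_of_Derive2 c x :
  ex_series (fun k => Rabs (c k) * freq k ^ 2) ->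
  Derive_n (fun_of c) 2 x = sine_series (fun k => - (c k * freq k ^ 2)) x.
Proof.
intros Hc. assert (Hc1 := summable_lower c 1 Hc).
change (Derive_n (fun_of c) 2 x) with (Derive (Derive (fun_of c)) x).
rewrite (Derive_ext _ (cosine_series (fun k => c k * freq k))) by
  (intros; now apply fun_of_Derive).
replace (sine_series (fun k => - (c k * freq k ^ 2)) x) with
  (sine_series (fun k => - (c k * freq k * freq k)) x).
- apply is_derive_unique, cosine_series_derive.
  eapply ex_series_ext_R; [|exact Hc]. intros k. assert (H := freq_ge1 k).
  simpl. rewrite Rabs_mult, (Rabs_pos_eq (freq k)) by lra. ring.
- apply Series_ext. intros k. simpl; ring.
Qed.

Lemma RInt_FTC (G g : R -> R) (a b : R) :
  (forall x, is_derive G x (g x)) -> (forall x, continuous g x) ->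
  RInt g a b = G b - G a :> R.
Proof.
intros HG Hg. apply is_RInt_unique.
exact (is_RInt_derive (V := R_CompleteNormedModule) G g a b
  (fun x _ => HG x) (fun x _ => Hg x)).
Qed.

Lemma RInt_by_parts (f g df dg : R -> R) (a b : R) :
  (forall x, is_derive f x (df x)) -> (forall x, is_derive g x (dg x)) ->
  (forall x, continuous df x) -> (forall x, continuous dg x) ->
  f a * g a = 0 -> f b * g b = 0 ->
  RInt (fun x => df x * g x) a b = - RInt (fun x => f x * dg x) a b :> R.
Proof.
intros Hf Hg Hdf Hdg Ha Hb.
assert (Cf : forall x, continuous f x).
{ intros x. eapply is_derive_continuous, Hf. }
assert (Cg : forall x, continuous g x).
{ intros x. eapply is_derive_continuous, Hg. }
assert (C1 : forall x, continuous (fun x => df x * g x) x) by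
  (intros x; now apply continuous_Rmult).
assert (C2 : forall x, continuous (fun x => f x * dg x) x) by
  (intros x; now apply continuous_Rmult).
assert (H : RInt (fun x => df x * g x + f x * dg x) a b = f b * g b - f a * g a).
{ apply (RInt_FTC (fun x => f x * g x)).
  - intros x. now apply is_derive_Rmult.
  - intros x. now apply continuous_Rplus. }
rewrite RInt_Rplus in H by auto. lra.
Qed.

Lemma freq_inj k l : freq k = freq l -> k = l.
Proof. unfold freq. intros H. apply INR_eq in H. lia. Qed.

Lemma sin_sum_freq k l : sin ((freq k + freq l) * PI) = 0.
Proof. unfold freq. rewrite <- plus_INR. apply sin_nat_PI. Qed.

Lemma sin_diff_freq k l : sin ((freq k - freq l) * PI) = 0.
Proof.
unfold freq. rewrite Rmult_minus_distr_r, sin_minus, !sin_nat_PI. ring.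
Qed.

Lemma cos_integral (c : R) :
  c <> 0 -> sin (c * PI) = 0 -> RInt (fun x => cos (c * x)) 0 PI = 0 :> R.
Proof.
intros Hc Hs. rewrite (RInt_FTC (fun x => sin (c * x) / c)).
- rewrite Hs, Rmult_0_r, sin_0. unfold Rdiv; ring.
- intros x. auto_derive; [easy | field; exact Hc].
- intros x. apply (ex_derive_continuous (V := R_NormedModule)). auto_derive; easy.
Qed.

(** Both families follow from the product formulas, which differ by a sign. *)
Lemma trigonometric_orthogonal (sg : R) (e : nat -> R -> R) k l :
  (forall x, e k x * e l x = nrm * nrm / 2 *
     (cos ((freq k - freq l) * x) + sg * cos ((freq k + freq l) * x))) ->
  RInt (fun x => e k x * e l x) 0 PI = (if Nat.eq_dec k l then 1 else 0) :> R.
Proof.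
intros He. assert (Hk := freq_ge1 k). assert (Hl := freq_ge1 l).
assert (C : forall c x, continuous (fun x => cos (c * x)) x).
{ intros c x. apply (ex_derive_continuous (V := R_NormedModule)). auto_derive; easy. }
assert (C' : forall c x, continuous (fun x => sg * cos (c * x)) x) by
  (intros; apply continuous_Rmult; [apply continuous_const | apply C]).
rewrite (RInt_ext_R _ _ _ _ (fun x _ => He x)).
rewrite RInt_Rscal, RInt_Rplus, RInt_Rscal; auto.
2: intros; now apply continuous_Rplus.
rewrite (cos_integral (freq k + freq l)) by (apply sin_sum_freq || lra).
destruct (Nat.eq_dec k l) as [-> | Hne].
- rewrite (RInt_ext_R _ (fun _ => 1)).
  + rewrite RInt_const. unfold scal; simpl; unfold mult; simpl.
    transitivity (nrm * nrm * (PI / 2)); [field | apply nrm_sqr].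
  + intros x _. rewrite Rminus_eq_0, Rmult_0_l. apply cos_0.
- rewrite cos_integral; [ring | | apply sin_diff_freq].
  intros E. apply Hne, freq_inj. lra.
Qed.

Lemma phi_orthogonal k l :
  RInt (fun x => phi k x * phi l x) 0 PI = (if Nat.eq_dec k l then 1 else 0) :> R.
Proof.
apply (trigonometric_orthogonal (-1)). intros x. unfold phi; fold nrm.
rewrite Rmult_minus_distr_r, Rmult_plus_distr_r, cos_minus, cos_plus. field.
Qed.

Lemma psi_orthogonal k l :
  RInt (fun x => psi k x * psi l x) 0 PI = (if Nat.eq_dec k l then 1 else 0) :> R.
Proof.
apply (trigonometric_orthogonal 1). intros x. unfold psi.
rewrite Rmult_minus_distr_r, Rmult_plus_distr_r, cos_minus, cos_plus. field.
Qed.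

Lemma Series_single (f : nat -> R) (k : nat) :
  (forall l, l <> k -> f l = 0) -> Series f = f k.
Proof.
intros H.
assert (Hs : forall n, (k <= n)%nat -> sum_n f n = f k :> R).
{ assert (H0 : forall n, (n < k)%nat -> sum_n f n = 0 :> R).
  { intros n; induction n as [|n IH]; intros Hn.
    - rewrite sum_n_O_R; apply H; lia.
    - rewrite sum_n_S_R, IH, H by lia. ring. }
  intros n Hn; induction Hn as [|n Hn IH].
  - destruct k as [|k]; [apply sum_n_O_R|]. rewrite sum_n_S_R, H0 by lia. ring.
  - rewrite sum_n_S_R, IH, (H (S n)) by lia. ring. }
apply is_series_unique.
change (is_lim_seq (sum_n f) (f k)).
apply (is_lim_seq_ext_loc (fun _ => f k)); [|apply is_lim_seq_const].
exists k. intros n Hn. now rewrite Hs.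
Qed.

(** Absolute convergence allows integration term by term, and orthonormality leaves
    one term. *)
Lemma expansion_coefficient (e : nat -> R -> R) (c : nat -> R) (k : nat) :
  (forall k x, continuous (e k) x) -> (forall k x, Rabs (e k x) <= 1) ->
  (forall k l, RInt (fun x => e k x * e l x) 0 PI = if Nat.eq_dec k l then 1 else 0) ->
  ex_series (fun k => Rabs (c k)) ->
  RInt (fun x => e k x * Series (fun l => c l * e l x)) 0 PI = c k :> R.
Proof.
intros He Hb Ho Hc.
assert (Cc : forall l x, continuous (fun x => c l * e l x) x) by
  (intros l x; apply continuous_Rmult; [apply continuous_const | apply He]).
rewrite (RInt_ext_R _ (fun x => Series (fun l => e k x * (c l * e l x)))) by
  (intros x _; now rewrite Series_scal_l).
rewrite (RInt_Series (fun l x => e k x * (c l * e l x)) (fun l => Rabs (c l))).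
- rewrite (Series_single _ k).
  + rewrite (RInt_ext_R _ (fun x => c k * (e k x * e k x))) by (intros; ring).
    rewrite RInt_Rscal, Ho; [|intros; now apply continuous_Rmult].
    destruct Nat.eq_dec; [ring | easy].
  + intros l Hl. rewrite (RInt_ext_R _ (fun x => c l * (e k x * e l x))) by (intros; ring).
    rewrite RInt_Rscal, Ho; [|intros; now apply continuous_Rmult].
    destruct Nat.eq_dec; [congruence | ring].
- exact Hc.
- intros l x. now apply continuous_Rmult.
- intros l x. rewrite Rmult_comm. eapply Rle_trans; [now apply Rabs_mult_le1|].
  now apply Rabs_mult_le1.
Qed.

Lemma parseval_cosine c :
  ex_series (fun k => Rabs (c k)) ->
  RInt (fun x => cosine_series c x ^ 2) 0 PI = Series (fun k => c k ^ 2) :> R.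
Proof.
intros Hc.
assert (Cs : forall x, continuous (cosine_series c) x) by
  (intros; now apply cosine_series_continuous).
assert (Hb : forall x, Rabs (cosine_series c x) <= Series (fun k => Rabs (c k))).
{ intros x. apply Series_dominated_le; [|exact Hc]. intros k. apply Rabs_mult_le1, psi_le. }
rewrite (RInt_ext_R _ (fun x => Series (fun k => cosine_series c x * (c k * psi k x)))).
2: { intros x _. rewrite Series_scal_l. unfold cosine_series. simpl; ring. }
rewrite (RInt_Series (fun k x => cosine_series c x * (c k * psi k x))
  (fun k => Series (fun k => Rabs (c k)) * Rabs (c k))).
- apply Series_ext. intros k.
  rewrite (RInt_ext_R _ (fun x => c k * (psi k x * cosine_series c x))) by (intros; ring).
  rewrite RInt_Rscal.
  + unfold cosine_series. rewrite (expansion_coefficient psi); auto using psi_continuous, psi_le, psi_orthogonal.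
    simpl; ring.
  + intros x. apply continuous_Rmult; [apply psi_continuous | apply Cs].
- now apply ex_series_Rscal.
- intros k x. apply continuous_Rmult; [apply Cs|].
  apply continuous_Rmult; [apply continuous_const | apply psi_continuous].
- intros k x. rewrite Rabs_mult. apply Rmult_le_compat; auto using Rabs_pos.
  apply Rabs_mult_le1, psi_le.
Qed.

Lemma tension_eq m c :
  ex_series (fun k => Rabs (c k) * freq k ^ 1) ->
  tension m (fun_of c) = m + coupling * Series (fun k => (freq k * c k) ^ 2).
Proof.
intros Hc. unfold tension, coupling.
rewrite (RInt_ext_R _ (fun x => cosine_series (fun k => c k * freq k) x ^ 2)) by
  (intros x _; now rewrite fun_of_Derive).
rewrite parseval_cosine.
- assert (H := PI_RGT_0).
  replace (1 / (2 * PI)) with (/ (2 * PI)) by (field; lra).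
  do 2 f_equal. apply Series_ext; intros k; ring.
- eapply ex_series_ext_R; [|exact Hc]. intros k; cbv beta. assert (H := freq_ge1 k).
  rewrite pow_1, Rabs_mult, (Rabs_pos_eq (freq k)); lra.
Qed.

Lemma Series_combine (a c q J : nat -> R) (tau : R) :
  ex_series (fun k => a k * J k) -> ex_series (fun k => - (c k * q k) * J k) ->
  ex_series (fun k => c k * J k) ->
  - Series (fun k => a k * J k) +
    (Series (fun k => - (c k * q k) * J k) + tau * - Series (fun k => c k * J k)) =
  - Series (fun k => (a k + (q k + tau) * c k) * J k).
Proof.
intros E1 E2 E3.
rewrite (Series_ext (fun k => (a k + (q k + tau) * c k) * J k)
  (fun k => a k * J k + (-1 * (- (c k * q k) * J k) + tau * (c k * J k)))) by (intros; ring).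
rewrite (Series_plus (fun k => a k * J k)), (Series_plus (fun k => -1 * _)).
- rewrite !Series_scal_l. ring.
- now apply ex_series_Rscal.
- now apply ex_series_Rscal.
- exact E1.
- apply ex_series_Rplus; now apply ex_series_Rscal.
Qed.

Section TestFunctions.
Variable eta : R -> R.
Hypothesis Heta : test_function eta.

Let eta_smooth : smooth eta := proj1 Heta.

Lemma test_derive x : is_derive eta x (Derive eta x).
Proof. apply smooth_is_derive, eta_smooth. Qed.

Lemma test_derive2 x : is_derive (Derive eta) x (Derive_n eta 2 x).
Proof. apply (smooth_is_derive (Derive eta)), smooth_Derive, eta_smooth. Qed.

Lemma test_continuous n x : continuous (Derive_n eta n) x.
Proof.
apply (ex_derive_continuous (V := R_NormedModule)). exact (eta_smooth (S n) x).
Qed.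

(** Outside the support the test function is locally zero. *)
Lemma test_support :
  exists a b, 0 < a /\ b < PI /\
    forall n x, x < a \/ b < x -> Derive_n eta n x = 0.
Proof.
pose proof Heta as [_ [a [b [Ha [Hb H]]]]]. exists a, b. split; [exact Ha|split; [exact Hb|]].
assert (H0 : forall x, x < a \/ b < x -> eta x = 0).
{ intros x Hx. apply Classical_Prop.NNPP; intros Hne. apply H in Hne. lra. }
intros n x Hx.
rewrite (Derive_n_ext_loc eta (fun _ => 0)).
- destruct n as [|n]; [reflexivity | apply Derive_n_const].
- destruct Hx as [Hx | Hx].
  + exists (mkposreal (a - x) ltac:(lra)). intros y Hy. apply Rabs_def2 in Hy.
    change (y - x < a - x /\ - (a - x) < y - x) in Hy. apply H0; lra.
  + exists (mkposreal (x - b) ltac:(lra)). intros y Hy. apply Rabs_def2 in Hy.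
    change (y - x < x - b /\ - (x - b) < y - x) in Hy. apply H0; lra.
Qed.

Lemma test_ends n : Derive_n eta n 0 = 0 /\ Derive_n eta n PI = 0.
Proof.
destruct test_support as [a [b [Ha [Hb H]]]]. split; apply H; lra.
Qed.

Lemma test_bounded n : exists M, 0 <= M /\ forall x, Rabs (Derive_n eta n x) <= M.
Proof.
destruct test_support as [a [b [Ha [Hb H]]]].
destruct (continuity_ab_maj (fun x => Rabs (Derive_n eta n x)) 0 PI) as [p [Hp _]].
- assert (HP := PI_RGT_0); lra.
- intros x _. apply continuity_pt_filterlim.
  apply (continuous_comp (Derive_n eta n) Rabs); [apply test_continuous|].
  apply continuous_Rabs.
- exists (Rabs (Derive_n eta n p)). split; [apply Rabs_pos|]. intros x.
  destruct (Rlt_le_dec x 0) as [H1 | H1]; [|destruct (Rlt_le_dec PI x) as [H2 | H2]].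
  + rewrite H by lra. rewrite Rabs_R0; apply Rabs_pos.
  + rewrite H by lra. rewrite Rabs_R0; apply Rabs_pos.
  + now apply Hp.
Qed.

Lemma phi_test k :
  RInt (fun x => phi k x * eta x) 0 PI =
  - (/ freq k ^ 2 * RInt (fun x => phi k x * Derive_n eta 2 x) 0 PI).
Proof.
assert (Hf := freq_ge1 k).
destruct (test_ends 0) as [E0 EP]. destruct (test_ends 1) as [E0' EP'].
simpl Derive_n in E0, EP. change (Derive_n eta 1) with (Derive eta) in E0', EP'.
assert (Cphi : forall x, continuous (fun x => freq k * psi k x) x) by
  (intros x; apply continuous_Rmult; [apply continuous_const | apply psi_continuous]).
assert (Cpsi : forall x, continuous (fun x => - freq k * phi k x) x) by
  (intros x; apply continuous_Rmult; [apply continuous_const | apply phi_continuous]).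
assert (H1 := RInt_by_parts (psi k) eta (fun x => - freq k * phi k x) (Derive eta) 0 PI
  (psi_derive k) test_derive Cpsi (test_continuous 1)).
rewrite E0, EP, !Rmult_0_r in H1. specialize (H1 eq_refl eq_refl).
assert (H2 := RInt_by_parts (phi k) (Derive eta) (fun x => freq k * psi k x)
  (Derive_n eta 2) 0 PI (phi_derive k) test_derive2 Cphi (test_continuous 2)).
rewrite phi_0, phi_PI, !Rmult_0_l in H2. specialize (H2 eq_refl eq_refl).
rewrite (RInt_ext_R _ (fun x => - freq k * (phi k x * eta x))), RInt_Rscal in H1.
- rewrite (RInt_ext_R _ (fun x => freq k * (psi k x * Derive eta x))), RInt_Rscal in H2.
  + apply (Rmult_eq_reg_l (- freq k * freq k)); [|nra].
    transitivity (freq k * (- freq k * RInt (fun x => phi k x * eta x) 0 PI)); [ring|].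
    rewrite H1. transitivity (- (freq k * RInt (fun x => psi k x * Derive eta x) 0 PI)); [ring|].
    rewrite H2. field; lra.
  + intros x. apply continuous_Rmult; [apply psi_continuous | apply (test_continuous 1)].
  + intros; ring.
- intros x. apply continuous_Rmult; [apply phi_continuous | apply (test_continuous 0)].
- intros; ring.
Qed.

(** The series converges uniformly, so it may be integrated term by term. *)
Lemma sine_series_test c :
  ex_series (fun k => Rabs (c k)) ->
  RInt (fun x => sine_series c x * Derive_n eta 2 x) 0 PI =
  Series (fun k => c k * RInt (fun x => phi k x * Derive_n eta 2 x) 0 PI).
Proof.
intros Hc. destruct (test_bounded 2) as [M [HM Hb]].
rewrite (RInt_ext_R _ (fun x => Series (fun k => c k * phi k x * Derive_n eta 2 x))) by
  (intros x _; now rewrite Series_scal_r).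
assert (C : forall k x, continuous (fun x => phi k x * Derive_n eta 2 x) x) by
  (intros k x; apply continuous_Rmult; [apply phi_continuous | apply test_continuous]).
rewrite (RInt_Series (fun k x => c k * phi k x * Derive_n eta 2 x) (fun k => M * Rabs (c k))).
- apply Series_ext. intros k.
  rewrite (RInt_ext_R _ (fun x => c k * (phi k x * Derive_n eta 2 x))) by (intros; ring).
  now rewrite RInt_Rscal.
- now apply ex_series_Rscal.
- intros k x. apply continuous_Rmult; [|apply test_continuous].
  apply continuous_Rmult; [apply continuous_const | apply phi_continuous].
- intros k x. rewrite Rabs_mult, Rmult_comm.
  apply Rmult_le_compat; auto using Rabs_pos. apply Rabs_mult_le1, phi_le.
Qed.

(** Integrating by parts moves all derivatives to the test function; the boundary terms
    vanish because the test function and the modes are zero at the ends. Since d may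
    grow like j^2, only the coefficients divided by j^2 define a function. *)
Lemma weak_identity (c d : nat -> R) (tau : R) :
  ex_series (fun k => Rabs (c k) * freq k ^ 2) ->
  ex_series (fun k => Rabs (d k / freq k ^ 2)) ->
  pairing d eta +
    RInt (fun x => Derive_n (fun_of c) 2 x * Derive_n eta 2 x +
                   tau * (Derive (fun_of c) x * Derive eta x)) 0 PI =
  - RInt (fun x => sine_series (fun k => d k / freq k ^ 2 + (freq k ^ 2 + tau) * c k) x *
                   Derive_n eta 2 x) 0 PI.
Proof.
intros Hc Hd.
assert (Hc1 := summable_lower c 1 Hc). assert (Hc0 := summable_coef c (summable_lower c 0 Hc1)).
assert (Hcf : ex_series (fun k => Rabs (- (c k * freq k ^ 2)))).
{ eapply ex_series_ext_R; [|exact Hc]. intros k; cbv beta. assert (H := freq_pow_ge1 k 2).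
  rewrite Rabs_Ropp, Rabs_mult, (Rabs_pos_eq (freq k ^ 2)); lra. }
assert (Hcg : ex_series (fun k => Rabs (c k * freq k))).
{ eapply ex_series_ext_R; [|exact Hc1]. intros k; cbv beta. assert (H := freq_ge1 k).
  rewrite pow_1, Rabs_mult, (Rabs_pos_eq (freq k)); lra. }
assert (Ceta := test_continuous 2).
assert (H1 : pairing d eta =
  - RInt (fun x => sine_series (fun k => d k / freq k ^ 2) x * Derive_n eta 2 x) 0 PI).
{ unfold pairing. rewrite sine_series_test by exact Hd.
  rewrite <- Series_opp. apply Series_ext. intros k. rewrite phi_test.
  assert (H := freq_ge1 k). field; lra. }
assert (H2 : RInt (fun x => Derive (fun_of c) x * Derive eta x) 0 PI =
  - RInt (fun x => sine_series c x * Derive_n eta 2 x) 0 PI).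
{ rewrite (RInt_ext_R _ (fun x => cosine_series (fun k => c k * freq k) x * Derive eta x)) by
    (intros x _; now rewrite fun_of_Derive).
  apply RInt_by_parts.
  - intros x. now apply sine_series_derive.
  - apply test_derive2.
  - intros x. now apply cosine_series_continuous.
  - exact Ceta.
  - rewrite sine_series_0; ring.
  - rewrite sine_series_PI; ring. }
rewrite (RInt_ext_R _ (fun x => sine_series (fun k => - (c k * freq k ^ 2)) x * Derive_n eta 2 x +
   tau * (Derive (fun_of c) x * Derive eta x))) by
  (intros x _; now rewrite fun_of_Derive2).
assert (CD : forall x, continuous (fun x => Derive (fun_of c) x * Derive eta x) x).
{ intros x. apply continuous_Rmult; [|apply (test_continuous 1)].
  apply (continuous_ext (cosine_series (fun k => c k * freq k))).
  - intros y; now rewrite fun_of_Derive.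
  - now apply cosine_series_continuous. }
assert (CS : forall b, ex_series (fun k => Rabs (b k)) ->
  forall x, continuous (fun x => sine_series b x * Derive_n eta 2 x) x).
{ intros b Hb x. apply continuous_Rmult; [now apply sine_series_continuous | apply Ceta]. }
rewrite RInt_Rplus, RInt_Rscal, H1, H2; auto.
2: { intros x. apply continuous_Rmult; [apply continuous_const | apply CD]. }
assert (Hall : ex_series (fun k => Rabs (d k / freq k ^ 2 + (freq k ^ 2 + tau) * c k))).
{ eapply ex_series_dominated;
    [|exact (ex_series_Rplus _ _ Hd (ex_series_Rplus _ _ Hc (ex_series_Rscal (Rabs tau) _ Hc0)))].
  intros k. cbv beta. rewrite Rabs_Rabsolu.
  eapply Rle_trans; [apply Rabs_triang|]. apply Rplus_le_compat_l.
  rewrite Rmult_plus_distr_r. eapply Rle_trans; [apply Rabs_triang|].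
  assert (H := freq_pow_ge1 k 2).
  rewrite !Rabs_mult, (Rabs_pos_eq (freq k ^ 2)) by lra. lra. }
rewrite !sine_series_test by auto.
assert (Hex : forall b, ex_series (fun k => Rabs (b k)) ->
  ex_series (fun k => b k * RInt (fun x => phi k x * Derive_n eta 2 x) 0 PI)).
{ intros b Hb. destruct (test_bounded 2) as [M [HM HMb]].
  apply (ex_series_dominated _ (fun k => PI * M * Rabs (b k))); [|now apply ex_series_Rscal].
  intros k. rewrite Rabs_mult, Rmult_comm. apply Rmult_le_compat_r; [apply Rabs_pos|].
  assert (HP := PI_RGT_0).
  replace (PI * M) with ((PI - 0) * M) by ring.
  apply abs_RInt_le_const; [lra | |].
  - apply ex_RInt_cont. intros x. apply continuous_Rmult; [apply phi_continuous | apply Ceta].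
  - intros x _. rewrite Rmult_comm. eapply Rle_trans; [apply Rabs_mult_le1, phi_le | apply HMb]. }
assert (E1 := Hex _ Hd). assert (E2 := Hex _ Hcf). assert (E3 := Hex _ Hc0).
exact (Series_combine (fun k => d k / freq k ^ 2) c (fun k => freq k ^ 2) _ tau E1 E2 E3).
Qed.
End TestFunctions.

(** * Modes of a weak solution *)

Lemma in_interval_open a b t : in_interval a b t ->
  exists d, 0 < d /\ forall s, Rabs (s - t) < d -> in_interval a b s.
Proof.
intros [Ha Hb].
assert (H1 : exists d, 0 < d /\ forall s, Rabs (s - t) < d -> Rbar_lt a s).
{ destruct a as [a| |]; simpl in *; [|easy|now exists 1; split; [lra|]].
  exists (t - a). split; [lra|]. intros s Hs. apply Rabs_def2 in Hs. lra. }
assert (H2 : exists d, 0 < d /\ forall s, Rabs (s - t) < d -> Rbar_lt s b).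
{ destruct b as [b| |]; simpl in *; [|now exists 1; split; [lra|] | easy].
  exists (b - t). split; [lra|]. intros s Hs. apply Rabs_def2 in Hs. lra. }
destruct H1 as [d1 [Hd1 H1]], H2 as [d2 [Hd2 H2]].
exists (Rmin d1 d2). split; [now apply Rmin_pos|]. intros s Hs. split.
- apply H1. eapply Rlt_le_trans; [exact Hs | apply Rmin_l].
- apply H2. eapply Rlt_le_trans; [exact Hs | apply Rmin_r].
Qed.

Lemma in_interval_seg a b t s :
  in_interval a b 0 -> in_interval a b t -> seg t s -> in_interval a b s.
Proof.
unfold in_interval, seg, Rmin, Rmax. intros H0 Ht Hs.
destruct (Rle_dec 0 t); destruct a as [a| |], b as [b| |]; simpl in *; lra.
Qed.

Lemma H_term_ge0 r c k : 0 <= c k ^ 2 * Rpower (freq k) (2 * r).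
Proof. apply Rmult_le_pos; [apply pow2_ge_0 | left; apply Rpower_freq_pos]. Qed.

Lemma in_H_scal r x c : in_H r c -> in_H r (fun k => x * c k).
Proof.
intros H. eapply ex_series_ext_R; [|exact (ex_series_Rscal (x ^ 2) _ H)].
intros k; cbv beta. ring.
Qed.

Lemma in_H_plus r c d : in_H r c -> in_H r d -> in_H r (fun k => c k + d k).
Proof.
intros Hc Hd.
eapply ex_series_dominated;
  [|exact (ex_series_Rplus _ _ (ex_series_Rscal 2 _ Hc) (ex_series_Rscal 2 _ Hd))].
intros k; cbv beta. rewrite Rabs_pos_eq by apply (H_term_ge0 r (fun k => c k + d k)).
assert (H := Rpower_freq_pos k (2 * r)).
assert (H1 := Rle_0_sqr (c k - d k)). unfold Rsqr in H1.
nra.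
Qed.

Lemma in_H_ext r c d : (forall k, c k = d k) -> in_H r c -> in_H r d.
Proof. intros H. apply ex_series_ext_R. intros k; now rewrite H. Qed.

Lemma in_H_minus r c d : in_H r c -> in_H r d -> in_H r (fun k => c k - d k).
Proof.
intros Hc Hd. apply (in_H_ext _ (fun k => c k + (-1) * d k)); [intros; ring|].
apply in_H_plus; [exact Hc | now apply in_H_scal].
Qed.

(** Norm convergence passes to single coefficients through this bound. It needs the
    series to converge: [Series] of a divergent series carries no information. *)
Lemma coef_le_H_norm r c k :
  in_H r c -> Rabs (c k) * Rpower (freq k) r <= H_norm r c.
Proof.
intros Hc. assert (Hp := Rpower_freq_pos k r).
rewrite <- (sqrt_Rsqr (Rabs (c k) * Rpower (freq k) r)) by
  (apply Rmult_le_pos; [apply Rabs_pos | lra]).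
apply sqrt_le_1_alt.
eapply Rle_trans; [|apply (term_le_Series _ k (H_term_ge0 r c) Hc)].
right. rewrite Rsqr_mult, <- Rsqr_abs, <- !Rsqr_pow2. f_equal.
unfold Rsqr. rewrite <- Rpower_plus. f_equal; ring.
Qed.

Lemma H_norm_sqr r c : in_H r c ->
  H_norm r c ^ 2 = Series (fun k => c k ^ 2 * Rpower (freq k) (2 * r)).
Proof.
intros Hc. unfold H_norm. rewrite <- Rsqr_pow2. apply Rsqr_sqrt.
apply Series_ge0; [apply H_term_ge0 | exact Hc].
Qed.

Lemma H_norm_ge0 r c : 0 <= H_norm r c.
Proof. apply sqrt_pos. Qed.

Lemma H_derivative_coef r a b w dw :
  (forall t, in_interval a b t -> in_H r (w t)) ->
  (forall t, in_interval a b t -> in_H r (dw t)) ->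
  H_derivative r a b w dw ->
  forall t, in_interval a b t -> forall k, is_derive (fun x => w x k) t (dw t k).
Proof.
intros Hw Hdw HD t Ht k. apply is_derive_Reals. intros e He.
assert (Hp := Rpower_freq_pos k r).
destruct (in_interval_open a b t Ht) as [d1 [Hd1 Hin]].
assert (He' : 0 < e * Rpower (freq k) r) by now apply Rmult_lt_0_compat.
destruct (proj1 (filterlim_R_spec (Rbar_locally' 0) _ 0) (HD t Ht) _ He') as [d2 Hd2].
exists (mkposreal (Rmin d1 d2) (Rmin_pos _ _ Hd1 (cond_pos d2))). simpl.
intros h Hh0 Hh.
assert (Hh1 := Rlt_le_trans _ _ _ Hh (Rmin_l _ _)).
assert (Hh2 := Rlt_le_trans _ _ _ Hh (Rmin_r _ _)).
assert (Hth : in_interval a b (t + h)).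
{ apply Hin. now replace (t + h - t) with h by ring. }
assert (HH : in_H r (fun k => (w (t + h) k - w t k) / h - dw t k)).
{ apply in_H_minus; [|now apply Hdw].
  apply (in_H_ext _ (fun k => / h * (w (t + h) k - w t k))); [intros; unfold Rdiv; ring|].
  apply in_H_scal, in_H_minus; now apply Hw. }
assert (H := coef_le_H_norm r _ k HH). cbv beta in H.
assert (H2 := Hd2 h). rewrite Rminus_0_r, Rabs_pos_eq in H2 by apply H_norm_ge0.
assert (H3 : H_norm r (fun k => (w (t + h) k - w t k) / h - dw t k) < e * Rpower (freq k) r).
{ apply H2; [|exact Hh0]. change (Rabs (h - 0) < d2). now rewrite Rminus_0_r. }
apply (Rmult_lt_reg_r (Rpower (freq k) r)); lra.
Qed.

(** Young's inequality for w_x^2 - w_t^2 replaces the triangle inequality of the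
    norm. *)
Lemma H_continuous_quadratic r a b w (q : nat -> R) (C : R) :
  (forall k, 0 <= q k <= C * Rpower (freq k) (2 * r)) ->
  H_continuous r a b w ->
  forall t, in_interval a b t ->
    ex_series (fun k => q k * w t k ^ 2) /\
    continuous (fun x => Series (fun k => q k * w x k ^ 2)) t.
Proof.
intros Hq Hw.
assert (Hsum : forall c, in_H r c -> ex_series (fun k => q k * c k ^ 2)).
{ intros c Hc. eapply ex_series_dominated; [|exact (ex_series_Rscal C _ Hc)].
  intros k; cbv beta. destruct (Hq k) as [Hq1 Hq2].
  rewrite Rabs_pos_eq by nra. nra. }
assert (HC : 0 <= C).
{ destruct (Hq 0%nat) as [H1 H2]. assert (H := Rpower_freq_pos 0 (2 * r)). nra. }
assert (Hle : forall c, in_H r c -> Series (fun k => q k * c k ^ 2) <= C * H_norm r c ^ 2).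
{ intros c Hc. rewrite H_norm_sqr by exact Hc. rewrite <- Series_scal_l.
  apply Series_le; [|now apply ex_series_Rscal]. intros k.
  destruct (Hq k) as [Hq1 Hq2]. split; nra. }
intros t Ht. destruct (Hw t Ht) as [Hwt Hlim]. split; [now apply Hsum|].
apply (filterlim_R_spec (locally t)). intros e He.
set (S0 := Series (fun k => q k * w t k ^ 2)).
assert (HS0 : 0 <= S0).
{ apply Series_ge0; [|now apply Hsum]. intros k.
  destruct (Hq k) as [Hq1 _]. nra. }
set (del := e / (2 * (S0 + 1))).
assert (Hdel : 0 < del) by (apply Rdiv_lt_0_compat; lra).
assert (HdelS : del * S0 < e / 2).
{ unfold del. apply (Rmult_lt_reg_r (2 * (S0 + 1))); [lra|].
  replace (e / (2 * (S0 + 1)) * S0 * (2 * (S0 + 1))) with (e * S0) by (field; lra). nra. }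
set (K := (1 + / del) * C).
assert (Hdi := Rinv_0_lt_compat _ Hdel).
assert (HK : 0 <= K) by (unfold K; nra).
set (e2 := Rmin 1 (e / (2 * (K + 1)))).
assert (He2 : 0 < e2) by (apply Rmin_pos; [lra | apply Rdiv_lt_0_compat; lra]).
destruct (in_interval_open a b t Ht) as [d1 [Hd1 Hin]].
destruct (proj1 (filterlim_R_spec (Rbar_locally' t) _ 0) Hlim _ He2) as [d2 Hd2].
exists (mkposreal (Rmin d1 d2) (Rmin_pos _ _ Hd1 (cond_pos d2))).
intros x Hx. change (Rabs (x - t) < Rmin d1 d2) in Hx.
destruct (Req_dec x t) as [-> | Hne]; [rewrite Rminus_eq_0, Rabs_R0; exact He|].
assert (Hx1 := Rlt_le_trans _ _ _ Hx (Rmin_l _ _)).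
assert (Hx2 := Rlt_le_trans _ _ _ Hx (Rmin_r _ _)).
assert (Hwx : in_H r (w x)) by (apply Hw, Hin, Hx1).
assert (Hd := in_H_minus r _ _ Hwx Hwt).
assert (H1 := Hd2 x Hx2 Hne). rewrite Rminus_0_r, Rabs_pos_eq in H1 by apply H_norm_ge0.
set (N := H_norm r (fun k => w x k - w t k)) in *.
assert (HN0 : 0 <= N) by apply H_norm_ge0.
fold S0. unfold S0.
rewrite <- Series_minus by now apply Hsum.
eapply Rle_lt_trans.
- apply (Series_dominated_le _ (fun k => (1 + / del) * (q k * (w x k - w t k) ^ 2) +
    del * (q k * w t k ^ 2))).
  + intros k. destruct (Hq k) as [Hq1 _].
    replace (q k * w x k ^ 2 - q k * w t k ^ 2) with
      (q k * ((w x k - w t k) ^ 2 + 2 * (w x k - w t k) * w t k)) by ring.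
    rewrite Rabs_mult, (Rabs_pos_eq (q k)) by exact Hq1.
    replace ((1 + / del) * (q k * (w x k - w t k) ^ 2) + del * (q k * w t k ^ 2)) with
      (q k * ((1 + / del) * (w x k - w t k) ^ 2 + del * w t k ^ 2)) by ring.
    apply Rmult_le_compat_l; [exact Hq1|].
    set (y := w x k - w t k). set (z := w t k).
    assert (Hy : 2 * Rabs (y * z) <= / del * y ^ 2 + del * z ^ 2).
    { assert (H := pow2_ge_0 (Rabs y - del * Rabs z)).
      apply (Rmult_le_reg_l del); [exact Hdel|].
      replace (del * (/ del * y ^ 2 + del * z ^ 2)) with (y ^ 2 + del ^ 2 * z ^ 2) by (field; lra).
      rewrite Rabs_mult. rewrite <- (pow2_abs y), <- (pow2_abs z). nra. }
    eapply Rle_trans; [apply Rabs_triang|].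
    rewrite (Rabs_pos_eq (y ^ 2)) by apply pow2_ge_0.
    replace (2 * y * z) with (2 * (y * z)) by ring.
    rewrite (Rabs_mult 2), (Rabs_pos_eq 2) by lra. lra.
  + apply ex_series_Rplus; apply ex_series_Rscal; auto.
- rewrite Series_plus; try (apply ex_series_Rscal; auto; now apply (Hsum (fun k => w x k - w t k))).
  rewrite !Series_scal_l. fold S0.
  assert (H2 := Hle _ Hd). cbv beta in H2. fold N in H2.
  assert (HN1 : N ^ 2 <= e2).
  { assert (e2 <= 1) by apply Rmin_l. nra. }
  assert (HKe : K * e2 < e / 2).
  { assert (H3 : e2 <= e / (2 * (K + 1))) by apply Rmin_r.
    apply Rle_lt_trans with (K * (e / (2 * (K + 1)))); [now apply Rmult_le_compat_l|].
    apply (Rmult_lt_reg_r (2 * (K + 1))); [lra|].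
    replace (K * (e / (2 * (K + 1))) * (2 * (K + 1))) with (K * e) by (field; lra). nra. }
  assert (H3 : (1 + / del) * Series (fun k => q k * (w x k - w t k) ^ 2) <= K * e2).
  { apply Rle_trans with ((1 + / del) * (C * N ^ 2)); [apply Rmult_le_compat_l; lra|].
    replace ((1 + / del) * (C * N ^ 2)) with (K * N ^ 2) by (unfold K; ring).
    now apply Rmult_le_compat_l. }
  lra.
Qed.

Section WeakSolution.
Variables (m s : R) (a b : Rbar) (u0 v0 : nat -> R) (u ut utt : R -> nat -> R).
Hypothesis (Hm_lo : - (1 / 2) <= m) (Hm_hi : m <= 1) (Hs : 1 / 2 < s).
Hypothesis (Hu : H_continuous (s + 2) a b u).
Hypothesis (Hut : H_continuous s a b ut).
Hypothesis (Hutt : H_continuous (s - 2) a b utt).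
Hypothesis (Hdu : H_derivative s a b u ut).
Hypothesis (Hdut : H_derivative (s - 2) a b ut utt).
Hypothesis (Hweak : forall eta t, test_function eta -> in_interval a b t ->
  pairing (utt t) eta +
  RInt (fun x =>
          Derive_n (fun_of (u t)) 2 x * Derive_n eta 2 x +
          tension m (fun_of (u t)) *
            (Derive (fun_of (u t)) x * Derive eta x)) 0 PI = 0).

Lemma mode_derive t : in_interval a b t -> forall k,
  is_derive (fun x => u x k) t (ut t k).
Proof.
apply (H_derivative_coef s a b); auto.
- intros r Hr. apply (in_H_weaken (s + 2)); [lra | apply Hu, Hr].
- intros r Hr. apply Hut, Hr.
Qed.

Lemma mode_derive2 t : in_interval a b t -> forall k,
  is_derive (fun x => ut x k) t (utt t k).
Proof.
apply (H_derivative_coef (s - 2) a b); auto.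
- intros r Hr. apply (in_H_weaken s); [lra | apply Hut, Hr].
- intros r Hr. apply Hutt, Hr.
Qed.

Lemma summable_freq2 c : in_H (s + 2) c -> ex_series (fun k => Rabs (c k) * freq k ^ 2).
Proof. apply in_H_summable_pow. simpl; lra. Qed.

Lemma summable_freq_inv2 c : in_H (s - 2) c -> ex_series (fun k => Rabs (c k / freq k ^ 2)).
Proof.
intros Hc. eapply ex_series_ext_R; [|apply (in_H_summable (s - 2) (-2) c)]; [|lra | exact Hc].
intros k; cbv beta. assert (H := freq_pow_ge1 k 2).
unfold Rdiv. rewrite Rabs_mult. f_equal.
rewrite Rabs_pos_eq by (left; apply Rinv_0_lt_compat; lra).
replace (-2) with (- INR 2) by (simpl; ring). now rewrite Rpower_Ropp, Rpower_freq_nat.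
Qed.

(** The coefficients e_k of the equation divided by j^2 are absolutely summable, since
    s > 1 / 2. The sine series they define is continuous and vanishes at the ends, so
    [weakly_affine_zero] applies. *)
Lemma mode_equation t : in_interval a b t -> forall k,
  utt t k = - om m k ^ 2 * u t k -
    coupling * Series (fun k => (freq k * u t k) ^ 2) * (freq k ^ 2 * u t k).
Proof.
intros Ht.
assert (H2 := summable_freq2 _ (proj1 (Hu t Ht))).
assert (Hd := summable_freq_inv2 _ (proj1 (Hutt t Ht))).
assert (H1 := summable_lower _ 1 H2). assert (H0 := summable_coef _ (summable_lower _ 0 H1)).
set (tau := tension m (fun_of (u t))).
set (e := fun k => utt t k / freq k ^ 2 + (freq k ^ 2 + tau) * u t k).
assert (He : ex_series (fun k => Rabs (e k))).
{ eapply ex_series_dominated;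
    [|exact (ex_series_Rplus _ _ Hd (ex_series_Rplus _ _ H2 (ex_series_Rscal (Rabs tau) _ H0)))].
  intros k. cbv beta. rewrite Rabs_Rabsolu. unfold e.
  eapply Rle_trans; [apply Rabs_triang|]. apply Rplus_le_compat_l.
  rewrite Rmult_plus_distr_r. eapply Rle_trans; [apply Rabs_triang|].
  assert (H := freq_pow_ge1 k 2).
  rewrite !Rabs_mult, (Rabs_pos_eq (freq k ^ 2)) by lra. lra. }
assert (Hz : forall x, 0 <= x <= PI -> sine_series e x = 0).
{ apply weakly_affine_zero.
  - intros x; now apply sine_series_continuous.
  - apply sine_series_0.
  - apply sine_series_PI.
  - intros eta Heta.
    assert (H := weak_identity eta Heta (u t) (utt t) tau H2 Hd).
    unfold tau in H at 1. rewrite Hweak in H by auto. fold e in H. lra. }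
intros k.
assert (Hk : e k = 0).
{ rewrite <- (expansion_coefficient phi e k);
    auto using phi_continuous, phi_le, phi_orthogonal.
  apply RInt_zero. intros x Hx. assert (HP := PI_RGT_0).
  rewrite Rmin_left, Rmax_right in Hx by lra.
  change (Series (fun l => e l * phi l x)) with (sine_series e x).
  rewrite Hz by lra. ring. }
unfold e in Hk. unfold tau in Hk. rewrite tension_eq in Hk by exact H1.
assert (Hf := freq_ge1 k). rewrite om_sqr by lra.
replace (utt t k) with (utt t k / freq k ^ 2 * freq k ^ 2) by (field; lra).
replace (utt t k / freq k ^ 2) with
  (- ((freq k ^ 2 + (m + coupling * Series (fun k => (freq k * u t k) ^ 2))) * u t k)) by lra.
ring.
Qed.
End WeakSolution.

(** * The sup bound for weak solutions *)

(** The bound telescopes. *)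
Lemma sum_inv_sqr_le n : sum_n (fun k => / freq k ^ 2) n <= 2 - / freq n.
Proof.
induction n as [|n IH].
- rewrite sum_n_O_R. unfold freq; simpl. right; field.
- rewrite sum_n_S_R. assert (H := freq_ge1 n).
  assert (E : freq (S n) = freq n + 1) by (unfold freq; now rewrite (S_INR (S n))).
  rewrite E.
  assert (/ (freq n + 1) ^ 2 + / (freq n + 1) <= / freq n); [|lra].
  apply (Rmult_le_reg_r (freq n * (freq n + 1) ^ 2)); [apply Rmult_lt_0_compat; nra|].
  replace ((/ (freq n + 1) ^ 2 + / (freq n + 1)) * (freq n * (freq n + 1) ^ 2)) with
    (freq n + freq n * (freq n + 1)) by (field; lra).
  replace (/ freq n * (freq n * (freq n + 1) ^ 2)) with ((freq n + 1) ^ 2) by (field; lra).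
  nra.
Qed.

Lemma freq_inv_sqr_pos k : 0 < / freq k ^ 2.
Proof. apply Rinv_0_lt_compat. assert (H := freq_pow_ge1 k 2). lra. Qed.

Lemma ex_series_inv_sqr : ex_series (fun k => / freq k ^ 2).
Proof.
apply (ex_series_ext_R (fun k => Rpower (freq k) (- (2 * 1)))); [|apply ex_series_freq; lra].
intros k. rewrite Rpower_Ropp. f_equal. rewrite Rmult_1_r.
rewrite <- (Rpower_freq_nat k 2). f_equal.
Qed.

Lemma Series_inv_sqr_le : Series (fun k => / freq k ^ 2) <= 2.
Proof.
assert (H := Series_correct _ ex_series_inv_sqr).
apply (is_lim_seq_le (sum_n (fun k => / freq k ^ 2)) (fun _ => 2)
  (Series (fun k => / freq k ^ 2)) 2).
- intros n. eapply Rle_trans; [apply sum_inv_sqr_le|].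
  assert (0 < / freq n) by (apply Rinv_0_lt_compat; assert (H1 := freq_ge1 n); lra). lra.
- exact H.
- apply is_lim_seq_const.
Qed.

(** Young's inequality for the product of j |c_k| and 1 / j, balanced by e: the sum of
    |c_k| is at most (3.1 e + 2 e) / 2, and sqrt (2 / pi) <= 0.82. *)
Lemma fun_of_sup_le (c : nat -> R) (e x : R) :
  0 <= e -> ex_series (fun k => (freq k * c k) ^ 2) ->
  Series (fun k => (freq k * c k) ^ 2) <= 31 / 10 * e ^ 2 ->
  Rabs (fun_of c x) <= 21 / 10 * e.
Proof.
intros He Hc Hle.
assert (Hphi : forall k, Rabs (c k * phi k x) <= nrm * Rabs (c k)).
{ intros k. unfold phi; fold nrm. rewrite !Rabs_mult, (Rabs_pos_eq nrm) by (left; apply nrm_bounds).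
  assert (H1 := SIN_bound (freq k * x)).
  assert (Rabs (sin (freq k * x)) <= 1) by (apply Rabs_le; lra).
  assert (H3 := nrm_bounds). assert (H2 := Rabs_pos (c k)). assert (0 <= Rabs (c k) * nrm) by nra.
  nra. }
destruct (Rle_lt_or_eq_dec _ _ He) as [He0 | <-].
- assert (Hk : forall k, Rabs (c k) <= / (2 * e) * (freq k * c k) ^ 2 + e / 2 * / freq k ^ 2).
  { intros k. assert (Hf := freq_ge1 k).
    apply (Rmult_le_reg_l (2 * e)); [lra|].
    replace (2 * e * (/ (2 * e) * (freq k * c k) ^ 2 + e / 2 * / freq k ^ 2)) with
      ((freq k * c k) ^ 2 + (e * / freq k) ^ 2) by (field; lra).
    replace (2 * e * Rabs (c k)) with (2 * (Rabs (freq k * c k) * (e * / freq k))).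
    - rewrite <- (pow2_abs (freq k * c k)).
      assert (H := pow2_ge_0 (Rabs (freq k * c k) - e * / freq k)). nra.
    - rewrite Rabs_mult, (Rabs_pos_eq (freq k)) by lra. field; lra. }
  assert (Hex : ex_series (fun k => / (2 * e) * (freq k * c k) ^ 2 + e / 2 * / freq k ^ 2)).
  { apply ex_series_Rplus; apply ex_series_Rscal; [exact Hc | apply ex_series_inv_sqr]. }
  assert (Hn := nrm_bounds).
  assert (Hbound : Rabs (fun_of c x) <=
    nrm * Series (fun k => / (2 * e) * (freq k * c k) ^ 2 + e / 2 * / freq k ^ 2)).
  { rewrite <- Series_scal_l. apply Series_dominated_le; [|now apply ex_series_Rscal].
    intros k. eapply Rle_trans; [apply Hphi|]. apply Rmult_le_compat_l; [lra | apply Hk]. }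
  rewrite Series_plus, !Series_scal_l in Hbound;
    try (apply ex_series_Rscal; auto using ex_series_inv_sqr).
  assert (H1 : / (2 * e) * Series (fun k => (freq k * c k) ^ 2) <= 155 / 100 * e).
  { apply (Rmult_le_reg_l (2 * e)); [lra|].
    rewrite <- Rmult_assoc, Rinv_r, Rmult_1_l by lra. lra. }
  assert (H2 : e / 2 * Series (fun k => / freq k ^ 2) <= e).
  { assert (H := Series_inv_sqr_le). nra. }
  assert (Hn2 : nrm <= 82 / 100).
  { apply Rsqr_incr_0_var; [|lra].
    assert (HP := PI2_3_2). unfold nrm. rewrite Rsqr_sqrt by (apply Rlt_le, Rdiv_lt_0_compat; lra).
    unfold Rsqr. apply (proj2 (Rle_div_l _ _ _ PI_RGT_0)). lra. }
  eapply Rle_trans; [exact Hbound|].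
  apply Rle_trans with (82 / 100 * (155 / 100 * e + e)); [|lra].
  apply Rmult_le_compat; [lra| |lra|lra].
  assert (0 <= Series (fun k => (freq k * c k) ^ 2)) by
    (apply Series_ge0; auto; intros; apply pow2_ge_0).
  assert (0 <= Series (fun k => / freq k ^ 2)) by
    (apply Series_ge0; [intros; left; apply freq_inv_sqr_pos | apply ex_series_inv_sqr]).
  assert (0 < / (2 * e)) by (apply Rinv_0_lt_compat; lra). nra.
- assert (Hz : fun_of c x = 0).
  { apply Series_zero. intros k. assert (Hf := freq_ge1 k).
    assert (H := term_le_Series _ k (fun k => pow2_ge_0 (freq k * c k)) Hc). cbv beta in H.
    assert (H0 := pow2_ge_0 (freq k * c k)).
    assert (Hfc : freq k * c k = 0) by (apply Rsqr_0_uniq; unfold Rsqr; lra).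
    assert (c k = 0) by (apply Rmult_integral in Hfc; destruct Hfc; lra).
    rewrite H1; ring. }
  rewrite Hz, Rabs_R0; lra.
Qed.

Lemma Rpower_two k : Rpower (freq k) 2 = freq k ^ 2.
Proof. exact (Rpower_freq_nat k 2). Qed.

Lemma H_norm_1_sqr c : in_H 1 c -> H_norm 1 c ^ 2 = Series (fun k => (freq k * c k) ^ 2).
Proof.
intros Hc. rewrite H_norm_sqr by exact Hc. apply Series_ext. intros k.
rewrite Rmult_1_r, Rpower_two. ring.
Qed.

Lemma H_norm_0_sqr c : in_H 0 c -> H_norm 0 c ^ 2 = Series (fun k => c k ^ 2).
Proof.
intros Hc. rewrite H_norm_sqr by exact Hc. apply Series_ext. intros k.
rewrite Rmult_0_r, Rpower_O; [ring | assert (H := freq_ge1 k); lra].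
Qed.

Lemma in_H_1_sum c : in_H 1 c -> ex_series (fun k => (freq k * c k) ^ 2).
Proof.
apply ex_series_ext_R. intros k. rewrite Rmult_1_r, Rpower_two. ring.
Qed.

Lemma in_H_0_sum c : in_H 0 c -> ex_series (fun k => c k ^ 2).
Proof.
apply ex_series_ext_R. intros k.
rewrite Rmult_0_r, Rpower_O; [ring | assert (H := freq_ge1 k); lra].
Qed.

Lemma cfrak_ge1 m : - (1 / 2) <= m -> 1 <= cfrak m.
Proof.
intros Hm. unfold cfrak. destruct (Rle_dec 0 m) as [H | H]; [lra|].
apply Rnot_le_lt in H. rewrite <- Rinv_1 at 1. apply Rinv_le_contravar.
- apply sqrt_lt_R0; lra.
- apply Rle_trans with (sqrt 1); [apply sqrt_le_1_alt; lra | rewrite sqrt_1; lra].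
Qed.

Lemma eps1_sqr_le m e : - (1 / 2) <= m -> m <= 1 -> 0 <= e -> e <= eps1 m ->
  e ^ 2 <= 64 / 10000 * mu m /\ e ^ 4 <= Rabs m * mu m / 3222.
Proof.
intros Hm1 Hm2 He Hle. assert (Hmu := mu_pos m Hm1 Hm2). assert (Hc := cfrak_ge1 m Hm1).
assert (H1 := Rle_trans _ _ _ Hle (Rmin_l _ _)). assert (H2 := Rle_trans _ _ _ Hle (Rmin_r _ _)).
split.
- unfold eps0 in H1. apply Rle_trans with ((8 / 100 * sqrt (mu m)) ^ 2); [now apply pow_incr|].
  rewrite Rpow_mult_distr, <- (Rsqr_pow2 (sqrt (mu m))), Rsqr_sqrt by lra. lra.
- set (q := Rabs m * mu m / (3222 * cfrak m ^ 2)) in *.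
  assert (Hq : 0 <= q).
  { apply Rmult_le_pos; [apply Rmult_le_pos; [apply Rabs_pos | lra]|].
    left; apply Rinv_0_lt_compat; nra. }
  apply Rle_trans with (sqrt (sqrt q) ^ 4); [now apply pow_incr|].
  replace (sqrt (sqrt q) ^ 4) with ((sqrt (sqrt q) ^ 2) ^ 2) by ring.
  rewrite <- (Rsqr_pow2 (sqrt (sqrt q))), Rsqr_sqrt by apply sqrt_pos.
  rewrite <- (Rsqr_pow2 (sqrt q)), Rsqr_sqrt by exact Hq.
  unfold q, Rdiv. apply Rmult_le_compat_l; [apply Rmult_le_pos; [apply Rabs_pos | lra]|].
  apply Rinv_le_contravar; nra.
Qed.

Lemma T1_le m e : - (1 / 2) <= m -> m <= 1 -> m <> 0 -> T1 m e <= Rabs m * mu m / 6595.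
Proof.
intros Hm1 Hm2 Hm0. assert (Hmu := mu_pos m Hm1 Hm2). assert (Hc := cfrak_ge1 m Hm1).
assert (Hma := Rabs_pos_lt m Hm0).
unfold T1.
set (den := 6595 * cfrak m ^ 3 * _).
assert (Hden : 6595 <= den).
{ unfold den; clear den.
assert (H3 : 1 <= cfrak m ^ 3) by now apply pow_R1_Rle.
assert (H2 := pow2_ge_0 e).
assert (Ha : 0 < cfrak m / (Rabs m * mu m)) by
  (apply Rdiv_lt_0_compat; [lra | now apply Rmult_lt_0_compat]).
assert (Hb : 0 < cfrak m / mu m) by (apply Rdiv_lt_0_compat; lra).
set (A := 30 * (cfrak m / (Rabs m * mu m)) * e ^ 2).
set (B := 90 * (cfrak m / mu m) * e ^ 2).
assert (0 <= A) by (apply Rmult_le_pos; lra). assert (0 <= B) by (apply Rmult_le_pos; lra).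
nra. }
unfold Rdiv. apply Rmult_le_compat_l; [apply Rmult_le_pos; lra|].
apply Rinv_le_contravar; lra.
Qed.

(** The modes satisfy the hypotheses of [mass_bound], whose conclusion is exactly what
    [fun_of_sup_le] needs. *)
Theorem weak_solution_sup_bound (m s : R) (u0 v0 : nat -> R) (a b : Rbar) (u : R -> nat -> R) :
  - (1 / 2) <= m -> m <= 1 -> m <> 0 -> 1 / 2 < s ->
  in_H (s + 2) u0 -> in_H s v0 -> epsilon m u0 v0 <= eps1 m ->
  weak_solution m s a b u0 v0 u ->
  forall t, in_interval a b t -> within_time m (epsilon m u0 v0) t ->
  Rbar_le (sup_abs (fun_of (u t))) (21 / 10 * epsilon m u0 v0).
Proof.
intros Hm_lo Hm_hi Hm0 Hs Hu0 Hv0 Heps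
  [H0in [ut [utt [Hu [Hdu [Hut [Hdut [Hutt [Eu0 [Ev0 [_ Hweak]]]]]]]]]]] t Ht Htime.
set (e := epsilon m u0 v0) in *.
assert (Hw : 0 < sqrt (1 + m)) by (apply sqrt_lt_R0; lra).
assert (He : 0 <= e).
{ eapply Rle_trans; [apply (H_norm_ge0 1 u0) | apply Rmax_l]. }
destruct (eps1_sqr_le m e Hm_lo Hm_hi He Heps) as [Hsmall2 Hsmall4].
assert (HT := T1_le m e Hm_lo Hm_hi Hm0).
assert (Hu0' : in_H 1 u0) by (apply (in_H_weaken (s + 2)); [lra | exact Hu0]).
assert (Hv0' : in_H 0 v0) by (apply (in_H_weaken s); [lra | exact Hv0]).
set (X := fun k x => freq k * u x k).
set (Y := fun k x => / om m k * freq k * ut x k).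
set (kap := fun x => coupling * Series (fun k => X k x ^ 2)).
assert (Hseg : forall x, seg t x -> in_interval a b x) by
  (intros x Hx; now apply (in_interval_seg a b t)).
assert (HX2 : forall k, 0 <= freq k ^ 2 <= 1 * Rpower (freq k) (2 * (s + 2))).
{ intros k. assert (H := freq_ge1 k). split; [nra|].
  rewrite <- Rpower_two, Rmult_1_l. apply Rle_Rpower; lra. }
assert (HY2 : forall k, 0 <= (/ om m k * freq k) ^ 2 <= 2 * Rpower (freq k) (2 * s)).
{ intros k. assert (H := freq_ge1 k). split; [apply pow2_ge_0|].
  assert (Hr : 1 <= Rpower (freq k) (2 * s)).
  { rewrite <- (Rpower_O (freq k)) at 1 by lra. apply Rle_Rpower; lra. }
  apply Rle_trans with 2; [|lra].
  rewrite Rpow_mult_distr, pow_inv, om_sqr by lra.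
  replace (/ (freq k ^ 2 * (freq k ^ 2 + m)) * freq k ^ 2) with (/ (freq k ^ 2 + m))
    by (assert (Hp : 1 / 2 <= freq k ^ 2 + m) by (apply root_arg_pos; lra); field; lra).
  replace 2 with (/ / 2) by field. apply Rinv_le_contravar; [lra|].
  assert (Hp : 1 / 2 <= freq k ^ 2 + m) by (apply root_arg_pos; lra). lra. }
assert (HcX := H_continuous_quadratic (s + 2) a b u (fun k => freq k ^ 2) 1 HX2 Hu).
assert (HcY := H_continuous_quadratic s a b ut (fun k => (/ om m k * freq k) ^ 2) 2 HY2 Hut).
assert (HsX : forall x, in_interval a b x -> ex_series (fun k => X k x * X k x)).
{ intros x Hx. eapply ex_series_ext_R; [|exact (proj1 (HcX x Hx))].
  intros k; cbv beta; unfold X; ring. }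
assert (HsY : forall x, in_interval a b x -> ex_series (fun k => Y k x * Y k x)).
{ intros x Hx. eapply ex_series_ext_R; [|exact (proj1 (HcY x Hx))].
  intros k; cbv beta; unfold Y; ring. }
assert (HsXY : forall x, seg t x -> ex_series (fun k => X k x * X k x + Y k x * Y k x)).
{ intros x Hx. apply ex_series_Rplus; auto. }
assert (Hmass : total_mass X Y t <= 31 / 10 * e ^ 2).
{ apply (mass_bound m X Y kap t u0 v0); auto.
  - intros x Hx k. assert (Hom : 0 < om m k) by (apply om_pos; lra).
    eapply is_derive_cast.
    + apply is_derive_Rscal.
      apply (mode_derive s a b u ut); auto.
    + unfold Y. field; lra.
  - intros x Hx k. assert (Hom : 0 < om m k) by (apply om_pos; lra).
    eapply is_derive_cast.
    + apply is_derive_Rscal.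
      apply (mode_derive2 s a b ut utt); auto.
    + rewrite (mode_equation m s a b u utt) by auto.
      unfold kap, X. rewrite <- om_gain with (m := m) by lra. field; lra.
  - intros x Hx. specialize (Hseg x Hx).
    destruct (in_interval_open a b x Hseg) as [d [Hd Hin]].
    apply (continuous_ext_loc _ (fun x => Series (fun k => freq k ^ 2 * u x k ^ 2) +
      Series (fun k => (/ om m k * freq k) ^ 2 * ut x k ^ 2))).
    + exists (mkposreal d Hd). intros y Hy. specialize (Hin y Hy).
      rewrite <- Series_plus by first [exact (proj1 (HcX y Hin)) | exact (proj1 (HcY y Hin))].
      apply Series_ext. intros k. unfold X, Y; ring.
    + apply continuous_Rplus; [exact (proj2 (HcX x Hseg)) | exact (proj2 (HcY x Hseg))].
  - intros k. unfold X. now rewrite Eu0.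
  - intros k. unfold Y. rewrite Ev0. unfold Rdiv. ring.
  - now apply in_H_1_sum.
  - now apply in_H_0_sum.
  - rewrite <- H_norm_1_sqr by exact Hu0'.
    apply pow_incr; split; [apply H_norm_ge0 | apply Rmax_l].
  - rewrite <- H_norm_0_sqr by exact Hv0'.
    assert (H : H_norm 0 v0 <= sqrt (1 + m) * e).
    { rewrite Rmult_comm. apply (proj1 (Rle_div_l _ _ _ Hw)). apply Rmax_r. }
    replace (1 + m) with (sqrt (1 + m) ^ 2) by (rewrite <- Rsqr_pow2; apply Rsqr_sqrt; lra).
    rewrite <- Rpow_mult_distr. apply pow_incr; split; [apply H_norm_ge0 | exact H].
  - eapply Rle_trans; [exact Htime | exact HT]. }
unfold sup_abs. apply (proj2 (Lub_Rbar_correct _)).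
intros y [x [_ ->]]. apply fun_of_sup_le; [exact He| |].
- eapply ex_series_ext_R; [|exact (HsX t Ht)]. intros k; cbv beta; unfold X; ring.
- eapply Rle_trans; [|exact Hmass].
  apply Series_le; [|apply HsXY, seg_end]. intros k. split; [apply pow2_ge_0|].
  unfold X. assert (H := Rle_0_sqr (Y k t)). unfold Rsqr in H. nra.
Qed.

(** * Picard iteration for the truncated coupling *)

Lemma RInt_exp_le (f : R -> R) (B lam t : R) :
  0 < lam -> (forall x, continuous f x) ->
  (forall x, seg t x -> Rabs (f x) <= B * exp (lam * Rabs x)) ->
  Rabs (RInt f 0 t) <= B * ((exp (lam * Rabs t) - 1) / lam).
Proof.
intros Hlam Hf Hb.
assert (Cexp : forall k x, continuous (fun y => B * exp (k * y)) x).
{ intros k x. apply (ex_derive_continuous (V := R_NormedModule)). auto_derive; easy. }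
assert (Hint : forall k p q, k <> 0 ->
  RInt (fun y => B * exp (k * y)) p q = B * ((exp (k * q) - exp (k * p)) / k) :> R).
{ intros k p q Hk.
  rewrite (RInt_FTC (fun y => B * (exp (k * y) / k))) with (2 := Cexp k).
  - unfold Rdiv; ring.
  - intros x. auto_derive; [easy | field; auto]. }
assert (Hgen : forall p q h, p <= q -> (forall x, continuous h x) ->
  (forall x, p <= x <= q -> Rabs (f x) <= h x) -> Rabs (RInt f p q) <= RInt h p q).
{ intros p q h Hpq Hh Hfh. eapply Rle_trans.
  - apply abs_RInt_le; [exact Hpq | now apply ex_RInt_cont].
  - apply RInt_le; [exact Hpq | | now apply ex_RInt_cont | intros x Hx; apply Hfh; lra].
    apply ex_RInt_cont. intros x. apply (continuous_comp f Rabs); [apply Hf | apply continuous_Rabs]. }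
destruct (Rle_dec 0 t) as [Ht | Ht].
- rewrite (Rabs_pos_eq t) by exact Ht.
  eapply Rle_trans; [apply (Hgen 0 t (fun y => B * exp (lam * y))); auto|].
  + intros x Hx. rewrite <- (Rabs_pos_eq x) at 2 by lra. apply Hb.
    unfold seg; rewrite Rmin_left, Rmax_right; lra.
  + rewrite Hint by lra. rewrite Rmult_0_r, exp_0. right; reflexivity.
- apply Rnot_le_lt in Ht. rewrite (Rabs_left t) by exact Ht.
  rewrite <- (opp_RInt_swap f t 0) by (now apply ex_RInt_cont).
  change (opp (RInt f t 0)) with (- RInt f t 0). rewrite Rabs_Ropp.
  eapply Rle_trans; [apply (Hgen t 0 (fun y => B * exp (- lam * y))); auto; [lra|]|].
  + intros x Hx. replace (- lam * x) with (lam * Rabs x) by (rewrite Rabs_left1; lra).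
    apply Hb. unfold seg; rewrite Rmin_right, Rmax_left; lra.
  + rewrite Hint by lra. rewrite Rmult_0_r, exp_0.
    right. replace (lam * - t) with (- lam * t) by ring. field; lra.
Qed.

Lemma Rmin_lipschitz M x y : Rabs (Rmin M x - Rmin M y) <= Rabs (x - y).
Proof.
unfold Rmin; destruct (Rle_dec M x), (Rle_dec M y); unfold Rabs; repeat destruct Rcase_abs; lra.
Qed.

Lemma continuous_Rmin M (f : R -> R) x :
  continuous f x -> continuous (fun y => Rmin M (f y)) x.
Proof.
intros Hf. apply (filterlim_R_spec (locally x)). intros e He.
assert (H := proj1 (filterlim_R_spec (locally x) f (f x)) Hf e He).
eapply filter_imp; [|exact H]. intros y Hy.
eapply Rle_lt_trans; [apply Rmin_lipschitz | exact Hy].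
Qed.

Definition stretch (w : nat -> R -> R) (t : R) : R :=
  coupling * Series (fun k => (freq k * w k t) ^ 2).

Section Picard.
Variables (om g A : nat -> R) (u0 v0 : nat -> R) (M : R).
Hypothesis (Hom : forall k, 0 < om k) (Hg : forall k, 0 < g k <= 3 / 2) (HM : 0 < M).
Hypothesis (HA : forall k, Rabs (u0 k) + Rabs (v0 k / om k) <= A k).
Hypothesis (HAsum : ex_series (fun k => (freq k * A k) ^ 2)).

(** Capping the coupling makes it bounded, so that single modes grow at most
    exponentially with a rate known in advance. *)
Definition cut (w : nat -> R -> R) (t : R) : R :=
  Rmin M (stretch w t).

(** Amplitudes in the rotating frame; the Duhamel formula for u_k contains only these
    and no second derivative. *)
Definition cos_part (w : nat -> R -> R) (k : nat) (t : R) : R :=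
  u0 k + g k * RInt (fun r => sin (om k * r) * (cut w r * w k r)) 0 t.
Definition sin_part (w : nat -> R -> R) (k : nat) (t : R) : R :=
  v0 k / om k - g k * RInt (fun r => cos (om k * r) * (cut w r * w k r)) 0 t.
Definition duhamel (w : nat -> R -> R) (k : nat) (t : R) : R :=
  cos (om k * t) * cos_part w k t + sin (om k * t) * sin_part w k t.

(* Two integrals of size gain M <= 3 M / 2 each. *)
Let lam := 3 * M.

Definition admissible (w : nat -> R -> R) : Prop :=
  (forall k t, continuous (w k) t) /\
  (forall k t, Rabs (w k t) <= A k * exp (lam * Rabs t)).

Lemma A_ge0 k : 0 <= A k.
Proof.
eapply Rle_trans; [|apply HA]. apply Rplus_le_le_0_compat; apply Rabs_pos.
Qed.

Lemma exp_le x y : x <= y -> exp x <= exp y.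
Proof. intros [H | ->]; [left; now apply exp_increasing | lra]. Qed.

Let W : R := Series (fun k => (freq k * A k) ^ 2).

Lemma admissible_sqr w k t : admissible w ->
  (freq k * w k t) ^ 2 <= exp (2 * (lam * Rabs t)) * (freq k * A k) ^ 2.
Proof.
intros [_ Hw]. assert (Hf := freq_ge1 k).
rewrite <- pow2_abs, Rabs_mult, (Rabs_pos_eq (freq k)) by lra.
replace (exp (2 * (lam * Rabs t))) with (exp (lam * Rabs t) ^ 2).
- rewrite <- Rpow_mult_distr. apply pow_incr.
  assert (H1 := Rabs_pos (w k t)). specialize (Hw k t). split; [nra|].
  replace (exp (lam * Rabs t) * (freq k * A k)) with (freq k * (A k * exp (lam * Rabs t))) by ring.
  apply Rmult_le_compat_l; lra.
- simpl. rewrite Rmult_1_r, <- exp_plus. f_equal; ring.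
Qed.

Lemma admissible_sum w t : admissible w -> ex_series (fun k => (freq k * w k t) ^ 2).
Proof.
intros Hw. eapply ex_series_dominated; [|exact (ex_series_Rscal (exp (2 * (lam * Rabs t))) _ HAsum)].
intros k; cbv beta. rewrite Rabs_pos_eq by apply pow2_ge_0. now apply admissible_sqr.
Qed.

Lemma cut_bounds w t : admissible w -> 0 <= cut w t <= M.
Proof.
intros Hw. split; [|apply Rmin_l]. apply Rmin_glb; [lra|].
apply Rmult_le_pos; [left; apply coupling_bounds|].
apply Series_ge0; [intros; apply pow2_ge_0 | now apply admissible_sum].
Qed.

Lemma cut_continuous w t : admissible w -> continuous (cut w) t.
Proof.
intros Hw. apply continuous_Rmin. apply continuous_Rmult; [apply continuous_const|].
apply (Series_continuous (fun k s => (freq k * w k s) ^ 2)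
  (fun k => exp (2 * (lam * (Rabs t + 1))) * (freq k * A k) ^ 2) t 1);
  [lra | now apply ex_series_Rscal | |].
- intros k. apply (continuous_ext (fun s => freq k * w k s * (freq k * w k s))).
  + intros s; simpl; ring.
  + assert (H : continuous (fun s => freq k * w k s) t).
    { apply continuous_Rmult; [apply continuous_const | apply Hw]. }
    now apply continuous_Rmult.
- intros k s Hs. rewrite Rabs_pos_eq by apply pow2_ge_0.
  eapply Rle_trans; [now apply admissible_sqr|].
  apply Rmult_le_compat_r; [apply pow2_ge_0|]. apply exp_le.
  assert (H := Rabs_triang_inv s t). unfold lam. nra.
Qed.

Lemma forcing_continuous w k (h : R -> R) t :
  admissible w -> continuous h t -> continuous (fun r => h r * (cut w r * w k r)) t.
Proof.
intros Hw Hh. apply continuous_Rmult; [exact Hh|].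
apply continuous_Rmult; [now apply cut_continuous | apply Hw].
Qed.

Lemma continuous_cos_om k t : continuous (fun r => cos (om k * r)) t.
Proof. apply (ex_derive_continuous (V := R_NormedModule)). auto_derive; easy. Qed.

Lemma continuous_sin_om k t : continuous (fun r => sin (om k * r)) t.
Proof. apply (ex_derive_continuous (V := R_NormedModule)). auto_derive; easy. Qed.

Lemma cos_part_derive w k t : admissible w ->
  is_derive (cos_part w k) t (g k * (sin (om k * t) * (cut w t * w k t))).
Proof.
intros Hw. eapply is_derive_cast.
- apply is_derive_Rplus; [apply is_derive_Rconst|]. apply is_derive_Rscal.
  apply (primitive_derive (fun r => sin (om k * r) * (cut w r * w k r))).
  intros x. apply forcing_continuous; [exact Hw | apply continuous_sin_om].
- ring.
Qed.

Lemma sin_part_derive w k t : admissible w ->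
  is_derive (sin_part w k) t (- (g k * (cos (om k * t) * (cut w t * w k t)))).
Proof.
intros Hw. eapply is_derive_cast.
- apply is_derive_Rminus; [apply is_derive_Rconst|]. apply is_derive_Rscal.
  apply (primitive_derive (fun r => cos (om k * r) * (cut w r * w k r))).
  intros x. apply forcing_continuous; [exact Hw | apply continuous_cos_om].
- ring.
Qed.

Lemma Rabs_cos_sin_le x y z : Rabs (cos x * y + sin x * z) <= Rabs y + Rabs z.
Proof.
assert (H1 := COS_bound x). assert (H2 := SIN_bound x).
apply Rabs_add_le; rewrite Rmult_comm; apply Rabs_mult_le1, Rabs_le; lra.
Qed.

Lemma integral_pair_le (k : nat) (h : R -> R) (B l t : R) :
  0 < l -> (forall x, continuous h x) ->
  (forall x, seg t x -> Rabs (h x) <= B * exp (l * Rabs x)) ->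
  Rabs (RInt (fun r => sin (om k * r) * h r) 0 t) +
  Rabs (RInt (fun r => cos (om k * r) * h r) 0 t) <=
  2 * B * ((exp (l * Rabs t) - 1) / l).
Proof.
intros Hl Hh Hb.
replace (2 * B * ((exp (l * Rabs t) - 1) / l)) with
  (B * ((exp (l * Rabs t) - 1) / l) + B * ((exp (l * Rabs t) - 1) / l)) by ring.
apply Rplus_le_compat; apply RInt_exp_le; auto.
- intros x. apply continuous_Rmult; [apply continuous_sin_om | apply Hh].
- intros x Hx. rewrite Rmult_comm. eapply Rle_trans; [|now apply Hb].
  assert (H := SIN_bound (om k * x)). apply Rabs_mult_le1, Rabs_le; lra.
- intros x. apply continuous_Rmult; [apply continuous_cos_om | apply Hh].
- intros x Hx. rewrite Rmult_comm. eapply Rle_trans; [|now apply Hb].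
  assert (H := COS_bound (om k * x)). apply Rabs_mult_le1, Rabs_le; lra.
Qed.

Lemma forcing_continuous_one w k t : admissible w -> continuous (fun r => cut w r * w k r) t.
Proof. intros Hw. apply continuous_Rmult; [now apply cut_continuous | apply Hw]. Qed.

Lemma duhamel_admissible w : admissible w -> admissible (duhamel w).
Proof.
intros Hw. split.
- intros k t. apply continuous_Rplus; apply continuous_Rmult.
  + apply continuous_cos_om.
  + eapply is_derive_continuous; now apply cos_part_derive.
  + apply continuous_sin_om.
  + eapply is_derive_continuous; now apply sin_part_derive.
- intros k t. destruct (Hg k) as [Hg1 Hg2].
  assert (Hl : 0 < lam) by (unfold lam; lra).
  eapply Rle_trans; [apply Rabs_cos_sin_le|]. unfold cos_part, sin_part.
  assert (Hint := integral_pair_le k (fun r => cut w r * w k r) (M * A k) lam t Hl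
    (fun x => forcing_continuous_one w k x Hw)).
  set (I1 := RInt (fun r => sin (om k * r) * (cut w r * w k r)) 0 t) in *.
  set (I2 := RInt (fun r => cos (om k * r) * (cut w r * w k r)) 0 t) in *.
  assert (H : Rabs I1 + Rabs I2 <= 2 * (M * A k) * ((exp (lam * Rabs t) - 1) / lam)).
  { apply Hint. intros x _. assert (Hc := cut_bounds w x Hw).
    rewrite Rabs_mult, (Rabs_pos_eq (cut w x)), Rmult_assoc by lra.
    apply Rmult_le_compat; [lra | apply Rabs_pos | lra | apply Hw]. }
  assert (H1 : 2 * (M * A k) * ((exp (lam * Rabs t) - 1) / lam) =
    2 / 3 * A k * (exp (lam * Rabs t) - 1)) by (unfold lam; field; lra).
  rewrite H1 in H.
  eapply Rle_trans; [apply Rplus_le_compat; [apply Rabs_triang | apply Rabs_triang]|].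
  rewrite Rabs_Ropp, !Rabs_mult, (Rabs_pos_eq (g k)) by lra.
  specialize (HA k). assert (P1 := Rabs_pos I1). assert (P2 := Rabs_pos I2). nra.
Qed.

(** Six times the Lipschitz constant of w -> cut w * w for |t| <= T, in units of A. *)
Definition rate (T : R) : R := 6 * (M + 2 * coupling * W * exp (2 * (lam * T))).

Lemma rate_bounds T : 6 * M <= rate T.
Proof.
unfold rate. assert (H := coupling_bounds). assert (HW : 0 <= W).
{ apply Series_ge0; [intros; apply pow2_ge_0 | exact HAsum]. }
assert (H1 := exp_pos (2 * (lam * T))).
assert (0 <= 2 * coupling * W * exp (2 * (lam * T))); [|lra].
apply Rmult_le_pos; [|lra]. apply Rmult_le_pos; lra.
Qed.

Lemma cut_difference w z (T del L x : R) :
  admissible w -> admissible z -> 0 <= del -> Rabs x <= T ->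
  (forall k, Rabs (w k x - z k x) <= A k * (del * exp (L * Rabs x))) ->
  Rabs (cut w x - cut z x) <= 2 * coupling * W * exp (lam * T) * (del * exp (L * Rabs x)).
Proof.
intros Hw Hz Hdel Hx Hd. assert (Hc := coupling_bounds).
set (D := del * exp (L * Rabs x)) in *.
unfold cut. eapply Rle_trans; [apply Rmin_lipschitz|]. unfold stretch.
rewrite <- Rmult_minus_distr_l, <- Series_minus by now apply admissible_sum.
rewrite Rabs_mult, (Rabs_pos_eq coupling) by lra.
replace (2 * coupling * W * exp (lam * T) * D) with (coupling * (2 * exp (lam * T) * D * W)) by ring.
apply Rmult_le_compat_l; [lra|]. unfold W. rewrite <- Series_scal_l.
apply Series_dominated_le; [|now apply ex_series_Rscal].
intros k. assert (HA0 := A_ge0 k).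
replace ((freq k * w k x) ^ 2 - (freq k * z k x) ^ 2) with
  (freq k ^ 2 * ((w k x - z k x) * (w k x + z k x))) by ring.
rewrite Rabs_mult, (Rabs_pos_eq (freq k ^ 2)), Rabs_mult by nra.
replace (2 * exp (lam * T) * D * (freq k * A k) ^ 2) with
  (freq k ^ 2 * ((A k * D) * (A k * exp (lam * T) + A k * exp (lam * T)))) by ring.
apply Rmult_le_compat_l; [nra|].
assert (He : exp (lam * Rabs x) <= exp (lam * T)) by (apply exp_le; unfold lam; nra).
apply Rmult_le_compat; auto using Rabs_pos.
apply Rabs_add_le; (eapply Rle_trans; [apply Hw || apply Hz | now apply Rmult_le_compat_l]).
Qed.

(** Integrating exp (L |t|) gains a factor 1 / L, and [rate] is six times the Lipschitz
    constant, which leaves a factor one half after the two integrals and the gain. *)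
Lemma duhamel_contraction w z (T del t : R) :
  admissible w -> admissible z -> 0 <= del -> Rabs t <= T ->
  (forall k x, Rabs x <= T -> Rabs (w k x - z k x) <= A k * (del * exp (rate T * Rabs x))) ->
  forall k, Rabs (duhamel w k t - duhamel z k t) <=
    A k * (del / 2 * exp (rate T * Rabs t)).
Proof.
intros Hw Hz Hdel Ht Hd k. assert (HA0 := A_ge0 k). destruct (Hg k) as [Hg1 Hg2].
assert (Hrate := rate_bounds T). assert (Hr : 0 < rate T) by lra.
set (h := fun r => cut w r * w k r - cut z r * z k r).
assert (Ch : forall x, continuous h x).
{ intros x. apply continuous_Rminus; now apply forcing_continuous_one. }
assert (Hh : forall x, seg t x -> Rabs (h x) <=
  (A k * del * (rate T / 6)) * exp (rate T * Rabs x)).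
{ intros x Hx. assert (HxT : Rabs x <= T) by exact (Rle_trans _ _ _ (seg_Rabs _ _ Hx) Ht).
  unfold h. replace (cut w x * w k x - cut z x * z k x) with
    (cut w x * (w k x - z k x) + (cut w x - cut z x) * z k x) by ring.
  assert (Hc := cut_bounds w x Hw).
  assert (Hcd := cut_difference w z T del (rate T) x Hw Hz Hdel HxT (fun k => Hd k x HxT)).
  replace (A k * del * (rate T / 6) * exp (rate T * Rabs x)) with
    (M * (A k * (del * exp (rate T * Rabs x))) +
     2 * coupling * W * exp (lam * T) * (del * exp (rate T * Rabs x)) * (A k * exp (lam * T))).
  2: { unfold rate at 3. replace (2 * (lam * T)) with (lam * T + lam * T) by ring.
       rewrite exp_plus. field. }
  assert (He : exp (lam * Rabs x) <= exp (lam * T)) by (apply exp_le; unfold lam; nra).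
  apply Rabs_add_le; rewrite Rabs_mult; apply Rmult_le_compat; auto using Rabs_pos.
  - rewrite Rabs_pos_eq; lra.
  - eapply Rle_trans; [apply Hz | now apply Rmult_le_compat_l]. }
assert (Hint := integral_pair_le k h _ _ t Hr Ch Hh).
assert (Hsplit : forall f : R -> R, (forall x, continuous f x) ->
  RInt (fun r => f r * (cut w r * w k r)) 0 t - RInt (fun r => f r * (cut z r * z k r)) 0 t =
  RInt (fun r => f r * h r) 0 t :> R).
{ intros f Cf.
  rewrite (RInt_ext_R (fun r => f r * h r)
    (fun r => f r * (cut w r * w k r) + (-1) * (f r * (cut z r * z k r)))) by
    (intros; unfold h; ring).
  rewrite RInt_Rplus, RInt_Rscal; [ring | | | ].
  all: intros x; try apply (continuous_Rmult (fun _ => -1)); try apply continuous_const;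
    apply forcing_continuous; auto. }
set (I1 := RInt (fun r => sin (om k * r) * h r) 0 t) in *.
set (I2 := RInt (fun r => cos (om k * r) * h r) 0 t) in *.
assert (E : duhamel w k t - duhamel z k t =
  cos (om k * t) * (g k * I1) + sin (om k * t) * (- (g k * I2))).
{ unfold duhamel, cos_part, sin_part, I1, I2.
  rewrite <- (Hsplit (fun r => sin (om k * r))), <- (Hsplit (fun r => cos (om k * r))).
  - ring.
  - intros; apply continuous_cos_om.
  - intros; apply continuous_sin_om. }
rewrite E. eapply Rle_trans; [apply Rabs_cos_sin_le|].
rewrite Rabs_Ropp, !Rabs_mult, (Rabs_pos_eq (g k)) by lra.
rewrite <- Rmult_plus_distr_l.
apply Rle_trans with (3 / 2 * (2 * (A k * del * (rate T / 6)) *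
  ((exp (rate T * Rabs t) - 1) / rate T))).
- apply Rmult_le_compat; [lra | | lra | exact Hint].
  apply Rplus_le_le_0_compat; apply Rabs_pos.
- replace (3 / 2 * (2 * (A k * del * (rate T / 6)) * ((exp (rate T * Rabs t) - 1) / rate T)))
    with (A k * (del / 2 * (exp (rate T * Rabs t) - 1))) by (field; lra).
  apply Rmult_le_compat_l; [exact HA0|]. nra.
Qed.
Fixpoint picard (n : nat) : nat -> R -> R :=
  match n with O => fun _ _ => 0 | S n => duhamel (picard n) end.

Lemma picard_admissible n : admissible (picard n).
Proof.
induction n as [|n IH]; [|now apply duhamel_admissible].
split; intros k t; [apply continuous_const|]. simpl. rewrite Rabs_R0.
apply Rmult_le_pos; [apply A_ge0 | left; apply exp_pos].
Qed.

(** The weights depend on T but the iterates do not, so the limit is defined for all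
    times at once. *)
Lemma picard_step T n k t : Rabs t <= T ->
  Rabs (picard (S n) k t - picard n k t) <= A k * ((1 / 2) ^ n * exp (rate T * Rabs t)).
Proof.
revert k t; induction n as [|n IH]; intros k t Ht.
- change (picard 0 k t) with 0. rewrite Rminus_0_r, pow_O, Rmult_1_l.
  eapply Rle_trans; [apply (picard_admissible 1)|].
  apply Rmult_le_compat_l; [apply A_ge0|]. apply exp_le.
  apply Rmult_le_compat_r; [apply Rabs_pos|]. assert (H := rate_bounds T). unfold lam; lra.
- change (picard (S (S n))) with (duhamel (picard (S n))).
  change (picard (S n)) with (duhamel (picard n)) at 2.
  replace ((1 / 2) ^ S n) with ((1 / 2) ^ n / 2) by (simpl; field).
  apply (duhamel_contraction (picard (S n)) (picard n) T); auto using picard_admissible.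
  apply pow_le; lra.
Qed.

Lemma picard_cauchy T n p k t : Rabs t <= T ->
  Rabs (picard (n + p) k t - picard n k t) <=
  A k * ((2 * (1 / 2) ^ n - 2 * (1 / 2) ^ (n + p)) * exp (rate T * Rabs t)).
Proof.
intros Ht. induction p as [|p IH].
- rewrite Nat.add_0_r, Rminus_eq_0, Rabs_R0. right; ring.
- rewrite Nat.add_succ_r.
  replace (picard (S (n + p)) k t - picard n k t) with
    ((picard (S (n + p)) k t - picard (n + p) k t) + (picard (n + p) k t - picard n k t)) by ring.
  eapply Rle_trans; [apply Rabs_triang|].
  assert (H := picard_step T (n + p) k t Ht).
  replace ((1 / 2) ^ S (n + p)) with ((1 / 2) ^ (n + p) / 2) by (simpl; field). nra.
Qed.

Lemma half_pow_small (C e : R) : 0 <= C -> 0 < e ->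
  exists N, forall n, (N <= n)%nat -> (1 / 2) ^ n * C < e.
Proof.
intros HC He. destruct (pow_lt_1_zero (1 / 2)) with (y := e / (C + 1)) as [N HN].
- rewrite Rabs_pos_eq; lra.
- apply Rdiv_lt_0_compat; lra.
- exists N. intros n Hn. specialize (HN n Hn).
  assert (Hp : 0 < (1 / 2) ^ n) by (apply pow_lt; lra).
  rewrite Rabs_pos_eq in HN by lra. assert (HC1 : C + 1 > 0) by lra.
  apply (proj2 (Rlt_div_r _ _ _ HC1)) in HN.
  nra.
Qed.

Definition picard_limit (k : nat) (t : R) : R := real (Lim_seq (fun n => picard n k t)).

Lemma picard_limit_correct k t : is_lim_seq (fun n => picard n k t) (picard_limit k t).
Proof.
apply Lim_seq_correct'. apply ex_lim_seq_cauchy_corr. intros e.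
set (T := Rabs t). set (C := 2 * (A k * exp (rate T * Rabs t))).
assert (HC : 0 <= C).
{ assert (H := A_ge0 k). assert (H1 := exp_pos (rate T * Rabs t)). unfold C; nra. }
destruct (half_pow_small C (e / 2)) as [N HN]; [exact HC | apply is_pos_div_2 |].
assert (Hd : forall n, (N <= n)%nat -> Rabs (picard n k t - picard N k t) < e / 2).
{ intros n Hn. replace n with (N + (n - N))%nat by lia.
  eapply Rle_lt_trans; [apply (picard_cauchy T); apply Rle_refl|].
  eapply Rle_lt_trans; [|apply (HN N (le_n N))].
  unfold C. assert (H : 0 < (1 / 2) ^ (N + (n - N))) by (apply pow_lt; lra).
  assert (H1 := A_ge0 k). assert (H2 := exp_pos (rate T * Rabs t)).
  assert (0 <= A k * exp (rate T * Rabs t)) by nra. nra. }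
exists N. intros n p Hn Hp. assert (H1 := Hd n Hn). assert (H2 := Hd p Hp).
apply Rabs_def2 in H1, H2. apply Rabs_def1; lra.
Qed.

Lemma Rabs_lim_le (f : nat -> R) (l c B : R) :
  is_lim_seq f l -> (forall n, Rabs (f n - c) <= B) -> Rabs (l - c) <= B.
Proof.
intros Hf H.
apply (is_lim_seq_le (fun n => Rabs (f n - c)) (fun _ => B) (Rabs (l - c)) B H).
- apply (is_lim_seq_abs _ (l - c)).
  apply is_lim_seq_minus'; [exact Hf | apply is_lim_seq_const].
- apply is_lim_seq_const.
Qed.

Lemma picard_limit_close T n k t : Rabs t <= T ->
  Rabs (picard_limit k t - picard n k t) <=
  A k * ((2 * (1 / 2) ^ n) * exp (rate T * Rabs t)).
Proof.
intros Ht. apply Rabs_lim_le with (fun p => picard (p + n) k t).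
- apply (is_lim_seq_incr_n (fun p => picard p k t) n), picard_limit_correct.
- intros p. rewrite Nat.add_comm. eapply Rle_trans; [now apply (picard_cauchy T)|].
  apply Rmult_le_compat_l; [apply A_ge0|].
  apply Rmult_le_compat_r; [left; apply exp_pos|].
  assert (0 < (1 / 2) ^ (n + p)) by (apply pow_lt; lra). lra.
Qed.

Lemma picard_limit_admissible : admissible picard_limit.
Proof.
split.
- intros k t. apply (filterlim_R_spec (locally t)). intros e He.
  set (T := Rabs t + 1).
  set (C := 2 * (A k * exp (rate T * T))).
  assert (Hrate := rate_bounds T).
  assert (HC : 0 <= C).
  { assert (H := A_ge0 k). assert (H1 := exp_pos (rate T * T)). unfold C; nra. }
  destruct (half_pow_small C (e / 3)) as [N HN]; [exact HC | lra |].
  specialize (HN N (le_n N)).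
  assert (Hclose : forall x, Rabs x <= T -> Rabs (picard_limit k x - picard N k x) < e / 3).
  { intros x Hx. eapply Rle_lt_trans; [now apply (picard_limit_close T)|].
    eapply Rle_lt_trans; [|exact HN]. unfold C.
    replace (A k * (2 * (1 / 2) ^ N * exp (rate T * Rabs x))) with
      ((1 / 2) ^ N * (2 * (A k * exp (rate T * Rabs x)))) by ring.
    apply Rmult_le_compat_l; [apply pow_le; lra|].
    apply Rmult_le_compat_l; [lra|]. apply Rmult_le_compat_l; [apply A_ge0|].
    apply exp_le. apply Rmult_le_compat_l; lra. }
  destruct (picard_admissible N) as [Hcont _].
  destruct (proj1 (filterlim_R_spec (locally t) _ _) (Hcont k t) (e / 3)) as [d Hd]; [lra|].
  exists (mkposreal (Rmin d 1) (Rmin_pos _ _ (cond_pos d) Rlt_0_1)).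
  intros x Hx. change (Rabs (x - t) < Rmin d 1) in Hx.
  assert (Hx1 := Rlt_le_trans _ _ _ Hx (Rmin_l _ _)).
  assert (Hx2 := Rlt_le_trans _ _ _ Hx (Rmin_r _ _)).
  assert (HxT : Rabs x <= T).
  { unfold T. assert (H := Rabs_triang_inv x t). lra. }
  assert (H1 := Hclose x HxT). assert (H2 := Hclose t ltac:(unfold T; lra)).
  specialize (Hd x Hx1). apply Rabs_def2 in H1, H2, Hd. apply Rabs_def1; lra.
- intros k t. rewrite <- (Rminus_0_r (picard_limit k t)).
  apply Rabs_lim_le with (fun n => picard n k t); [apply picard_limit_correct|].
  intros n. rewrite Rminus_0_r. apply picard_admissible.
Qed.

Lemma picard_limit_fixed k t : duhamel picard_limit k t = picard_limit k t.
Proof.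
set (T := Rabs t). set (C := 2 * (A k * exp (rate T * Rabs t))).
assert (HC : 0 <= C).
{ assert (H := A_ge0 k). assert (H1 := exp_pos (rate T * Rabs t)). unfold C; nra. }
apply cond_eq. intros e He.
destruct (half_pow_small C e) as [n Hn]; [exact HC | exact He |].
specialize (Hn n (le_n n)). eapply Rle_lt_trans; [|exact Hn].
assert (H1 := picard_limit_close T (S n) k t (Rle_refl _)).
assert (H2 := duhamel_contraction picard_limit (picard n) T (2 * (1 / 2) ^ n) t
  picard_limit_admissible (picard_admissible n)).
assert (H3 : 0 < (1 / 2) ^ n) by (apply pow_lt; lra).
specialize (H2 ltac:(lra) (Rle_refl _) (fun k x Hx => picard_limit_close T n k x Hx) k).
change (duhamel (picard n) k t) with (picard (S n) k t) in H2.
replace (duhamel picard_limit k t - picard_limit k t) with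
  ((duhamel picard_limit k t - picard (S n) k t) - (picard_limit k t - picard (S n) k t)) by ring.
eapply Rle_trans; [apply Rabs_sub_le; eassumption|].
unfold C. simpl pow. right; field.
Qed.

(** Rotating back from the amplitudes gives a solution of the mode equations. *)
Lemma picard_solution :
  exists u v : nat -> R -> R,
    (forall k t, is_derive (u k) t (v k t)) /\
    (forall k t, is_derive (v k) t
       (- om k ^ 2 * u k t - cut u t * (g k * om k) * u k t)) /\
    (forall k, u k 0 = u0 k) /\ (forall k, v k 0 = v0 k) /\
    (forall t, ex_series (fun k => (freq k * u k t) ^ 2)) /\
    (forall t, 0 <= cut u t <= M).
Proof.
set (u := picard_limit). assert (Hu : admissible u) by exact picard_limit_admissible.
exists u, (fun k t => om k *
  (cos (om k * t) * sin_part u k t - sin (om k * t) * cos_part u k t)).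
assert (Dcos : forall k t, is_derive (fun r => cos (om k * r)) t (- om k * sin (om k * t))) by
  (intros k t; auto_derive; [easy | ring]).
assert (Dsin : forall k t, is_derive (fun r => sin (om k * r)) t (om k * cos (om k * t))) by
  (intros k t; auto_derive; [easy | ring]).
assert (Hpt : forall k t, 1 = cos (om k * t) ^ 2 + sin (om k * t) ^ 2).
{ intros k t. assert (H := sin2_cos2 (om k * t)). unfold Rsqr in H. simpl; lra. }
split; [|split; [|split; [|split; [|split]]]].
- intros k t. apply (is_derive_ext (duhamel u k)); [apply picard_limit_fixed|].
  eapply is_derive_cast.
  + exact (is_derive_Rplus _ _ _ _ _
      (is_derive_Rmult _ _ _ _ _ (Dcos k t) (cos_part_derive u k t Hu))
      (is_derive_Rmult _ _ _ _ _ (Dsin k t) (sin_part_derive u k t Hu))).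
  + cbv beta. ring.
- intros k t. eapply is_derive_cast.
  + exact (is_derive_Rscal _ _ _ _ (is_derive_Rminus _ _ _ _ _
      (is_derive_Rmult _ _ _ _ _ (Dcos k t) (sin_part_derive u k t Hu))
      (is_derive_Rmult _ _ _ _ _ (Dsin k t) (cos_part_derive u k t Hu)))).
  + cbv beta. assert (E : cos (om k * t) * cos_part u k t + sin (om k * t) * sin_part u k t = u k t)
      by exact (picard_limit_fixed k t).
    replace (- om k ^ 2 * u k t) with (- om k ^ 2 *
      (cos (om k * t) * cos_part u k t + sin (om k * t) * sin_part u k t)) by now rewrite E.
    replace (cut u t * (g k * om k) * u k t) with
      (cut u t * (g k * om k) * u k t * (cos (om k * t) ^ 2 + sin (om k * t) ^ 2))
      by (rewrite <- Hpt; ring).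
    ring.
- intros k. rewrite <- (picard_limit_fixed k 0 : duhamel u k 0 = u k 0).
  unfold duhamel, cos_part. rewrite RInt_point, Rmult_0_r, cos_0, sin_0.
  change (@zero R_CompleteNormedModule) with 0. ring.
- intros k. assert (H := Hom k).
  unfold sin_part. rewrite RInt_point, Rmult_0_r, cos_0, sin_0.
  change (@zero R_CompleteNormedModule) with 0. field; lra.
- intros t. now apply admissible_sum.
- intros t. now apply cut_bounds.
Qed.
End Picard.

(** * Energy and global existence *)

Section Energy.
Variables (m M : R) (u v : nat -> R -> R).
Hypothesis (Hm_lo : - (1 / 2) <= m) (Hm_hi : m <= 1) (HM : 0 < M).
Hypothesis (Hu : forall k t, is_derive (u k) t (v k t)).
Hypothesis (Hv : forall k t, is_derive (v k) t
  (- om m k ^ 2 * u k t - cut M u t * (gain m k * om m k) * u k t)).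
Hypothesis (Hsum : forall t, ex_series (fun k => (freq k * u k t) ^ 2)).
Hypothesis (Hcut : forall t, 0 <= cut M u t <= M).

Definition mode_energy (k : nat) (t : R) : R :=
  freq k ^ 2 * u k t ^ 2 + freq k ^ 2 * v k t ^ 2 / om m k ^ 2.

Lemma mode_energy_ge0 k t : 0 <= mode_energy k t.
Proof.
assert (H : 0 < om m k) by (apply om_pos; lra). assert (Hf := freq_pow_ge1 k 2).
apply Rplus_le_le_0_compat.
- apply Rmult_le_pos; [lra | apply pow2_ge_0].
- apply Rmult_le_pos; [apply Rmult_le_pos; [lra | apply pow2_ge_0]|].
  left; apply Rinv_0_lt_compat. nra.
Qed.

Lemma mode_energy_growth k t :
  mode_energy k t <= mode_energy k 0 * exp (3 / 2 * M * Rabs t).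
Proof.
assert (H : 0 < om m k) by (apply om_pos; lra).
assert (E : forall s, mode_energy k s =
  freq k * u k s * (freq k * u k s) + / om m k * freq k * v k s * (/ om m k * freq k * v k s)).
{ intros s. unfold mode_energy. field; lra. }
rewrite !E.
apply (mode_growth m (fun k s => freq k * u k s) (fun k s => / om m k * freq k * v k s)
  (cut M u) t Hm_lo) with (K := M).
- intros s _ j. assert (Hj : 0 < om m j) by (apply om_pos; lra).
  eapply is_derive_cast; [apply is_derive_Rscal, Hu | field; lra].
- intros s _ j. assert (Hj : 0 < om m j) by (apply om_pos; lra).
  eapply is_derive_cast; [apply is_derive_Rscal, Hv | field; lra].
- apply seg_end.
- intros s _. rewrite Rabs_pos_eq; apply Hcut.
Qed.

Lemma om_sqr_bounds k : freq k ^ 2 / 2 <= om m k ^ 2 <= 2 * freq k ^ 4.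
Proof.
rewrite om_sqr by lra. assert (H := freq_pow_ge1 k 2).
replace (freq k ^ 4) with (freq k ^ 2 * freq k ^ 2) by ring. split; nra.
Qed.

Lemma om_le k : om m k <= 2 * freq k ^ 2.
Proof.
assert (H := om_sqr_bounds k). assert (H1 := freq_pow_ge1 k 2).
apply Rsqr_incr_0_var; [|lra]. rewrite !Rsqr_pow2, Rpow_mult_distr.
replace ((freq k ^ 2) ^ 2) with (freq k ^ 4) by ring.
lra.
Qed.

Lemma kinetic_le k t :
  / 2 * (v k t ^ 2 + om m k ^ 2 * u k t ^ 2) <= freq k ^ 2 * mode_energy k t.
Proof.
assert (H : 0 < om m k) by (apply om_pos; lra). assert (Hb := om_sqr_bounds k).
assert (Hf := freq_ge1 k). assert (He := mode_energy_ge0 k t).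
replace (/ 2 * (v k t ^ 2 + om m k ^ 2 * u k t ^ 2)) with
  (om m k ^ 2 / (2 * freq k ^ 2) * mode_energy k t)
  by (unfold mode_energy; field; lra).
apply Rmult_le_compat_r; [exact He|].
apply (proj2 (Rle_div_l (om m k ^ 2) (freq k ^ 2) (2 * freq k ^ 2) ltac:(nra))).
replace (freq k ^ 2 * (2 * freq k ^ 2)) with (2 * freq k ^ 4) by ring. lra.
Qed.

Lemma power_le k t : Rabs (freq k ^ 2 * (u k t * v k t)) <= freq k ^ 2 * mode_energy k t.
Proof.
assert (H : 0 < om m k) by (apply om_pos; lra). assert (Hb := om_le k).
set (X := freq k * u k t). set (Y := freq k * v k t / om m k).
assert (EM : mode_energy k t = X ^ 2 + Y ^ 2) by (unfold mode_energy, X, Y; field; lra).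
replace (freq k ^ 2 * (u k t * v k t)) with (om m k * (X * Y)) by (unfold X, Y; field; lra).
rewrite Rabs_mult, (Rabs_pos_eq (om m k)) by lra.
assert (HXY : Rabs (X * Y) <= / 2 * mode_energy k t).
{ rewrite EM. assert (H1 := Rle_0_sqr (X - Y)). assert (H2 := Rle_0_sqr (X + Y)).
  unfold Rsqr in *. apply Rabs_le; lra. }
apply Rle_trans with (2 * freq k ^ 2 * (/ 2 * mode_energy k t)).
- apply Rmult_le_compat; auto using Rabs_pos; lra.
- right; field.
Qed.

Hypothesis (Hq : ex_series (fun k => freq k ^ 2 * mode_energy k 0)).

Lemma weighted_growth k s t : Rabs (s - t) < 1 ->
  freq k ^ 2 * mode_energy k s <=
  exp (3 / 2 * M * (Rabs t + 1)) * (freq k ^ 2 * mode_energy k 0).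
Proof.
intros Hs. assert (Hf := freq_pow_ge1 k 2).
assert (H := mode_energy_growth k s). assert (H0 := mode_energy_ge0 k 0).
assert (He : exp (3 / 2 * M * Rabs s) <= exp (3 / 2 * M * (Rabs t + 1))).
{ apply exp_le. assert (H1 := Rabs_triang_inv s t). apply Rmult_le_compat_l; lra. }
replace (exp (3 / 2 * M * (Rabs t + 1)) * (freq k ^ 2 * mode_energy k 0)) with
  (freq k ^ 2 * (mode_energy k 0 * exp (3 / 2 * M * (Rabs t + 1)))) by ring.
apply Rmult_le_compat_l; [lra|]. eapply Rle_trans; [exact H|].
apply Rmult_le_compat_l; lra.
Qed.

Lemma ex_series_weighted t : ex_series (fun k => freq k ^ 2 * mode_energy k t).
Proof.
eapply ex_series_dominated; [|exact (ex_series_Rscal (exp (3 / 2 * M * (Rabs t + 1))) _ Hq)].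
intros k; cbv beta. rewrite Rabs_pos_eq.
- apply weighted_growth. rewrite Rminus_eq_0, Rabs_R0; lra.
- apply Rmult_le_pos; [assert (H := freq_pow_ge1 k 2); lra | apply mode_energy_ge0].
Qed.

Definition kinetic (t : R) : R := Series (fun k => / 2 * (v k t ^ 2 + om m k ^ 2 * u k t ^ 2)).
(** The coupling energy of the capped system: its derivative in the stretch is the
    capped coupling. *)
Definition potential (x : R) : R := RInt (Rmin M) 0 x.

Lemma ex_series_kinetic t :
  ex_series (fun k => / 2 * (v k t ^ 2 + om m k ^ 2 * u k t ^ 2)).
Proof.
eapply ex_series_dominated; [|exact (ex_series_weighted t)].
intros k; cbv beta. rewrite Rabs_pos_eq; [apply kinetic_le|].
nra.
Qed.

Lemma kinetic_derive t :
  is_derive kinetic t (- cut M u t * Series (fun k => freq k ^ 2 * (u k t * v k t))).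
Proof.
assert (Hg : forall k, gain m k * om m k = freq k ^ 2) by
  (intros k; rewrite Rmult_comm; apply om_gain; lra).
eapply is_derive_cast.
- apply (Series_derive (fun k s => / 2 * (v k s ^ 2 + om m k ^ 2 * u k s ^ 2))
    (fun k s => - cut M u s * (freq k ^ 2 * (u k s * v k s)))
    (fun k => M * (exp (3 / 2 * M * (Rabs t + 1)) * (freq k ^ 2 * mode_energy k 0))) t 1).
  + lra.
  + now apply ex_series_Rscal, ex_series_Rscal.
  + intros k s _.
    apply (is_derive_ext (fun r => / 2 * (v k r * v k r + om m k ^ 2 * (u k r * u k r)))).
    { intros r; simpl; ring. }
    assert (H1 := fun k => Hu k s). assert (H2 := fun k => Hv k s).
    eapply is_derive_cast; [derive_poly | rewrite Hg; field].
  + intros k s Hs. rewrite Rabs_mult, Rabs_Ropp, (Rabs_pos_eq (cut M u s)) by apply Hcut.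
    apply Rmult_le_compat; [apply Hcut | apply Rabs_pos | apply Hcut |].
    eapply Rle_trans; [apply power_le | now apply weighted_growth].
  + intros s _. apply ex_series_kinetic.
- apply Series_scal_l.
Qed.

Lemma stretch_derive t :
  is_derive (stretch u) t (coupling * (2 * Series (fun k => freq k ^ 2 * (u k t * v k t)))).
Proof.
apply is_derive_Rscal. rewrite <- Series_scal_l.
apply (Series_derive (fun k s => (freq k * u k s) ^ 2)
  (fun k s => 2 * (freq k ^ 2 * (u k s * v k s)))
  (fun k => 2 * (exp (3 / 2 * M * (Rabs t + 1)) * (freq k ^ 2 * mode_energy k 0))) t 1).
- lra.
- now apply ex_series_Rscal, ex_series_Rscal.
- intros k s _.
  apply (is_derive_ext (fun r => freq k ^ 2 * (u k r * u k r))); [intros r; simpl; ring|].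
  assert (H1 := fun k => Hu k s).
  eapply is_derive_cast; [derive_poly | ring].
- intros k s Hs. rewrite Rabs_mult, (Rabs_pos_eq 2) by lra.
  apply Rmult_le_compat_l; [lra|].
  eapply Rle_trans; [apply power_le | now apply weighted_growth].
- intros s _. apply Hsum.
Qed.

Lemma potential_derive x : is_derive potential x (Rmin M x).
Proof.
apply (primitive_derive (Rmin M) 0 x). intros y.
apply (continuous_Rmin M (fun z => z)), continuous_id.
Qed.

Lemma potential_bounds x : 0 <= x -> 0 <= potential x <= x * x.
Proof.
intros Hx.
assert (C : forall y, continuous (Rmin M) y) by
  (intros y; apply (continuous_Rmin M (fun z => z)), continuous_id).
assert (Hpos : forall y, 0 <= y -> 0 <= Rmin M y) by (intros y Hy; apply Rmin_glb; lra).
split.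
- apply RInt_ge_0; [exact Hx | now apply ex_RInt_cont | intros y Hy; apply Hpos; lra].
- eapply Rle_trans; [apply Rle_abs|].
  replace (x * x) with ((x - 0) * x) by ring.
  apply abs_RInt_le_const; [exact Hx | now apply ex_RInt_cont|].
  intros y Hy. rewrite Rabs_pos_eq by (apply Hpos; lra).
  eapply Rle_trans; [apply Rmin_r | lra].
Qed.

Lemma energy_conserved t :
  kinetic t + PI * potential (stretch u t) = kinetic 0 + PI * potential (stretch u 0).
Proof.
destruct (MVT_seg (fun s => kinetic s + PI * potential (stretch u s)) (fun _ => 0) t)
  as [s [_ E]]; [|lra].
intros s _.
eapply is_derive_cast.
- apply is_derive_Rplus; [apply kinetic_derive|].
  apply is_derive_Rscal.
  apply (is_derive_comp potential (stretch u)); [apply potential_derive | apply stretch_derive].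
- unfold scal; simpl; unfold mult; simpl.
  change (Rmin M (stretch u s)) with (cut M u s).
  assert (HP := PI_RGT_0). unfold coupling. field; lra.
Qed.

Lemma stretch_ge0 t : 0 <= stretch u t.
Proof.
apply Rmult_le_pos; [left; apply coupling_bounds|].
apply Series_ge0; [intros; apply pow2_ge_0 | apply Hsum].
Qed.

Lemma stretch_le_kinetic t : stretch u t <= 4 * coupling * kinetic t.
Proof.
unfold stretch, kinetic. rewrite (Rmult_comm 4), Rmult_assoc, <- (Series_scal_l 4).
apply Rmult_le_compat_l; [left; apply coupling_bounds|].
apply Series_le; [|apply ex_series_Rscal, ex_series_kinetic].
intros k. split; [apply pow2_ge_0|]. assert (H := om_sqr_bounds k).
rewrite Rpow_mult_distr. nra.
Qed.

(** The right-hand side involves only the initial data, not the cap M. *)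
Lemma stretch_le t :
  stretch u t <= 4 * coupling * (kinetic 0 + PI * (stretch u 0 * stretch u 0)).
Proof.
eapply Rle_trans; [apply stretch_le_kinetic|].
assert (Hc := coupling_bounds). assert (HP := PI_RGT_0).
apply Rmult_le_compat_l; [lra|].
assert (E := energy_conserved t).
assert (H1 := potential_bounds _ (stretch_ge0 t)).
assert (H2 := potential_bounds _ (stretch_ge0 0)). nra.
Qed.
End Energy.

(** The cap is chosen above the energy bound of [stretch_le], hence never reached. *)
Theorem mode_global_solution (m s : R) (u0 v0 : nat -> R) :
  - (1 / 2) <= m -> m <= 1 -> 1 / 2 < s -> in_H (s + 2) u0 -> in_H s v0 ->
  exists (M : R) (u v : nat -> R -> R),
    0 < M /\
    (forall k t, is_derive (u k) t (v k t)) /\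
    (forall k t, is_derive (v k) t
       (- om m k ^ 2 * u k t - stretch u t * freq k ^ 2 * u k t)) /\
    (forall k, u k 0 = u0 k) /\ (forall k, v k 0 = v0 k) /\
    (forall t, 0 <= stretch u t <= M) /\
    (forall k t, mode_energy m u v k t <=
       (freq k ^ 2 * u0 k ^ 2 + freq k ^ 2 * v0 k ^ 2 / om m k ^ 2) *
       exp (3 / 2 * M * Rabs t)) /\
    (forall t, continuous (stretch u) t).
Proof.
intros Hm_lo Hm_hi Hs Hu0 Hv0.
set (K0 := Series (fun k => / 2 * (v0 k ^ 2 + om m k ^ 2 * u0 k ^ 2))).
set (S0 := coupling * Series (fun k => (freq k * u0 k) ^ 2)).
assert (Hq : ex_series (fun k => freq k ^ 2 * (freq k ^ 2 * u0 k ^ 2 +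
  freq k ^ 2 * v0 k ^ 2 / om m k ^ 2))).
{ assert (H2 : in_H 2 u0) by (apply (in_H_weaken (s + 2)); [lra | exact Hu0]).
  assert (H0 : in_H 0 v0) by (apply (in_H_weaken s); [lra | exact Hv0]).
  eapply ex_series_dominated; [|exact (ex_series_Rplus _ _ H2 (ex_series_Rscal 2 _ (in_H_0_sum _ H0)))].
  intros k; cbv beta.
  assert (Hf := freq_pow_ge1 k 2). assert (Ho : 0 < om m k) by (apply om_pos; lra).
  assert (E4 : Rpower (freq k) (2 * 2) = freq k ^ 2 * freq k ^ 2).
  { replace (2 * 2) with (2 + 2) by ring. now rewrite Rpower_plus, Rpower_two. }
  assert (Hr : freq k ^ 2 * freq k ^ 2 / om m k ^ 2 <= 2).
  { apply (proj2 (Rle_div_l _ _ (om m k ^ 2) ltac:(nra))). rewrite om_sqr by lra. nra. }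
  assert (Hr0 : 0 <= freq k ^ 2 * freq k ^ 2 / om m k ^ 2).
  { apply Rmult_le_pos; [nra | left; apply Rinv_0_lt_compat; nra]. }
  rewrite E4.
  replace (freq k ^ 2 * (freq k ^ 2 * u0 k ^ 2 + freq k ^ 2 * v0 k ^ 2 / om m k ^ 2)) with
    (u0 k ^ 2 * (freq k ^ 2 * freq k ^ 2) +
     freq k ^ 2 * freq k ^ 2 / om m k ^ 2 * v0 k ^ 2) by (field; lra).
  rewrite Rabs_pos_eq; nra. }
set (M := Rmax 0 (4 * coupling * (K0 + PI * (S0 * S0))) + 1).
assert (HM : 0 < M) by (unfold M; assert (H := Rmax_l 0 (4 * coupling * (K0 + PI * (S0 * S0)))); lra).
destruct (picard_solution (om m) (gain m) (fun k => Rabs (u0 k) + Rabs (v0 k / om m k)) u0 v0 M)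
  as [u [v [Hu [Hv [Eu [Ev [Hsum Hcut]]]]]]].
- intros k; apply om_pos; lra.
- intros k; split; [apply gain_pos | apply gain_le]; lra.
- exact HM.
- intros k; apply Rle_refl.
- eapply ex_series_dominated; [|exact (ex_series_Rscal 2 _ Hq)].
  intros k; cbv beta. rewrite Rabs_pos_eq by apply pow2_ge_0.
  assert (Ho : 0 < om m k) by (apply om_pos; lra). assert (Hf := freq_pow_ge1 k 2).
  replace (freq k ^ 2 * v0 k ^ 2 / om m k ^ 2) with (freq k ^ 2 * (v0 k / om m k) ^ 2) by (field; lra).
  rewrite <- (pow2_abs (u0 k)), <- (pow2_abs (v0 k / om m k)), Rpow_mult_distr.
  set (x := Rabs (u0 k)). set (y := Rabs (v0 k / om m k)).
  assert (Hxy := pow2_ge_0 (x - y)).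
  replace (2 * (freq k ^ 2 * (freq k ^ 2 * x ^ 2 + freq k ^ 2 * y ^ 2))) with
    (freq k ^ 2 * (freq k ^ 2 * (2 * x ^ 2 + 2 * y ^ 2))) by ring.
  apply Rmult_le_compat_l; [lra|].
  nra.
- assert (E0 : forall k, mode_energy m u v k 0 =
    freq k ^ 2 * u0 k ^ 2 + freq k ^ 2 * v0 k ^ 2 / om m k ^ 2).
  { intros k. unfold mode_energy. now rewrite Eu, Ev. }
  assert (Hq' : ex_series (fun k => freq k ^ 2 * mode_energy m u v k 0)).
  { apply (ex_series_ext_R _ _ (fun k => f_equal _ (eq_sym (E0 k))) Hq). }
  assert (Hst : forall t, 0 <= stretch u t <= M).
  { intros t. split; [now apply stretch_ge0|].
    eapply Rle_trans; [apply (stretch_le m M u v Hm_lo Hm_hi HM Hu Hv Hsum Hcut Hq' t)|].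
    unfold M. eapply Rle_trans; [|apply Rlt_le, Rlt_plus_1].
    eapply Rle_trans; [|apply Rmax_r]. right.
    unfold kinetic, stretch, K0, S0. do 2 f_equal.
    + apply Series_ext. intros k. now rewrite Eu, Ev.
    + f_equal. rewrite (Series_ext (fun k => (freq k * u k 0) ^ 2) (fun k => (freq k * u0 k) ^ 2));
        [reflexivity | intros k; now rewrite Eu]. }
  assert (Hcs : forall t, cut M u t = stretch u t).
  { intros t. unfold cut. apply Rmin_right. apply Hst. }
  exists M, u, v. split; [exact HM|]. split; [exact Hu|]. split.
  { intros k t. eapply is_derive_cast; [apply Hv|].
    rewrite Hcs, (Rmult_comm (gain m k)), om_gain by lra. ring. }
  split; [exact Eu|]. split; [exact Ev|]. split; [exact Hst|]. split.
  { intros k t. rewrite <- E0. now apply mode_energy_growth. }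
  intros t. eapply is_derive_continuous. now apply (stretch_derive m M u v).
Qed.

(** * The solution in Sobolev norms *)

Lemma H_norm_limit (F : (R -> Prop) -> Prop) {FF : ProperFilter F}
    (r : R) (d : R -> nat -> R) (a : nat -> R) :
  ex_series a ->
  F (fun x => forall k, d x k ^ 2 * Rpower (freq k) (2 * r) <= a k) ->
  (forall k, filterlim (fun x => d x k) F (locally 0)) ->
  filterlim (fun x => H_norm r (d x)) F (locally 0).
Proof.
intros Ha Hdom Hlim.
assert (H : filterlim (fun x => Series (fun k => d x k ^ 2 * Rpower (freq k) (2 * r))) F
  (locally (Series (fun _ => 0)))).
{ apply (Series_dominated_limit F (fun x k => d x k ^ 2 * Rpower (freq k) (2 * r)) (fun _ => 0) a Ha).
  - eapply filter_imp; [|exact Hdom]. intros x Hx k.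
    rewrite Rabs_pos_eq by apply (H_term_ge0 r (d x)). apply Hx.
  - intros k. apply (filterlim_R_spec F). intros e He.
    assert (Hp := Rpower_freq_pos k (2 * r)).
    assert (He' : 0 < sqrt (e / Rpower (freq k) (2 * r))) by
      (apply sqrt_lt_R0; now apply Rdiv_lt_0_compat).
    eapply filter_imp; [|exact (proj1 (filterlim_R_spec F _ _) (Hlim k) _ He')].
    intros x Hx; cbv beta in Hx. rewrite Rminus_0_r in *.
    rewrite Rabs_pos_eq by apply (H_term_ge0 r (d x)).
    apply (proj2 (Rlt_div_r (d x k ^ 2) e _ Hp)).
    rewrite <- (Rsqr_sqrt (e / Rpower (freq k) (2 * r))) by
      (left; now apply Rdiv_lt_0_compat).
    rewrite <- Rsqr_pow2. apply Rsqr_lt_abs_1.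
    now rewrite (Rabs_pos_eq (sqrt _)) by apply sqrt_pos. }
rewrite (Series_zero (fun _ => 0)) in H by easy.
apply (filterlim_R_spec F). intros e He.
assert (He2 : 0 < e * e) by nra.
eapply filter_imp; [|exact (proj1 (filterlim_R_spec F _ _) H _ He2)].
intros x Hx; cbv beta in Hx. rewrite Rminus_0_r in *. rewrite Rabs_pos_eq by apply H_norm_ge0.
unfold H_norm. rewrite <- (sqrt_square e) by lra.
destruct (Rle_dec 0 (Series (fun k => d x k ^ 2 * Rpower (freq k) (2 * r)))) as [H0 | H0].
- apply sqrt_lt_1_alt. split; [exact H0|].
  eapply Rle_lt_trans; [apply Rle_abs | exact Hx].
- rewrite sqrt_neg_0 by lra. rewrite sqrt_square; lra.
Qed.

(** Locally uniform domination of the terms of the norm; with it, convergence in the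
    norm reduces to convergence of the single coefficients. *)
Definition bounded_near (r : R) (w : R -> nat -> R) : Prop :=
  forall t, exists a, ex_series a /\
    forall x, Rabs (x - t) < 1 -> forall k, w x k ^ 2 * Rpower (freq k) (2 * r) <= a k.

Lemma sqr_minus_le x y p a : 0 <= p -> x ^ 2 * p <= a -> y ^ 2 * p <= a ->
  (x - y) ^ 2 * p <= 4 * a.
Proof.
intros Hp Hx Hy. assert (H := pow2_ge_0 (x + y)).
nra.
Qed.

Lemma near_self t : Rabs (t - t) < 1.
Proof. rewrite Rminus_eq_0, Rabs_R0; lra. Qed.

Lemma H_continuous_modes (r : R) (w : R -> nat -> R) :
  bounded_near r w -> (forall k t, continuous (fun x => w x k) t) ->
  H_continuous r m_infty p_infty w.
Proof.
intros Hb Hc t _. destruct (Hb t) as [a [Ha Hle]]. split.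
- eapply ex_series_dominated; [|exact Ha]. intros k.
  rewrite Rabs_pos_eq by apply (H_term_ge0 r (w t)). apply Hle, near_self.
- apply (H_norm_limit (Rbar_locally' t) r (fun x k => w x k - w t k) (fun k => 4 * a k)).
  + now apply ex_series_Rscal.
  + exists (mkposreal 1 Rlt_0_1). intros x Hx _ k.
    apply sqr_minus_le; [left; apply Rpower_freq_pos | now apply Hle | apply Hle, near_self].
  + intros k. apply (filterlim_R_spec (Rbar_locally' t)). intros e He.
    destruct (proj1 (filterlim_R_spec (locally t) _ _) (Hc k t) e He) as [d Hd].
    exists d. intros x Hx _. rewrite Rminus_0_r. now apply Hd.
Qed.

Lemma H_derivative_modes (r : R) (w dw : R -> nat -> R) :
  bounded_near r dw -> (forall k t, is_derive (fun x => w x k) t (dw t k)) ->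
  H_derivative r m_infty p_infty w dw.
Proof.
intros Hb Hd t _. destruct (Hb t) as [a [Ha Hle]].
apply (H_norm_limit (Rbar_locally' 0) r (fun h k => (w (t + h) k - w t k) / h - dw t k)
  (fun k => 4 * a k)).
- now apply ex_series_Rscal.
- exists (mkposreal 1 Rlt_0_1). intros h Hh Hh0 k.
  change (Rabs (h - 0) < 1) in Hh. rewrite Rminus_0_r in Hh.
  destruct (MVT_R (fun x => w x k) (fun x => dw x k) t (t + h)) as [x [Hx E]].
  + intros x _. apply Hd.
  + replace ((w (t + h) k - w t k) / h) with (dw x k) by (rewrite E; field; exact Hh0).
    assert (Hxt : Rabs (x - t) < 1).
    { apply Rabs_def2 in Hh. unfold Rmin, Rmax in Hx.
      destruct (Rle_dec t (t + h)); apply Rabs_def1; lra. }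
    apply sqr_minus_le; [left; apply Rpower_freq_pos | now apply Hle | apply Hle, near_self].
- intros k. apply (filterlim_R_spec (Rbar_locally' 0)). intros e He.
  destruct (proj1 (is_derive_Reals _ _ _) (Hd k t) e He) as [d Hd'].
  exists d. intros h Hh Hh0. rewrite Rminus_0_r. apply Hd'; [exact Hh0|].
  change (Rabs (h - 0) < d) in Hh. now rewrite Rminus_0_r in Hh.
Qed.

(** The growth estimate dominates u, its first and its second derivative by the terms
    of the norms of the initial data. *)
Theorem weak_solution_exists (m s : R) (u0 v0 : nat -> R) :
  - (1 / 2) <= m -> m <= 1 -> 1 / 2 < s -> in_H (s + 2) u0 -> in_H s v0 ->
  exists u, weak_solution m s m_infty p_infty u0 v0 u.
Proof.
intros Hm_lo Hm_hi Hs Hu0 Hv0.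
destruct (mode_global_solution m s u0 v0 Hm_lo Hm_hi Hs Hu0 Hv0)
  as [M [u [v [HM [Du [Dv [Eu [Ev [Hst [Hgrow Cst]]]]]]]]]].
set (q := fun k t => - om m k ^ 2 * u k t - stretch u t * freq k ^ 2 * u k t) in *.
set (n0 := fun k => freq k ^ 2 * u0 k ^ 2 + freq k ^ 2 * v0 k ^ 2 / om m k ^ 2) in *.
set (P := fun k => n0 k * Rpower (freq k) (2 * s + 2)).
assert (Cu : forall k t, continuous (u k) t).
{ intros k t. eapply is_derive_continuous, Du. }
assert (Cv : forall k t, continuous (v k) t).
{ intros k t. eapply is_derive_continuous, Dv. }
assert (Hom : forall k, 0 < om m k) by (intros; apply om_pos; lra).
assert (Hom2 := om_sqr_bounds m Hm_lo Hm_hi).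
assert (Hf := fun k => freq_pow_ge1 k 2).
assert (Hpow : forall k p, Rpower (freq k) (p + 2) = freq k ^ 2 * Rpower (freq k) p).
{ intros k p. rewrite Rpower_plus, Rpower_two. ring. }
assert (HP : ex_series P).
{ eapply ex_series_dominated; [|exact (ex_series_Rplus _ _ Hu0 (ex_series_Rscal 2 _ Hv0))].
  intros k; cbv beta. assert (Hr := Rpower_freq_pos k (2 * s)).
  assert (Hu := pow2_ge_0 (u0 k)). assert (Hv := pow2_ge_0 (v0 k)).
  assert (Hr2 : 0 <= freq k ^ 2 * freq k ^ 2 / om m k ^ 2 <= 2).
  { specialize (Hf k). specialize (Hom k). assert (Ho2 : 0 < om m k ^ 2) by nra. split.
    - apply Rmult_le_pos; [nra | left; now apply Rinv_0_lt_compat].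
    - apply (proj2 (Rle_div_l _ _ _ Ho2)). rewrite om_sqr by lra. nra. }
  replace (2 * (s + 2)) with (2 * s + 2 + 2) by ring.
  unfold P, n0. rewrite !Hpow.
  replace ((freq k ^ 2 * u0 k ^ 2 + freq k ^ 2 * v0 k ^ 2 / om m k ^ 2) *
    (freq k ^ 2 * Rpower (freq k) (2 * s))) with
    (u0 k ^ 2 * (freq k ^ 2 * (freq k ^ 2 * Rpower (freq k) (2 * s))) +
     freq k ^ 2 * freq k ^ 2 / om m k ^ 2 * (v0 k ^ 2 * Rpower (freq k) (2 * s)))
    by (specialize (Hom k); field; lra).
  assert (Hvr : 0 <= v0 k ^ 2 * Rpower (freq k) (2 * s)) by (apply Rmult_le_pos; lra).
  rewrite Rabs_pos_eq.
  - apply Rplus_le_compat_l, Rmult_le_compat_r; lra.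
  - specialize (Hf k). apply Rplus_le_le_0_compat; apply Rmult_le_pos.
    + exact Hu.
    + apply Rmult_le_pos; [lra|]. apply Rmult_le_pos; lra.
    + apply Hr2.
    + exact Hvr. }
assert (Hloc : forall t x k, Rabs (x - t) < 1 ->
  mode_energy m u v k x * Rpower (freq k) (2 * s + 2) <=
  exp (3 / 2 * M * (Rabs t + 1)) * P k).
{ intros t x k Hx. unfold P.
  assert (Hn0 : 0 <= n0 k).
  { specialize (Hf k). specialize (Hom k). unfold n0. apply Rplus_le_le_0_compat.
    - apply Rmult_le_pos; [lra | apply pow2_ge_0].
    - apply Rmult_le_pos; [apply Rmult_le_pos; [lra | apply pow2_ge_0]|].
      left; apply Rinv_0_lt_compat; nra. }
  replace (exp (3 / 2 * M * (Rabs t + 1)) * (n0 k * Rpower (freq k) (2 * s + 2))) with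
    (n0 k * exp (3 / 2 * M * (Rabs t + 1)) * Rpower (freq k) (2 * s + 2)) by ring.
  apply Rmult_le_compat_r; [left; apply Rpower_freq_pos|].
  eapply Rle_trans; [apply Hgrow|]. apply Rmult_le_compat_l; [exact Hn0|].
  apply exp_le. assert (H := Rabs_triang_inv x t). apply Rmult_le_compat_l; lra. }
assert (Hscale : forall w r C, 0 <= C ->
  (forall x k, w x k ^ 2 * Rpower (freq k) (2 * r) <=
     C * (mode_energy m u v k x * Rpower (freq k) (2 * s + 2))) -> bounded_near r w).
{ intros w r C HC H t.
  exists (fun k => C * (exp (3 / 2 * M * (Rabs t + 1)) * P k)). split.
  - now apply ex_series_Rscal, ex_series_Rscal.
  - intros x Hx k. eapply Rle_trans; [apply H|].
    apply Rmult_le_compat_l; [exact HC | now apply Hloc]. }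
assert (Hu_le : forall x k, freq k ^ 2 * u k x ^ 2 <= mode_energy m u v k x).
{ intros x k. specialize (Hf k). specialize (Hom k). unfold mode_energy.
  assert (0 <= freq k ^ 2 * v k x ^ 2 / om m k ^ 2); [|lra].
  apply Rmult_le_pos; [apply Rmult_le_pos; [lra | apply pow2_ge_0]|].
  left; apply Rinv_0_lt_compat; nra. }
assert (Bu : bounded_near (s + 2) (fun t k => u k t)).
{ apply (Hscale _ _ 1 Rle_0_1). intros x k.
  replace (2 * (s + 2)) with (2 * s + 2 + 2) by ring.
  rewrite (Hpow k (2 * s + 2)), Rmult_1_l, <- Rmult_assoc.
  apply Rmult_le_compat_r; [left; apply Rpower_freq_pos|].
  specialize (Hu_le x k). lra. }
assert (Bv : bounded_near s (fun t k => v k t)).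
{ apply (Hscale _ _ 2 ltac:(lra)). intros x k. rewrite Hpow.
  assert (H := kinetic_le m u v Hm_lo Hm_hi k x). specialize (Hf k).
  assert (0 <= om m k ^ 2 * u k x ^ 2) by (apply Rmult_le_pos; apply pow2_ge_0).
  replace (2 * (mode_energy m u v k x * (freq k ^ 2 * Rpower (freq k) (2 * s)))) with
    (2 * (freq k ^ 2 * mode_energy m u v k x) * Rpower (freq k) (2 * s)) by ring.
  apply Rmult_le_compat_r; [left; apply Rpower_freq_pos | lra]. }
assert (Bq : bounded_near (s - 2) (fun t k => q k t)).
{ apply (Hscale _ _ ((2 + M) ^ 2) (pow2_ge_0 _)). intros x k.
  assert (Hq : q k x ^ 2 <= (2 + M) ^ 2 * (freq k ^ 2 * freq k ^ 2 * (freq k ^ 2 * freq k ^ 2)) * u k x ^ 2).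
  { unfold q. specialize (Hom2 k). specialize (Hst x). specialize (Hf k).
    replace (- om m k ^ 2 * u k x - stretch u x * freq k ^ 2 * u k x) with
      (- ((om m k ^ 2 + stretch u x * freq k ^ 2) * u k x)) by ring.
    replace ((- ((om m k ^ 2 + stretch u x * freq k ^ 2) * u k x)) ^ 2) with
      ((om m k ^ 2 + stretch u x * freq k ^ 2) ^ 2 * u k x ^ 2) by ring.
    replace ((2 + M) ^ 2 * (freq k ^ 2 * freq k ^ 2 * (freq k ^ 2 * freq k ^ 2))) with
      (((2 + M) * (freq k ^ 2 * freq k ^ 2)) ^ 2) by ring.
    apply Rmult_le_compat_r; [apply pow2_ge_0|]. apply pow_incr.
    replace (freq k ^ 4) with (freq k ^ 2 * freq k ^ 2) in Hom2 by ring.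
    split; [nra|].
    assert (stretch u x * freq k ^ 2 <= M * (freq k ^ 2 * freq k ^ 2)); [|lra].
    apply Rmult_le_compat; nra. }
  replace (2 * s + 2) with (2 * (s - 2) + 2 + 2 + 2) by ring. rewrite !Hpow.
  replace ((2 + M) ^ 2 * (mode_energy m u v k x * (freq k ^ 2 * (freq k ^ 2 *
    (freq k ^ 2 * Rpower (freq k) (2 * (s - 2))))))) with
    ((2 + M) ^ 2 * (freq k ^ 2 * freq k ^ 2 * freq k ^ 2) * mode_energy m u v k x *
     Rpower (freq k) (2 * (s - 2))) by ring.
  apply Rmult_le_compat_r; [left; apply Rpower_freq_pos|].
  eapply Rle_trans; [exact Hq|].
  replace ((2 + M) ^ 2 * (freq k ^ 2 * freq k ^ 2 * (freq k ^ 2 * freq k ^ 2)) * u k x ^ 2) with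
    ((2 + M) ^ 2 * (freq k ^ 2 * freq k ^ 2 * freq k ^ 2) * (freq k ^ 2 * u k x ^ 2)) by ring.
  apply Rmult_le_compat_l; [|apply Hu_le].
  apply Rmult_le_pos; [apply pow2_ge_0|]. specialize (Hf k).
  apply Rmult_le_pos; [apply Rmult_le_pos|]; lra. }
assert (Hsum : forall t, ex_series (fun k => Rabs (u k t) * freq k ^ 2)).
{ intros t. apply (summable_freq2 s Hs (fun k => u k t)).
  apply (H_continuous_modes (s + 2) (fun t k => u k t) Bu); [auto | split; exact I]. }
exists (fun t k => u k t). split; [split; exact I|].
exists (fun t k => v k t), (fun t k => q k t).
split; [now apply H_continuous_modes|].
split; [now apply H_derivative_modes|].
split; [now apply H_continuous_modes|].
split; [now apply H_derivative_modes|].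
split.
{ apply H_continuous_modes; [exact Bq|]. intros k t. unfold q.
  apply continuous_Rminus; apply continuous_Rmult; auto using continuous_const.
  apply continuous_Rmult; auto using continuous_const. }
split; [exact Eu|]. split; [exact Ev|]. split.
- intros t _. assert (H2 := Hsum t).
  unfold hinged. rewrite !fun_of_Derive2 by exact H2.
  repeat split; first [apply sine_series_0 | apply sine_series_PI].
- intros eta t Heta _.
  assert (H2 := Hsum t). assert (H1 := summable_lower _ 1 H2).
  assert (Hqs : ex_series (fun k => Rabs (q k t / freq k ^ 2))).
  { apply (summable_freq_inv2 s Hs (fun k => q k t)).
    destruct (Bq t) as [a [Ha Hle]]. eapply ex_series_dominated; [|exact Ha].
    intros k. rewrite Rabs_pos_eq by apply (H_term_ge0 (s - 2) (fun k => q k t)).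
    apply Hle, near_self. }
  rewrite (weak_identity eta Heta (fun k => u k t) (fun k => q k t)) by assumption.
  rewrite RInt_zero; [ring|]. intros x _.
  unfold sine_series. rewrite Series_zero; [ring|]. intros k.
  rewrite tension_eq by exact H1.
  change (coupling * Series (fun k => (freq k * u k t) ^ 2)) with (stretch u t).
  unfold q. rewrite om_sqr by lra. assert (Hk := freq_ge1 k). field; lra.
Qed.

Theorem theorem2 (m s : R) (u0 v0 : nat -> R)
  (Hm_lo : - (1 / 2) <= m) (Hm_hi : m <= 1) (Hm_neq0 : m <> 0) (Hs : 1 / 2 < s)
  (Hu0 : in_H (s + 2) u0) (Hv0 : in_H s v0)
  (Heps : epsilon m u0 v0 <= eps1 m) :
  (exists (a b : Rbar) (u : R -> nat -> R),
      weak_solution m s a b u0 v0 u /\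
      forall t, within_time m (epsilon m u0 v0) t -> in_interval a b t) /\
  (forall (a b : Rbar) (u : R -> nat -> R),
      weak_solution m s a b u0 v0 u ->
      forall t, in_interval a b t -> within_time m (epsilon m u0 v0) t ->
        Rbar_le (sup_abs (fun_of (u t))) (21 / 10 * epsilon m u0 v0)).
Proof.
split.
- destruct (weak_solution_exists m s u0 v0) as [u Hu]; auto.
  exists m_infty, p_infty, u. split; [exact Hu|]. intros t _. split; exact I.
- intros a b u Hu t Ht Htime. now apply (weak_solution_sup_bound m s u0 v0 a b u).
Qed.
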